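(* For any $n\in\mathbb{N}$ and $m\in\{1,\ldots,n-1\}$, there is a Euclidean open subset $\mathcal{U}$ of $\mathbb{R}[X_1,\ldots,X_n]_2^m$, containing some tuple of positive definite forms, and an efficient algorithm for the following problem: If $Y$ is a mixture of $m$ centered Gaussian random variables on $\mathbb{R}^n$ with general positive definite covariance forms $(q_1,\ldots,q_m)\in\mathcal{U}$ and positive mixing weights $\lambda_1,\ldots,\lambda_m$, compute the set of parameters $\{(q_1,\lambda_1),\ldots,(q_m,\lambda_m)\}$ from the moments $\mathcal{M}_{\le 6}(Y)$ of $Y$ of degree at most $6$.
   Context: $\mathbb{R}[X]_2$ is the space of quadratic forms in $X=(X_1,\ldots,X_n)$. The covariance form of a centered (mean zero) Gaussian random vector on $\mathbb{R}^n$ with covariance matrix $\Sigma$ is $q=X^T\Sigma X$. A mixture $Y=\lambda_1Y_1\oplus\ldots\oplus\lambda_mY_m$ of random variables $Y_1,\ldots,Y_m$ with mixing weights $\lambda_i\ge0$, $\sum_i\lambda_i=1$, is the random variable obtained by drawing an index $i$ with probability $\lambda_i$ and then sampling $Y_i$. $\mathcal{M}_d(Y)$ denotes the degree-$d$ moment form of $Y$, i.e. the degree-$d$ homogeneous part of the moment generating series $\mathbb{E}[\exp(Y^TX)]$, and $\mathcal{M}_{\le6}(Y)$ is the collection of these for $d\le6$. ''General'' means: outside some proper Zariski closed subset of the space of $m$-tuples of quadratic forms. ''Efficient'' means: aside from calls to a semidefinite programming solver, which is treated as a blackbox, the algorithm uses only basic linear-algebraic operations on polynomially-sized quantities constructed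 from the input; numerical issues are ignored. *)

(* Defs.v *)
From HB Require Import structures.
From mathcomp Require Import all_boot all_order all_algebra.
From mathcomp Require Import all_classical all_reals all_analysis.
(* The notations of mpoly clash with those of MathComp-Analysis. *)
From mathcomp Require Import -(notations) mpoly.
Set Implicit Arguments.
Unset Strict Implicit.
Unset Printing Implicit Defensive.
Import Order.TTheory GRing.Theory Num.Theory.
Import numFieldNormedType.Exports.
Local Open Scope classical_set_scope.
Local Open Scope ring_scope.

(* R[X_1, ..., X_n]_2 *)
Notation quadform R n := (dhomog n R 2).

Definition cov_poly (R : realType) (n : nat) (S : 'M[R]_n) : mpoly n R :=
  \sum_(i < n) \sum_(j < n)
    S i j *: (mpolyX R (mnm1 i) * mpolyX R (mnm1 j)).

Lemma cov_poly_homog (R : realType) (n : nat) (S : 'M[R]_n) :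
  cov_poly S \is ishomog1 2 (@mdeg n).
Proof.
apply: rpred_sum => i _; apply: rpred_sum => j _; apply: rpredZ.
by apply: (@dhomogM _ _ _ 1 _ 1); rewrite dhomogX /= mdeg1.
Qed.

(* X^T S X *)
Definition cov_form (R : realType) (n : nat) (S : 'M[R]_n) : quadform R n :=
  DHomog (cov_poly_homog S).

Definition pos_def (R : realType) (n : nat) (q : quadform R n) : Prop :=
  forall v : 'I_n -> R, (exists i, v i != 0) -> 0 < meval v q.

Definition euclidean_open (R : realType) (n m : nat)
    (U : set ('I_m -> quadform R n)) : Prop :=
  forall q, U q -> exists2 e : R, 0 < e &
    forall q' : 'I_m -> quadform R n,
      (forall i (a : multinom n), `|mcoeff a (q' i) - mcoeff a (q i)| < e) ->
      U q'.

(* All coefficients of degree at most 2 are listed; those of degree different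
   from 2 vanish on quadratic forms, so they add no polynomial functions. *)
Definition tuple_coords (R : realType) (n m : nat) (q : 'I_m -> quadform R n)
    (k : 'I_#|{: 'I_m * bmultinom n 3}|) : R :=
  mcoeff (enum_val k).2 (q (enum_val k).1).

Definition zariski_closed (R : realType) (n m : nat)
    (Z : set ('I_m -> quadform R n)) : Prop :=
  exists I : set (mpoly #|{: 'I_m * bmultinom n 3}| R),
    Z = [set q | forall f, I f -> meval (tuple_coords q) f = 0].

Definition psd (R : realType) (n : nat) (S : 'M[R]_n) : Prop :=
  S^T = S /\ forall u : 'rV[R]_n, 0 <= (u *m S *m u^T) 0 0.

(* A random vector is centered Gaussian with covariance matrix S when each
   linear functional u of it has law N(0, u S u^T).  The second argument of
   normal_prob is the standard deviation, and normal_prob 0 0 is not the Dirac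
   measure, whence the case distinction. *)
Definition centered_gaussian (R : realType) (n : nat) (d : measure_display)
    (T : measurableType d) (P : probability T R)
    (X : {RV P >-> n.-tuple R}) (S : 'M[R]_n) : Prop :=
  psd S /\
  forall (u : 'rV[R]_n) (A : set R), measurable A ->
    let var := (u *m S *m u^T) 0 0 in
    P [set t | A (\sum_(i < n) u 0 i * tnth (X t) i)] =
    if var == 0 then \d_(0 : R) A else normal_prob 0 (Num.sqrt var) A.

(* Only the laws of the components and of the mixture matter. *)
Definition is_mixture (R : realType) (n m : nat) (d d' : measure_display)
    (T : measurableType d) (P : probability T R) (Y : {RV P >-> n.-tuple R})
    (T' : measurableType d') (P' : probability T' R)
    (Z : 'I_m -> {RV P' >-> n.-tuple R}) (lam : 'I_m -> R) : Prop :=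
  [/\ forall i, 0 <= lam i,
      \sum_(i < m) lam i = 1 &
      forall A : set (n.-tuple R), measurable A ->
        distribution P Y A =
        (\sum_(i < m) (lam i)%:E * distribution P' (Z i) A)%E].

(* The coefficient of X^a in E[exp(Y^T X)] is E[Y^a] / a!. *)
Definition moment_form (R : realType) (n : nat) (d : measure_display)
    (T : measurableType d) (P : probability T R) (Y : {RV P >-> n.-tuple R})
    (k : nat) : mpoly n R :=
  \sum_(a : bmultinom n k.+1 | mdeg a == k)
    (fine ('E_P[fun t => \prod_(i < n) tnth (Y t) i ^+ a i])
       / (\prod_(i < n) (a i)`!)%:R) *: mpolyX R a.

Record solvers (R : realType) := Solvers {
  (* a solution x of A x = b *)
  lin_solver : forall p k : nat, 'M[R]_(p, k) -> 'cV[R]_p -> 'cV[R]_k;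
  (* a basis of eigenvectors, as columns, and the eigenvalues *)
  eig_solver : forall k : nat, 'M[R]_k -> 'M[R]_k * 'rV[R]_k;
  (* a minimizer of <C, X> subject to <A_l, X> = b_l and X psd *)
  sdp_solver : forall p k : nat,
    ('I_p -> 'M[R]_k) -> 'cV[R]_p -> 'M[R]_k -> 'M[R]_k
}.

Definition eigenbasis (R : realType) (k : nat) (A : 'M[R]_k)
    (Vd : 'M[R]_k * 'rV[R]_k) : Prop :=
  Vd.1 \in unitmx /\ A *m Vd.1 = Vd.1 *m diag_mx Vd.2.

Definition sdp_feasible (R : realType) (p k : nat) (A : 'I_p -> 'M[R]_k)
    (b : 'cV[R]_p) (X : 'M[R]_k) : Prop :=
  psd X /\ forall l, \tr (A l *m X) = b l 0.

Definition sdp_optimal (R : realType) (p k : nat) (A : 'I_p -> 'M[R]_k)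
    (b : 'cV[R]_p) (C X : 'M[R]_k) : Prop :=
  sdp_feasible A b X /\
  forall X', sdp_feasible A b X' -> \tr (C *m X) <= \tr (C *m X').

(* Nothing is assumed about the answer on an instance without solution, nor
   about which solution is returned when there are several. *)
Definition correct_solvers (R : realType) (o : solvers R) : Prop :=
  [/\ forall p k (A : 'M[R]_(p, k)) (b : 'cV[R]_p),
        (exists x, A *m x = b) -> A *m lin_solver o A b = b,
      forall k (A : 'M[R]_k),
        (exists Vd, eigenbasis A Vd) -> eigenbasis A (eig_solver o A) &
      forall p k (A : 'I_p -> 'M[R]_k) (b : 'cV[R]_p) (C : 'M[R]_k),
        (exists X, sdp_optimal A b C X) ->
        sdp_optimal A b C (sdp_solver o A b C)].

(* Integer variables serve for indexing and loop control.  Data are real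
   numbers, stored in numbered arrays indexed by nat. *)
Inductive nexp :=
| NVar of nat
| NCst of nat
| NAdd of nexp & nexp
| NSub of nexp & nexp
| NMul of nexp & nexp
| NDiv of nexp & nexp
| NMod of nexp & nexp.

(* The only real constants are (images of) integer values. *)
Inductive rexp :=
| RGet of nat & nexp
| RNat of nexp
| RAdd of rexp & rexp
| ROpp of rexp
| RMul of rexp & rexp
| RInv of rexp.

Inductive bexp :=
| BLeN of nexp & nexp
| BLeR of rexp & rexp
| BNot of bexp
| BAnd of bexp & bexp.

Inductive prog :=
| Skip
| Seq of prog & prog
| SetN of nat & nexp
| SetR of nat & nexp & rexp
| If of bexp & prog & prog
(* For x e s runs s with x = 0, 1, ..., e - 1 *)
| For of nat & nexp & prog
(* Lin p k A b x : solve the p x k system A x = b *)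
| Lin of nexp & nexp & nat & nat & nat
(* Eig k A V d : diagonalize the k x k matrix A as V diag(d) V^-1 *)
| Eig of nexp & nat & nat & nat
(* Sdp p k A b C X : semidefinite program with p constraints in size k x k *)
| Sdp of nexp & nexp & nat & nat & nat & nat.

Record state (R : realType) := State {
  ints : nat -> nat;
  arrs : nat -> nat -> R;
  clock : nat
}.

Section Semantics.
Context {R : realType}.
Implicit Types (o : solvers R) (st : state R).

Fixpoint evalN st (e : nexp) : nat :=
  match e with
  | NVar x => ints st x
  | NCst c => c
  | NAdd e1 e2 => evalN st e1 + evalN st e2
  | NSub e1 e2 => evalN st e1 - evalN st e2
  | NMul e1 e2 => evalN st e1 * evalN st e2
  | NDiv e1 e2 => evalN st e1 %/ evalN st e2
  | NMod e1 e2 => evalN st e1 %% evalN st e2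
  end%N.

Fixpoint evalR st (e : rexp) : R :=
  match e with
  | RGet a i => arrs st a (evalN st i)
  | RNat i => (evalN st i)%:R
  | RAdd e1 e2 => evalR st e1 + evalR st e2
  | ROpp e1 => - evalR st e1
  | RMul e1 e2 => evalR st e1 * evalR st e2
  | RInv e1 => (evalR st e1)^-1
  end.

Fixpoint evalB st (e : bexp) : bool :=
  match e with
  | BLeN e1 e2 => (evalN st e1 <= evalN st e2)%N
  | BLeR e1 e2 => evalR st e1 <= evalR st e2
  | BNot e1 => ~~ evalB st e1
  | BAnd e1 e2 => evalB st e1 && evalB st e2
  end.

Definition tick (c : nat) st : state R :=
  State (ints st) (arrs st) (clock st + c)%N.

Definition set_int (x v : nat) st : state R :=
  State (fun y => if y == x then v else ints st y) (arrs st) (clock st).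

Definition set_arr (a : nat) (f : nat -> R) st : state R :=
  State (ints st) (fun b => if b == a then f else arrs st b) (clock st).

(* Matrices are stored in row-major order. *)
Definition get_mx st (a p k : nat) : 'M[R]_(p, k) :=
  \matrix_(i < p, j < k) arrs st a (i * k + j)%N.

Definition mx_arr (p k : nat) (M : 'M[R]_(p, k)) (c : nat) : R :=
  match insub (c %/ k)%N, insub (c %% k)%N with
  | Some i, Some j => M i j
  | _, _ => 0
  end.

(* The clock charges one unit per elementary instruction, loop iteration and
   test.  Setting an integer variable also costs the value stored, and a solver
   call costs the size of its instance, so that within a polynomial time budget
   all indices, matrix sizes and integer variables stay polynomially bounded.
   Expressions are part of the program text, hence of constant size. *)
Fixpoint exec o (s : prog) st {struct s} : state R :=
  match s with
  | Skip => st
  | Seq s1 s2 => exec o s2 (exec o s1 st)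
  | SetN x e => let v := evalN st e in tick (1 + v)%N (set_int x v st)
  | SetR a i e =>
      let c := evalN st i in let r := evalR st e in
      tick 1 (set_arr a (fun c' => if c' == c then r else arrs st a c') st)
  | If b s1 s2 => exec o (if evalB st b then s1 else s2) (tick 1 st)
  | For x e s1 =>
      foldl (fun st' i => exec o s1 (tick 1 (set_int x i st')))
        (tick 1 st) (iota 0%N (evalN st e))
  | Lin ep ek A b x =>
      let p := evalN st ep in let k := evalN st ek in
      tick (1 + p * k + p + k)%N (set_arr x
        (mx_arr (lin_solver o (get_mx st A p k) (get_mx st b p 1))) st)
  | Eig ek A V d =>
      let k := evalN st ek in
      let Vd := eig_solver o (get_mx st A k k) in
      tick (1 + k * k + k)%N
        (set_arr d (mx_arr Vd.2) (set_arr V (mx_arr Vd.1) st))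
  | Sdp ep ek A b C X =>
      let p := evalN st ep in let k := evalN st ek in
      let Al (l : 'I_p) : 'M[R]_k :=
        \matrix_(i < k, j < k) arrs st A ((l * k + i) * k + j)%N in
      tick (1 + p * k * k + p + k * k)%N (set_arr X
        (mx_arr (sdp_solver o Al (get_mx st b p 1) (get_mx st C k k))) st)
  end.

End Semantics.

(* X_(j_1) ... X_(j_k), where j_1, ..., j_k are the base n digits of c *)
Definition code_mnm (n k c : nat) : multinom n :=
  Multinom [tuple (\sum_(l < k) ((c %/ n ^ l) %% n == i))%N | i < n].

(* Integer variables 0 and 1 hold n and m.  For k <= 6, array k lists the
   coefficients of the form M k of degree k : cell number
   j_1 + j_2 n + ... + j_k n^(k-1) holds that of X_(j_1) ... X_(j_k). *)
Definition input_state (R : realType) (n m : nat) (M : nat -> mpoly n R) :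
    state R :=
  State (fun x => if x == 0 then n else if x == 1 then m else 0)%N
    (fun k c => if ((k <= 6) && (c < n ^ k))%N
                then mcoeff (code_mnm n k c) (M k) else 0) 0.

(* Array 7 lists m matrices of size n x n, one after the other, that represent
   quadratic forms; array 8 lists m weights. *)
Definition output (R : realType) (n m : nat) (st : state R) :
    set (quadform R n * R) :=
  [set (cov_form (\matrix_(i < n, j < n) arrs st 7 ((l * n + i) * n + j)%N),
        arrs st 8 l) | l in [set: 'I_m]].
Arguments output {R} n m st.

Definition polynomial_time (R : realType) (s : prog) : Prop :=
  exists c k : nat, forall (o : solvers R), correct_solvers o ->
    forall (n m : nat) (M : nat -> mpoly n R),
      (clock (exec o s (input_state m M)) <= c * (n + m).+1 ^ k)%N.

(* Main.v *)
Require Import Defs.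
From HB Require Import structures.
From mathcomp Require Import all_boot all_order all_algebra.
From mathcomp Require Import all_classical all_reals all_analysis.
From mathcomp Require Import -(notations) mpoly.
From mathcomp Require Import measurable_realfun ring lra zify.
Set Implicit Arguments.
Unset Strict Implicit.
Unset Printing Implicit Defensive.
Import Order.TTheory GRing.Theory Num.Theory.
Import numFieldNormedType.Exports.
Local Open Scope classical_set_scope.
Local Open Scope ring_scope.

(* Write H_i = S_i - sum_j lam_j S_j.  The moments of degree 2 and 4 determine the
   quartic form sum_i lam_i H_i(x)^2, that is, the values at all pairs
   (x^T x, x^T x) of the bilinear form sum_i lam_i H_i (x) H_i on symmetric
   matrices.  For covariance matrices near a suitable tuple this form is the only
   positive semidefinite one with these values: on a finite grid there is a linear
   functional that vanishes on all products H_k H_l and H_k e, where the e span a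
   complement of span(H_k), and is positive definite on the products e e'; this
   forces any solution to live on span(H_k), and there it is determined because
   the products H_k H_l are linearly independent.  A semidefinite feasibility
   problem therefore finds it, whence also sum_i lam_i S_i (x) b_i with
   b_i = S_i e_0.  The moments E[Y_0^4 Y_j Y_k] then give
   sum_i lam_i a_i b_i b_i^T with a_i = (S_i)_00, and one diagonalization separates
   the components.  The argument works on a whole open set, so the exceptional
   closed set can be empty. *)

(** * Uniqueness of positive semidefinite forms *)

(** Moments of degree 4 see sum_i lam_i H_i (x) H_i only after full symmetrization, where x_a x_b
    (x) x_c x_d and x_a x_c (x) x_b x_d become the same quartic; positivity has to remove this
    ambiguity. The certificate comes from the pencil of the forms x_k^2 - x_0^2. It vanishes on the
    sign vectors, so averaging over them kills every product with a member of the pencil, while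
    x_0^2 and the x_a x_b with a < b are orthonormal for this average. The certificate has to
    survive perturbation. Its vanishing conditions are linear equations in the weights of the grid
    points. When the products that must vanish are linearly independent on the grid, these equations
    have full rank and a solution moves continuously. On sign vectors alone all these products are
    zero, so the grid also needs coordinates of absolute value 2 and 3; the perturbed weights may be
    negative. Degree 6 enters because M_2 = sum_i lam_i b_i b_i^T alone does not determine the b_i.
    A second matrix with the same vectors and weights lam_i a_i does, provided that the a_i are
    nonzero and distinct. *)

Section PsdForm.
Variables (R : realFieldType) (V : lmodType R) (X : V -> V -> R).

Record psd_form : Prop := PsdForm {
  psd_formC : forall A B, X A B = X B A;
  psd_formP : forall a A A' B, X (a *: A + A') B = a * X A B + X A' B;
  psd_form_ge0 : forall A, 0 <= X A A }.

Hypothesis HX : psd_form.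

Lemma psd_formD A A' B : X (A + A') B = X A B + X A' B.
Proof. by rewrite -[A]scale1r psd_formP// mul1r scale1r. Qed.

Lemma psd_form0 B : X 0 B = 0.
Proof. by apply: (addrI (X 0 B)); rewrite -psd_formD !addr0. Qed.

Lemma psd_formZ a A B : X (a *: A) B = a * X A B.
Proof. by rewrite -[a *: A]addr0 psd_formP// psd_form0 addr0. Qed.

Lemma psd_form_sum (I : finType) (p : pred I) (F : I -> V) B :
  X (\sum_(i | p i) F i) B = \sum_(i | p i) X (F i) B.
Proof.
by elim/big_rec2: _ => [|i u v _ <-]; [exact: psd_form0|rewrite psd_formD].
Qed.

Lemma psd_form_comb (I : finType) (p : pred I) (f : I -> R) (F : I -> V) B :
  X (\sum_(i | p i) f i *: F i) B = \sum_(i | p i) f i * X (F i) B.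
Proof. by rewrite psd_form_sum; apply: eq_bigr => i _; rewrite psd_formZ. Qed.

Lemma psd_form_sqr t A B :
  X (t *: A + B) (t *: A + B) = t ^+ 2 * X A A + 2 * t * X A B + X B B.
Proof.
rewrite psd_formP// (psd_formC HX A) (psd_formC HX B (_ + _)) !psd_formP//.
by rewrite (psd_formC HX B A); ring.
Qed.

(** On the line t A + B the form is affine in t with slope 2 X A B; a nonzero slope would let some t
    bring it down to -1. *)
Lemma psd_form_isotropic A B : X A A = 0 -> X A B = 0.
Proof.
move=> A0; apply/eqP; apply/negPn/negP => AB0.
have := psd_form_ge0 HX (- (X B B + 1) / (2 * X A B) *: A + B).
rewrite psd_form_sqr A0 [X in 0 <= X](_ : _ = -1); last by field.
by rewrite lerNr oppr0 ler10.
Qed.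

Lemma psd_form_norm A B : `|X A B| <= (X A A + X B B) / 2.
Proof.
have := psd_form_ge0 HX (1 *: A + B); have := psd_form_ge0 HX (- 1 *: A + B).
rewrite !psd_form_sqr => h1 h2.
by rewrite ler_norml; apply/andP; split; lra.
Qed.

End PsdForm.

Section GramUnique.
Variables (R : realFieldType) (V : lmodType R) (X : V -> V -> R).
Hypothesis HX : psd_form X.
Variables (Pt : Type) (p : Pt -> V) (K E Q : finType) (PK : pred K) (PE : pred E).
Variables (hs : K -> V) (es : E -> V) (hf : K -> Pt -> R) (ef : E -> Pt -> R).
(** In the application [p x] is the matrix x^T x, and [hs], [es] are dual to the quadratic forms
    [hf], [ef]. The weights [c] may have any sign. *)
Hypothesis dual : forall x, p x =
  \sum_(k | PK k) hf k x *: hs k + \sum_(e | PE e) ef e x *: es e.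
Variables (pt : Q -> Pt) (c : Q -> R) (eps : R).
Hypothesis c_hh : forall k l, PK k -> PK l ->
  \sum_q c q * (hf k (pt q) * hf l (pt q)) = 0.
Hypothesis c_he : forall k e, PK k -> PE e ->
  \sum_q c q * (hf k (pt q) * ef e (pt q)) = 0.
Hypothesis c_ee : forall e f, PE e -> PE f ->
  `|\sum_q c q * (ef e (pt q) * ef f (pt q)) - (e == f)%:R| <= eps.
Hypothesis eps_small : eps * #|E|%:R < 1.
Hypothesis hh_free : forall a : K -> K -> R,
  (forall q, \sum_(k | PK k) \sum_(l | PK l)
     a k l * (hf k (pt q) * hf l (pt q)) = 0) ->
  forall k l, PK k -> PK l -> a k l + a l k = 0.
Variable M : K -> K -> R.
Hypothesis M_sym : forall k l, M k l = M l k.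
Hypothesis XM : forall x, X (p x) (p x) =
  \sum_(k | PK k) \sum_(l | PK l) M k l * (hf k x * hf l x).

Let XE x y : X (p x) (p y) =
  \sum_(k | PK k) \sum_(l | PK l) hf k x * hf l y * X (hs k) (hs l)
  + \sum_(k | PK k) \sum_(e | PE e) hf k x * ef e y * X (hs k) (es e)
  + \sum_(k | PK k) \sum_(e | PE e) hf k y * ef e x * X (hs k) (es e)
  + \sum_(e | PE e) \sum_(f | PE f) ef e x * ef f y * X (es e) (es f).
Proof.
have XC := psd_formC HX.
have E1 B : X (p x) B = \sum_(k | PK k) hf k x * X (hs k) B
    + \sum_(e | PE e) ef e x * X (es e) B.
  by rewrite dual (psd_formD HX) !(psd_form_comb HX).
have E2 A : X A (p y) = \sum_(k | PK k) hf k y * X A (hs k)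
    + \sum_(e | PE e) ef e y * X A (es e).
  rewrite XC dual (psd_formD HX) !(psd_form_comb HX)//.
  by congr (_ + _); apply: eq_bigr => i _; rewrite XC.
rewrite E1 -[RHS]addrA; congr (_ + _).
  under eq_bigr do rewrite E2 mulrDr !big_distrr/=.
  by rewrite big_split/=; congr (_ + _);
    apply: eq_bigr => k _; apply: eq_bigr => l _; rewrite mulrA.
under eq_bigr do rewrite E2 mulrDr !big_distrr/=.
rewrite big_split/=; congr (_ + _).
  rewrite exchange_big/=; apply: eq_bigr => k _; apply: eq_bigr => e _.
  by rewrite (XC (es e)); ring.
by apply: eq_bigr => k _; apply: eq_bigr => l _; rewrite mulrA.
Qed.

(** Apply the functional [c] to both expressions of the quartic x -> X (p x) (p x): the products
    [hf hf] and [hf ef] die, and only the block of the [es] survives. *)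
Let sum_PX : \sum_(e | PE e) \sum_(f | PE f)
  (\sum_q c q * (ef e (pt q) * ef f (pt q))) * X (es e) (es f) = 0.
Proof.
have h1 : \sum_q c q * X (p (pt q)) (p (pt q)) = 0.
  under eq_bigr do rewrite XM big_distrr/=.
  rewrite exchange_big/= big1// => k kK.
  under eq_bigr do rewrite big_distrr/=.
  rewrite exchange_big/= big1// => l lK.
  rewrite -(@eq_bigr _ _ _ _ _ _ (fun q => M k l * (c q * (hf k (pt q) * hf l (pt q))))).
    by rewrite -big_distrr/= c_hh// mulr0.
  by move=> q _; ring.
rewrite -[RHS]h1 {h1}; under [RHS]eq_bigr do rewrite XE !mulrDr !big_distrr/=.
rewrite !big_split/= [X in _ = X + _ + _ + _]exchange_big/= [X in _ = _ + X + _ + _]exchange_big/=.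
rewrite [X in _ = _ + _ + X + _]exchange_big/= [X in _ = _ + _ + _ + X]exchange_big/=.
rewrite [X in _ = X + _ + _ + _]big1 ?add0r; last first.
  move=> k kK; under eq_bigr do rewrite big_distrr/=.
  rewrite exchange_big/= big1// => l lK.
  rewrite -(@eq_bigr _ _ _ _ _ _ (fun q => c q * (hf k (pt q) * hf l (pt q)) * X (hs k) (hs l))).
    by rewrite -big_distrl/= c_hh// mul0r.
  by move=> q _; ring.
rewrite [X in _ = X + _ + _]big1 ?add0r; last first.
  move=> k kK; under eq_bigr do rewrite big_distrr/=.
  rewrite exchange_big/= big1// => l lK.
  rewrite -(@eq_bigr _ _ _ _ _ _ (fun q => c q * (hf k (pt q) * ef l (pt q)) * X (hs k) (es l))).
    by rewrite -big_distrl/= c_he// mul0r.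
  by move=> q _; ring.
rewrite [X in _ = X + _]big1 ?add0r; last first.
  move=> k kK; under eq_bigr do rewrite big_distrr/=.
  rewrite exchange_big/= big1// => l lK.
  rewrite -(@eq_bigr _ _ _ _ _ _ (fun q => c q * (hf k (pt q) * ef l (pt q)) * X (hs k) (es l))).
    by rewrite -big_distrl/= c_he// mul0r.
  by move=> q _; ring.
apply: eq_bigr => e _; under [RHS]eq_bigr do rewrite big_distrr/=.
rewrite [RHS]exchange_big/=; apply: eq_bigr => f _.
by rewrite big_distrl/=; apply: eq_bigr => q _; ring.
Qed.

Let eps_ge0 e : PE e -> 0 <= eps.
Proof. by move=> eE; apply: le_trans (c_ee eE eE); rewrite normr_ge0. Qed.

(** The Gram matrix of the [es] pairs to zero with a matrix that is within eps of the identity. Its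
    entries are bounded by its diagonal, so its trace t satisfies t <= eps * #|E| * t, which forces
    t = 0. *)
Let es_isotropic e : PE e -> X (es e) (es e) = 0.
Proof.
move=> eE; have eps0 := eps_ge0 eE.
pose t := \sum_(e | PE e) X (es e) (es e).
have X0 f : 0 <= X (es f) (es f) by exact: psd_form_ge0.
have t0 : 0 <= t by apply: sumr_ge0 => f _.
suff t_le0 : t <= 0.
  apply/eqP; have : t == 0 by rewrite eq_le t_le0 t0.
  by rewrite psumr_eq0// => /allP/(_ e); rewrite mem_index_enum eE => /(_ isT).
have : t <= eps * #|E|%:R * t.
  have tE : t = - \sum_(e | PE e) \sum_(f | PE f)
     (\sum_q c q * (ef e (pt q) * ef f (pt q)) - (e == f)%:R) * X (es e) (es f).
    transitivity (- (0 - t)); first by rewrite sub0r opprK.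
    rewrite -[in LHS]sum_PX; congr (- _).
    rewrite /t -sumrB; apply: eq_bigr => e' e'E.
    under [RHS]eq_bigr do rewrite mulrBl.
    rewrite sumrB; congr (_ - _); rewrite (bigD1 e')//= eqxx mul1r big1 ?addr0//.
    by move=> f /andP[_ /negPf]; rewrite eq_sym => ->; rewrite mul0r.
  rewrite [leLHS]tE (le_trans (ler_norm _))// normrN (le_trans (ler_norm_sum _ _ _))//.
  apply: (@le_trans _ _ (\sum_(e | PE e) \sum_(f | PE f)
     eps * ((X (es e) (es e) + X (es f) (es f)) / 2))).
    apply: ler_sum => a aE; rewrite (le_trans (ler_norm_sum _ _ _))//.
    apply: ler_sum => b bE; rewrite normrM ler_pM ?c_ee//.
    exact: psd_form_norm.
  rewrite -/t [leLHS](_ : _ = eps * (#|PE|%:R * t)); last first.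
    under eq_bigr do rewrite -big_distrr/= -big_distrl/= big_split/= sumr_const.
    rewrite -big_distrr/= -big_distrl/= big_split/= sumr_const sumrMnl -/t.
    by rewrite -[t *+ _]mulr_natl; field.
  rewrite -[leRHS]mulrA; apply: ler_wpM2l => //; apply: ler_wpM2r => //.
  by rewrite ler_nat max_card.
rewrite -subr_ge0 -[X in _ - X]mul1r -mulrBl.
rewrite nmulr_rge0 ?subr_lt0//.
Qed.

(** Isotropic vectors lie in the radical of X, so X only depends on the [hs] coordinates. There the
    quartic determines a symmetric matrix, because the products [hf hf] are independent on the
    grid. *)
Lemma gram_unique x y : X (p x) (p y) =
  \sum_(k | PK k) \sum_(l | PK l) M k l * (hf k x * hf l y).
Proof.
have Xe e B : PE e -> X B (es e) = 0.
  by move=> eE; rewrite (psd_formC HX) psd_form_isotropic// es_isotropic.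
have XhE x' y' : X (p x') (p y') =
    \sum_(k | PK k) \sum_(l | PK l) hf k x' * hf l y' * X (hs k) (hs l).
  rewrite XE -!addrA -[RHS]addr0; congr (_ + _).
  rewrite !big1 ?addr0// => k kK; rewrite big1// => e eE; by rewrite Xe ?mulr0.
rewrite XhE; apply: eq_bigr => k kK; apply: eq_bigr => l lK; rewrite mulrC.
congr (_ * _); apply/eqP; rewrite -subr_eq0; apply/eqP.
pose a k l := X (hs k) (hs l) - M k l.
have : a k l + a l k = 0.
  apply: hh_free => // q; rewrite -[RHS](subrr (X (p (pt q)) (p (pt q)))).
  rewrite {1}XhE XM -sumrB; apply: eq_bigr => i _.
  by rewrite -sumrB; apply: eq_bigr => j _; rewrite /a; ring.
by rewrite /a (psd_formC HX (hs l)) M_sym; lra.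
Qed.

End GramUnique.

(** * Stability of kernels of matrices with independent rows *)

Lemma near1_bound (R : realFieldType) N (K : 'M[R]_N) (y : 'cV[R]_N) kap z :
  (forall i j, `|K i j| <= kap) -> kap * N%:R <= 2^-1 ->
  (forall i, `|((1%:M + K) *m y) i 0| <= z) -> forall i, `|y i 0| <= 2 * z.
Proof.
move=> Kk kN yz i.
(* At a coordinate of largest absolute value, K y is at most half as large as y. *)
pose i0 := [arg max_(j > i) `|y j 0|]%O.
have i0P j : `|y j 0| <= `|y i0 0|.
  by rewrite /i0; case: arg_maxP => // j' _; exact.
apply: le_trans (i0P i) _.
have Ky : `|(K *m y) i0 0| <= 2^-1 * `|y i0 0|.
  rewrite mxE (le_trans (ler_norm_sum _ _ _))//.
  apply: (@le_trans _ _ (\sum_(j < N) kap * `|y i0 0|)).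
    by apply: ler_sum => j _; rewrite normrM ler_pM.
  rewrite sumr_const card_ord -[X in X <= _]mulr_natr mulrAC ler_wpM2r//.
have := yz i0; rewrite mulmxDl mul1mx mxE => h.
have h2 : `|y i0 0| <= `|y i0 0 + (K *m y) i0 0| + `|(K *m y) i0 0|.
  by rewrite -[X in `|X| <= _](addrK ((K *m y) i0 0)) (le_trans (ler_normB _ _)).
lra.
Qed.

Lemma near1_unit (R : realFieldType) N (K : 'M[R]_N) kap :
  (forall i j, `|K i j| <= kap) -> kap * N%:R <= 2^-1 -> 1%:M + K \in unitmx.
Proof.
move=> Kk kN; rewrite -unitmx_tr -row_free_unit -kermx_eq0; apply/eqP/row_matrixP => i.
rewrite row0; apply/rowP => j; rewrite [RHS]mxE.
set u := row i _; have : u *m (1%:M + K)^T = 0.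
  by apply/sub_kermxP; exact: row_sub.
move=> /(congr1 trmx); rewrite trmx_mul trmxK trmx0 => h.
have := @near1_bound _ _ _ u^T kap 0 Kk kN.
rewrite h mulr0 => hb.
have := hb (fun k => _) j; rewrite [u^T _ _]mxE normr_le0 => hj; apply/eqP/hj => k.
by rewrite mxE normr0.
Qed.

Section Perturbation.
Variables (R : realFieldType) (J Q : finType).
Implicit Types A : J -> Q -> R.

Definition rows_free A := forall b : J -> R,
  (forall q, \sum_j b j * A j q = 0) -> forall j, b j = 0.

Let toM A : 'M[R]_(#|J|, #|Q|) := \matrix_(i, q) A (enum_val i) (enum_val q).

Let sum_enum_rank (T : finType) (F : 'I_#|T| -> R) :
  \sum_(i < #|T|) F i = \sum_t F (enum_rank t).
Proof. by rewrite (reindex _ (onW_bij _ (@enum_rank_bij T))). Qed.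

Let sum_enum_val (T : finType) (F : T -> R) :
  \sum_t F t = \sum_(i < #|T|) F (enum_val i).
Proof. by rewrite sum_enum_rank; apply: eq_bigr => t _; rewrite enum_rankK. Qed.

Let rows_free_rinv A : rows_free A -> exists B, toM A *m B = 1%:M.
Proof.
move=> Af; apply/row_freeP; rewrite -kermx_eq0; apply/eqP/row_matrixP => i.
rewrite row0; set u := row i _.
have uA : u *m toM A = 0 by apply/sub_kermxP; exact: row_sub.
apply/rowP => j; rewrite [RHS]mxE -[j]enum_valK.
apply: (Af (fun j => u 0 (enum_rank j))) => q.
have := congr1 (fun M : 'rV_#|Q| => M 0 (enum_rank q)) uA.
rewrite !mxE => uq; rewrite -[RHS]uq sum_enum_rank; apply: eq_bigr => k _.
by rewrite !mxE !enum_rankK.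
Qed.

Let toM_rows_free A B : toM A *m B = 1%:M -> rows_free A.
Proof.
move=> AB b bA j.
have : (\row_i b (enum_val i)) *m toM A = 0.
  apply/rowP => q; rewrite !mxE -[RHS](bA (enum_val q)) [RHS]sum_enum_val.
  by apply: eq_bigr => i _; rewrite !mxE.
move=> /(congr1 (mulmx^~ B)); rewrite -mulmxA AB mulmx1 mul0mx.
by move=> /rowP/(_ (enum_rank j)); rewrite !mxE enum_rankK.
Qed.

(** Let B be a right inverse of A0. Then A B is close to the identity, so B (A B)^-1 is a right
    inverse of A, and c0 - B (A B)^-1 A c0 lies in the kernel of A. The correction is small because
    A c0 = (A - A0) c0. *)
Lemma kernel_perturb A0 (c0 : Q -> R) eps : rows_free A0 ->
    (forall j, \sum_q A0 j q * c0 q = 0) -> 0 < eps ->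
  exists2 del, 0 < del & forall A, (forall j q, `|A j q - A0 j q| <= del) ->
    rows_free A /\ exists2 c : Q -> R, forall j, \sum_q A j q * c q = 0 &
      forall q, `|c q - c0 q| <= eps.
Proof.
move=> /rows_free_rinv[B A0B] A0c0 eps0.
pose b := \sum_(i < #|Q|) \sum_(j < #|J|) `|B i j|.
pose s := \sum_q `|c0 q|.
have b0 : 0 <= b by do 2! apply: sumr_ge0 => ? _.
have s0 : 0 <= s by apply: sumr_ge0.
(* The first term makes A B invertible by [near1_unit], the second keeps the correction of [c0]
   below eps, and the 1 makes D positive. *)
pose D := 2 * b * #|J|%:R + 2 * b * s / eps + 1.
have D0 : 0 < D.
  rewrite ltr_wpDl// addr_ge0// ?divr_ge0 ?mulr_ge0 ?ler0n ?(ltW eps0)//.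
exists D^-1; first by rewrite invr_gt0.
move=> A AA0.
pose K := (toM A - toM A0) *m B.
have Kb i j : `|K i j| <= D^-1 * b.
  rewrite mxE (le_trans (ler_norm_sum _ _ _))//.
  apply: (@le_trans _ _ (\sum_(k < #|Q|) D^-1 * `|B k j|)).
    apply: ler_sum => k _; rewrite normrM ler_wpM2r//.
    by rewrite !mxE; exact: AA0.
  rewrite -big_distrr/= ler_wpM2l ?invr_ge0 ?(ltW D0)//.
  by apply: ler_sum => k _; rewrite (bigD1 j)//= lerDl sumr_ge0.
have KN : D^-1 * b * #|J|%:R <= 2^-1.
  rewrite -mulrA mulrC ler_pdivrMr// [leRHS]mulrC.
  have : 0 <= 2 * b * s / eps by rewrite divr_ge0 ?mulr_ge0// ltW.
  rewrite /D; lra.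
have ABK : toM A *m B = 1%:M + K by rewrite /K mulmxBl A0B addrC subrK.
have Ku := near1_unit Kb KN.
split.
  by apply: (@toM_rows_free _ (B *m invmx (1%:M + K))); rewrite mulmxA ABK mulmxV.
pose c0v : 'cV[R]_#|Q| := \col_q c0 (enum_val q).
pose y := invmx (1%:M + K) *m (toM A *m c0v).
pose c := c0v - B *m y.
have Ac : toM A *m c = 0.
  by rewrite mulmxBr mulmxA ABK /y mulmxA mulmxV// mul1mx subrr.
have A0c : toM A0 *m c0v = 0.
  apply/colP => j; rewrite !mxE -[RHS](A0c0 (enum_val j)) [RHS]sum_enum_val.
  by apply: eq_bigr => q _; rewrite !mxE.
have yb i : `|y i 0| <= 2 * (D^-1 * s).
  apply: (near1_bound Kb KN) => {}i; rewrite /y mulmxA mulmxV// mul1mx.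
  rewrite -[toM A](subrK (toM A0)) mulmxDl A0c addr0 mxE.
  rewrite (le_trans (ler_norm_sum _ _ _))// /s [X in _ <= _ * X]sum_enum_val big_distrr/=.
  apply: ler_sum => q _; rewrite normrM !mxE ler_wpM2r//; exact: AA0.
exists (fun q => c (enum_rank q) 0) => [j|q].
  have := congr1 (fun M : 'cV_#|J| => M (enum_rank j) 0) Ac.
  rewrite [X in X = _]mxE [X in _ = X]mxE => cj; rewrite -[RHS]cj sum_enum_rank.
  apply: eq_bigr => q _.
  by rewrite [toM _ _ _]mxE !enum_rankK.
rewrite 2!mxE enum_rankK addrAC subrr add0r 2!mxE normrN (le_trans (ler_norm_sum _ _ _))//.
apply: (@le_trans _ _ (\sum_(k < #|J|) `|B (enum_rank q) k| * (2 * (D^-1 * s)))).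
  by apply: ler_sum => k _; rewrite normrM ler_wpM2l.
rewrite -big_distrl/=; apply: (@le_trans _ _ (b * (2 * (D^-1 * s)))).
  rewrite ler_wpM2r ?mulr_ge0 ?invr_ge0 ?(ltW D0)//.
  by rewrite /b (bigD1 (enum_rank q))//= lerDl; do 2! apply: sumr_ge0 => ? _.
rewrite (_ : b * _ = (2 * b * s) / D); last by ring.
rewrite ler_pdivrMr// /D mulrDr mulrDr.
rewrite [X in _ + X + _](_ : _ = 2 * b * s); last by field; rewrite gt_eqF.
have : 0 <= eps * (2 * b * #|J|%:R).
  by apply: mulr_ge0; [exact: ltW|rewrite !mulr_ge0].
by rewrite mulr1; lra.
Qed.

End Perturbation.

(** * Quadratic forms and averages over sign vectors *)

Section QuadraticForms.
Variables (R : realFieldType) (n : nat).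
Implicit Types (A B : 'M[R]_n) (x y u v w : 'rV[R]_n).

Definition qform A x := (x *m A *m x^T) 0 0.

Lemma qformE A x : qform A x = \sum_i \sum_j A i j * (x 0 i * x 0 j).
Proof.
rewrite /qform mxE exchange_big/=; apply: eq_bigr => j _.
by rewrite mxE big_distrl/=; apply: eq_bigr => i _; rewrite mxE; ring.
Qed.

Let addmxE (M N : 'M[R]_1) : (M + N) 0 0 = M 0 0 + N 0 0.
Proof. by rewrite mxE. Qed.

Let oppmxE (M : 'M[R]_1) : (- M) 0 0 = - M 0 0.
Proof. by rewrite mxE. Qed.

(** The alternating sum over the signs of v and w keeps only what is odd in both, so u and all
    squares drop out. Off-diagonal coefficients are read off grid values in this way. *)
Lemma qform_second_diff A u v w :
  qform A (u + v + w) - qform A (u + v - w) - qform A (u - v + w)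
    + qform A (u - v - w)
  = 4 * ((v *m A *m w^T) 0 0 + (w *m A *m v^T) 0 0).
Proof.
have trD (a b : 'rV[R]_n) : (a + b)^T = a^T + b^T by exact: linearD.
have trN (a : 'rV[R]_n) : (- a)^T = - a^T by exact: linearN.
rewrite /qform !(trD, trN) !(mulmxDl, mulmxDr, mulNmx, mulmxN).
by rewrite !(addmxE, oppmxE); ring.
Qed.

Lemma qformD A B x : qform (A + B) x = qform A x + qform B x.
Proof. by rewrite /qform mulmxDr mulmxDl mxE. Qed.

Lemma qformZ a A x : qform (a *: A) x = a * qform A x.
Proof. by rewrite /qform -scalemxAr -scalemxAl mxE. Qed.

Lemma qformN A x : qform (- A) x = - qform A x.
Proof. by rewrite /qform mulmxN mulNmx mxE. Qed.

Lemma qform0 x : qform 0 x = 0.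
Proof. by rewrite /qform mulmx0 mul0mx mxE. Qed.

Lemma qform_sum (T : finType) (P : pred T) (F : T -> 'M[R]_n) x :
  qform (\sum_(i | P i) F i) x = \sum_(i | P i) qform (F i) x.
Proof.
by elim/big_rec2: _ => [|i s A _ <-]; [exact: qform0|rewrite qformD].
Qed.

Lemma qform_delta A (a b : 'I_n) (s t : R) :
  ((s *: delta_mx 0 a : 'rV_n) *m A *m (t *: delta_mx 0 b : 'rV_n)^T) 0 0 =
  s * t * A a b.
Proof.
have E : (delta_mx (0 : 'I_1) a *m A *m delta_mx b (0 : 'I_1)) 0 0 = A a b.
  by rewrite -rowE -colE !mxE.
by rewrite linearZ/= trmx_delta -scalemxAl -scalemxAl -scalemxAr 2!mxE E mulrA.
Qed.

End QuadraticForms.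

Section SignGrid.
Variables (R : realFieldType) (n : nat).
Local Notation I := 'I_n.+1.

(** The coordinates -1 and 1 carry the unperturbed functional; those of absolute value 2 and 3 serve
    the linear independence of the products [prod_fun]. *)
Definition grid := {ffun I -> 'I_7}.
Definition grid_pt (q : grid) : 'rV[R]_n.+1 := \row_j ((q j)%:R - 3).

(** Cells 2 and 4 are the coordinates -1 and 1, so the product weight is the uniform distribution on
    the sign vectors. *)
Let wt (v : 'I_7) : R := if (v == 2 :> nat) || (v == 4 :> nat) then 2^-1 else 0.

Definition sign_weight (q : grid) : R := \prod_j wt (q j).

Let sum_wt e : \sum_v wt v * (v%:R - 3) ^+ e = (~~ odd e)%:R.
Proof.
rewrite !big_ord_recl big_ord0 /wt/= !mul0r !add0r !addr0.
rewrite (_ : 2 - 3 = -1); last by ring.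
rewrite (_ : 4 - 3 = 1); last by ring.
by rewrite expr1n -signr_odd; case: (odd e); rewrite /= ?expr1 ?expr0; field.
Qed.

Lemma sign_moment (e : I -> nat) :
  \sum_q sign_weight q * \prod_j grid_pt q 0 j ^+ e j = \prod_j (~~ odd (e j))%:R.
Proof.
under [RHS]eq_bigr do rewrite -sum_wt.
rewrite bigA_distr_bigA/=; apply: eq_bigr => q _.
rewrite /sign_weight -big_split/=; apply: eq_bigr => j _.
by rewrite mxE.
Qed.

Let coord_prod (x : 'rV[R]_n.+1) a : x 0 a = \prod_j x 0 j ^+ (j == a).
Proof.
rewrite (bigD1 a)//= eqxx big1 ?mulr1// => j /negPf ->.
by rewrite expr0.
Qed.

(** All squares agree on sign vectors and x_0^2 represents them; the monomials kept here restrict to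
    distinct Walsh functions. *)
Definition sign_basis (p : I * I) := (p.1 < p.2)%N || (p == (ord0, ord0)).

Definition monomial2 (p : I * I) (x : 'rV[R]_n.+1) := x 0 p.1 * x 0 p.2.

(** In the product of two different monomials of [sign_basis] some variable has odd degree, so its
    average over the signs is zero. *)
Let odd_letter (a b c d : nat) :
  (a < b)%N || (a == 0) && (b == 0) -> (c < d)%N || (c == 0) && (d == 0) ->
  ~~ ((a == c) && (b == d)) ->
  [|| odd ((a == a) + (a == b) + (a == c) + (a == d)),
      odd ((b == a) + (b == b) + (b == c) + (b == d)),
      odd ((c == a) + (c == b) + (c == c) + (c == d)) |
      odd ((d == a) + (d == b) + (d == c) + (d == d))].
Proof.
rewrite !oddD !eqxx !oddb.
case: (eqVneq a b) => ab; case: (eqVneq a c) => ac; case: (eqVneq a d) => ad;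
  case: (eqVneq b c) => bc; case: (eqVneq b d) => bd;
  case: (eqVneq c d) => cd //=; lia.
Qed.

Lemma sign_orthonormal p p' : sign_basis p -> sign_basis p' ->
  \sum_q sign_weight q * (monomial2 p (grid_pt q) * monomial2 p' (grid_pt q))
  = (p == p')%:R.
Proof.
case: p p' => [a b] [c d] /= hp hp'.
pose e (j : I) := ((j == a) + (j == b) + (j == c) + (j == d))%N.
transitivity (\sum_q sign_weight q * \prod_j grid_pt q 0 j ^+ e j).
  apply: eq_bigr => q _; congr (_ * _); rewrite /monomial2/=.
  rewrite (coord_prod _ a) (coord_prod _ b) (coord_prod _ c) (coord_prod _ d).
  by rewrite -!big_split/=; apply: eq_bigr => j _; rewrite /e !exprD !mulrA.
rewrite sign_moment; case: eqVneq => [[ac bd]|pp'].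
  rewrite /e ac bd big1// => j _.
  by case: (j == c); case: (j == d).
have [j ej] : exists j, odd (e j).
  have {pp'} : ~~ ((a == c) && (b == d)) by rewrite -xpair_eqE.
  move: hp hp'; rewrite /sign_basis/= !xpair_eqE /e -!val_eqE/=.
  move=> hab hcd pp'; have := odd_letter hab hcd pp'.
  by case/or4P => ?; [exists a|exists b|exists c|exists d].
by rewrite (bigD1 j)//= ej mul0r.
Qed.

Lemma sign_weight_support q j : sign_weight q != 0 ->
  grid_pt q 0 j ^+ 2 = 1.
Proof.
rewrite /sign_weight prodf_seq_neq0 => /allP/(_ j); rewrite mem_index_enum => /(_ isT)/=.
rewrite /wt mxE; case: ifP => [/orP[] /eqP -> _|]; last by rewrite eqxx.
- by ring.
- by ring.
Qed.

Lemma grid_ptP (x : 'rV[R]_n.+1) :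
  (forall j, exists v : 'I_7, x 0 j = v%:R - 3) -> exists q, grid_pt q = x.
Proof.
move=> /(@fin_all_exists _ _ _)[f fE].
exists [ffun j => f j]; apply/rowP => j; by rewrite mxE ffunE fE.
Qed.

End SignGrid.

(** * Forms near the pencil vanishing on sign vectors *)

Section Cube.
Variables (R : realFieldType) (n : nat).
Local Notation I := 'I_n.+1.

(* Its common zeros are the lines through the sign vectors. *)
Definition cube_form (k : I) : 'M[R]_n.+1 := delta_mx k k - delta_mx ord0 ord0.

Lemma qform_cube k x : qform (cube_form k) x = x 0 k ^+ 2 - x 0 ord0 ^+ 2.
Proof.
have E a : qform (delta_mx a a : 'M[R]_n.+1) x = x 0 a ^+ 2.
  rewrite qformE (bigD1 a)//= (bigD1 a)//= mxE !eqxx mul1r big1 ?addr0; last first.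
    by move=> j /negPf ja; rewrite mxE ja andbF mul0r.
  rewrite big1 ?addr0// => i /negPf ia; rewrite big1// => j _.
  by rewrite mxE ia mul0r.
by rewrite qformD qformN !E.
Qed.

(** For h = [cube_form], the pairs with p.1 <= p.2 index a basis of the quadratic forms in which
    members of the pencil replace the squares other than x_0^2. *)
Definition gen_fun (h : I -> 'M[R]_n.+1) (p : I * I) x :=
  if (p.1 == p.2) && (p.1 != ord0) then qform (h p.1) x else monomial2 p x.

Definition prod_fun h (j : I * (I * I)) x := qform (h j.1) x * gen_fun h j.2 x.

(* The products h_k h_l with k <= l, and h_k e with e in sign_basis. *)
Definition prod_index (j : I * (I * I)) :=
  (j.1 != ord0) && ((j.2.1 < j.2.2)%N ||
    ((j.2.1 == j.2.2) && ((j.2.1 == ord0) || (j.1 <= j.2.1)%N))).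

Section Free.
Variable b : I -> I * I -> R.
Hypothesis b_out : forall k p, ~~ prod_index (k, p) -> b k p = 0.
Hypothesis b_grid : forall q : grid n,
  \sum_k \sum_p b k p * prod_fun cube_form (k, p) (grid_pt R q) = 0.

(** The monomial part of the cofactor of h_k in a linear relation. The pencil part is kept apart
    because it does not change with the signs of the coordinates. *)
Let B k : 'M[R]_n.+1 :=
  \matrix_(a, c) (if (a == c) && (a != ord0) then 0 else b k (a, c)).

Let b0 p : b ord0 p = 0.
Proof. by apply: b_out; rewrite /prod_index eqxx. Qed.

Let vanish (m : I -> nat) (x : 'rV[R]_n.+1) :
  (forall j, (0 < m j < 4)%N) -> (forall j, x 0 j = (m j)%:R \/ x 0 j = - (m j)%:R) ->
  \sum_k ((m k)%:R ^+ 2 - (m ord0)%:R ^+ 2) *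
    (qform (B k) x + \sum_l b k (l, l) * ((m l)%:R ^+ 2 - (m ord0)%:R ^+ 2)) = 0.
Proof.
move=> m4 xm; have xx j : x 0 j ^+ 2 = (m j)%:R ^+ 2.
  by case: (xm j) => ->; rewrite ?sqrrN.
have [q qx] : exists q, grid_pt R q = x.
  apply: grid_ptP => j; have /andP[m0 m3] := m4 j; case: (xm j) => ->.
    have h : (m j + 3 < 7)%N by lia.
    by exists (Ordinal h); rewrite /= natrD addrK.
  have h : (3 - m j < 7)%N by lia.
  by exists (Ordinal h); rewrite /= natrB; [ring|lia].
rewrite -[RHS](b_grid q) qx; apply: eq_bigr => k _.
under [RHS]eq_bigr do rewrite /prod_fun/= qform_cube !xx mulrCA.
rewrite -big_distrr/=; congr (_ * _).
rewrite qformE -big_split/=.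
transitivity (\sum_a \sum_c b k (a, c) * gen_fun cube_form (a, c) x); last first.
  by rewrite pair_bigA/=; apply: eq_bigr => -[].
apply: eq_bigr => a _.
rewrite (bigD1 a)//= [RHS](bigD1 a)//= addrAC; congr (_ + _); last first.
  apply: eq_bigr => c /negPf ca; rewrite mxE /gen_fun/= eq_sym ca/=.
  by rewrite /monomial2.
rewrite mxE /gen_fun/= eqxx/=; case: eqVneq => [->|a0] /=.
  by rewrite subrr mulr0 addr0 /monomial2.
by rewrite mul0r add0r qform_cube !xx.
Qed.

(** When every coordinate but the k-th is a sign, all members of the pencil except h_k vanish, which
    isolates the cofactor of h_k. *)
Let at_k k mu (x : 'rV[R]_n.+1) : k != ord0 -> (1 < mu < 4)%N ->
  (forall j, x 0 j = (if j == k then mu else 1)%:R \/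
             x 0 j = - (if j == k then mu else 1)%:R) ->
  qform (B k) x = - (b k (k, k) * (mu%:R ^+ 2 - 1)).
Proof.
move=> k0 mu4 xm; pose m j : nat := if j == k then mu else 1%N.
have m4 j : (0 < m j < 4)%N by rewrite /m; case: ifP => // _; lia.
have m0 : m ord0 = 1%N by rewrite /m eq_sym (negPf k0).
have mk : m k = mu by rewrite /m eqxx.
have := vanish m4 xm; rewrite m0 expr1n.
rewrite (bigD1 k)//= [X in _ + X = _]big1 ?addr0; last first.
  by move=> j /negPf jk; rewrite /m jk expr1n subrr mul0r.
rewrite mk (bigD1 k)//= big1 ?addr0 ?mk; last first.
  by move=> j /negPf jk; rewrite /m jk expr1n subrr mulr0.
move=> /eqP; rewrite mulf_eq0 => /orP[|/eqP h]; last by lra.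
have : 4 <= mu%:R ^+ 2 :> R by rewrite -natrX ler_nat; nia.
by move=> h1 /eqP h2; lra.
Qed.

(** The value given by [at_k] does not depend on the signs of x, so its second difference in the
    signs of coordinates a and c is zero. *)
Let B_offdiag k a c : k != ord0 -> a != c -> B k a c + B k c a = 0.
Proof.
move=> k0 ac; pose m j : R := (if j == k then 2 else 1)%:R.
pose u : 'rV[R]_n.+1 := \row_j (if (j == a) || (j == c) then 0 else m j).
have m_neq0 j : m j != 0 by rewrite /m; case: ifP => _; rewrite pnatr_eq0.
have E (s t : bool) : qform (B k) (u + (-1) ^+ s *: (m a *: delta_mx 0 a) +
    (-1) ^+ t *: (m c *: delta_mx 0 c)) = - (b k (k, k) * (2 ^+ 2 - 1)).
  apply: at_k => // j; rewrite !mxE -/(m j) /=.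
  have [->|ja] := eqVneq j a.
    rewrite (negPf ac)/= !mulr0 mulr1 add0r addr0.
    by case: s; rewrite ?expr0 ?expr1 ?mul1r ?mulN1r; [right|left].
  have [->|jc] := eqVneq j c.
    rewrite /= !mulr0 mulr1 add0r add0r.
    by case: t; rewrite ?expr0 ?expr1 ?mul1r ?mulN1r; [right|left].
  by rewrite /= !mulr0 !addr0; left.
have := qform_second_diff (B k) u (m a *: delta_mx 0 a) (m c *: delta_mx 0 c).
have := E false false; have := E false true; have := E true false.
have := E true true; rewrite !expr0 !expr1 !scale1r !scaleN1r.
move=> -> -> -> ->; rewrite !qform_delta (mulrC (m c)) -mulrDr.
rewrite (_ : _ - _ - _ + _ = 0); last by ring.
move=> /esym/eqP; rewrite !mulf_eq0 (negPf (m_neq0 _)) (negPf (m_neq0 _)) pnatr_eq0/=.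
by move=> /eqP.
Qed.

Let b_mono k (a c : I) : (a < c)%N -> b k (a, c) = 0.
Proof.
move=> ac; have [->|k0] := eqVneq k ord0; first exact: b0.
have nac : a != c by rewrite -val_eqE ltn_eqF.
have := B_offdiag k0 nac; rewrite !mxE [c == a]eq_sym (negPf nac)/=.
rewrite [b k (c, a)]b_out ?addr0// /prod_index/= ltnNge (ltnW ac)/=.
by rewrite [c == a]eq_sym (negPf nac) andbF.
Qed.

Let qform_B k x : qform (B k) x = b k (ord0, ord0) * x 0 ord0 ^+ 2.
Proof.
rewrite qformE (bigD1 ord0)//= (bigD1 ord0)//= mxE/= big1 ?addr0; last first.
  move=> c c0; rewrite mxE eq_sym (negPf c0)/= b_mono ?mul0r//.
  by rewrite lt0n.
rewrite big1 ?addr0// => a a0; rewrite big1// => c _; rewrite mxE a0 andbT.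
case: eqVneq => [_|ac]; first by rewrite mul0r.
have [lac|lca|/val_inj eac] := ltngtP a c.
- by rewrite b_mono// mul0r.
- rewrite b_out ?mul0r// /prod_index/= ltnNge (ltnW lca)/= (negPf ac).
  by rewrite andbF.
- by rewrite eac eqxx in ac.
Qed.

(** The values mu = 2 and mu = 3 give two equations, with mu^2 - 1 = 3 and 8, whose only common
    solution is zero. This is what the coordinate 3 of the grid is for. *)
Let b_diag k : b k (ord0, ord0) = 0 /\ b k (k, k) = 0.
Proof.
have [->|k0] := eqVneq k ord0; first by rewrite !b0.
have E (mu : nat) : (1 < mu < 4)%N ->
    b k (ord0, ord0) = - (b k (k, k) * (mu%:R ^+ 2 - 1)).
  move=> mu4.
  rewrite -(@at_k _ mu (\row_j (if j == k then mu else 1)%:R))//.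
    by rewrite qform_B mxE eq_sym (negPf k0) expr1n mulr1.
  by move=> j; left; rewrite mxE.
by have := E 2 isT; have := E 3 isT; lra.
Qed.

Let b_pair (k l : I) : (k < l)%N -> b k (l, l) = 0.
Proof.
move=> kl; have [->|k0] := eqVneq k ord0; first exact: b0.
have kl' : k != l by rewrite -val_eqE ltn_eqF.
have l0 : l != ord0 by rewrite -val_eqE/=; apply/eqP; lia.
(* At this point only h_k and h_l are nonzero. Their squares are already excluded, so the
   coefficient of h_k h_l is all that remains. *)
pose m j : nat := if (j == k) || (j == l) then 2 else 1%N.
have m4 j : (0 < m j < 4)%N by rewrite /m; case: ifP.
have m0 : m ord0 = 1%N by rewrite /m ![ord0 == _]eq_sym (negPf k0) (negPf l0).
have mk : m k = 2%N by rewrite /m eqxx.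
have ml : m l = 2%N by rewrite /m eqxx orbT.
have mj j : j != k -> j != l -> m j = 1%N by rewrite /m => /negPf -> /negPf ->.
have := @vanish m (\row_j (m j)%:R) m4 (fun j => or_introl _ (mxE _ _ _ _)).
have Bz j (x : 'rV[R]_n.+1) : qform (B j) x = 0 by rewrite qform_B (b_diag j).1 mul0r.
have sumE j : \sum_l0 b j (l0, l0) * ((m l0)%:R ^+ 2 - (m ord0)%:R ^+ 2) =
    b j (k, k) * 3 + b j (l, l) * 3.
  rewrite (bigD1 k)//= (bigD1 l) 1?eq_sym//= big1 ?addr0; last first.
    by move=> i /andP[ik il]; rewrite mj// m0 subrr mulr0.
  by rewrite mk ml m0; ring.
under eq_bigr do rewrite Bz sumE add0r.
rewrite (bigD1 k)//= (bigD1 l) 1?eq_sym//= big1 ?addr0; last first.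
  by move=> i /andP[ik il]; rewrite mj// m0 subrr mul0r.
rewrite (b_diag k).2 (b_diag l).2 mk ml m0.
rewrite [b l (k, k)]b_out; first by lra.
by rewrite /prod_index/= ltnn eqxx/= (negPf k0)/= leqNgt kl andbF.
Qed.

Lemma prod_free_core k p : b k p = 0.
Proof.
case: p => a c; have [|/b_out//] := boolP (prod_index (k, (a, c))).
rewrite /prod_index/= => /andP[k0 /orP[ac|]]; first exact: b_mono.
move=> /andP[/eqP -> /orP[/eqP ->|]]; first exact: (b_diag k).1.
by rewrite leq_eqVlt => /orP[/eqP/val_inj <-|/b_pair//]; exact: (b_diag k).2.
Qed.

End Free.

Lemma prod_free : rows_free (fun (j : {j | j \in prod_index}) (q : grid n) =>
  prod_fun cube_form (val j) (grid_pt R q)).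
Proof.
move=> b bq j.
pose b' k p := if insub (k, p) is Some s then b s else 0.
have bE s : b' (val s).1 (val s).2 = b s.
  by rewrite /b' -surjective_pairing valK.
have b'N k p : ~~ prod_index (k, p) -> b' k p = 0 by move=> kp; rewrite /b' insubN.
rewrite -bE; apply: prod_free_core => // q.
rewrite -[RHS](bq q) pair_bigA/= [RHS](eq_bigr (fun s =>
  (fun j => b' j.1 j.2 * prod_fun cube_form j (grid_pt R q)) (val s))); last first.
  by move=> s _; rewrite bE.
rewrite -(big_sub prod_index (fun j => b' j.1 j.2 * prod_fun cube_form j (grid_pt R q))).
rewrite [RHS]big_mkcond/=; apply: eq_bigr => -[k p] _ /=.
by rewrite unfold_in; case: ifPn => // /b'N ->; rewrite mul0r.
Qed.

End Cube.

(** * The basis dual to a perturbed pencil *)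

Section LocalUnique.
Variables (R : realFieldType) (n : nat).
Local Notation I := 'I_n.+1.

Lemma sum_sym_offdiag (G : I -> I -> R) : (forall a c, G a c = G c a) ->
  \sum_(a : I) \sum_(c : I) G a c =
  \sum_(a : I) G a a + \sum_(a : I) \sum_(c : I | (a < c)%N) 2 * G a c.
Proof.
move=> Gs.
have -> : \sum_(a : I) \sum_(c : I | (a < c)%N) 2 * G a c =
    \sum_(a : I) \sum_(c : I) ((a < c)%N%:R + (c < a)%N%:R) * G a c.
  transitivity (\sum_(a : I) \sum_(c : I) (a < c)%N%:R * G a c +
    \sum_(a : I) \sum_(c : I) (a < c)%N%:R * G a c).
    rewrite -big_split/=; apply: eq_bigr => a _; rewrite -big_split/= big_mkcond/=.
    by apply: eq_bigr => c _; case: (a < c)%N; rewrite /=; ring.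
  rewrite [X in _ + X = _]exchange_big/= -big_split/=; apply: eq_bigr => a _.
  rewrite -big_split/=; apply: eq_bigr => c _.
  by rewrite (Gs c a); ring.
rewrite -big_split/=; apply: eq_bigr => a _.
rewrite (bigD1 a)//= [X in _ = _ + X](bigD1 a)//= ltnn addr0 mul0r add0r.
congr (_ + _); apply: eq_bigr => c ca.
suff -> : (a < c)%N%:R + (c < a)%N%:R = 1 :> R by rewrite mul1r.
case: (ltngtP a c) => [_|_|/val_inj ac]; rewrite ?addr0 ?add0r//.
by rewrite ac eqxx in ca.
Qed.

Lemma sum_sign_basis (F : I * I -> R) :
  \sum_(e | sign_basis e) F e =
  F (ord0, ord0) + \sum_(a : I) \sum_(c : I | (a < c)%N) F (a, c).
Proof.
rewrite (bigD1 (ord0, ord0))/=; last by rewrite /sign_basis eqxx orbT.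
congr (_ + _); rewrite pair_big_dep/=; apply: eq_big => [[a c]|[a c] _]//=.
rewrite /sign_basis; case: eqVneq => [[-> ->]//|_]; by rewrite orbF andbT.
Qed.

(** Coordinates modulo the pencil: replacing each x_l^2 by x_0^2 collects the trace as the
    coefficient of x_0^2. *)
Definition basis_coef (A : 'M[R]_n.+1) (e : I * I) :=
  if e == (ord0, ord0) then \tr A else 2 * A e.1 e.2.

Lemma qform_expand (A : 'M[R]_n.+1) x : A^T = A ->
  qform A x = \sum_(l | l != ord0) A l l * (x 0 l ^+ 2 - x 0 ord0 ^+ 2)
    + \sum_(e | sign_basis e) monomial2 e x * basis_coef A e.
Proof.
move=> As; rewrite qformE sum_sym_offdiag; last first.
  by move=> a c; rewrite -[in LHS]As mxE; ring.
rewrite sum_sign_basis addrA; congr (_ + _); last first.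
  apply: eq_bigr => a _; apply: eq_bigr => c ac.
  rewrite /basis_coef/monomial2/= ifN; first by ring.
  by apply/eqP => -[a0 c0]; rewrite a0 c0 ltnn in ac.
rewrite /basis_coef eqxx /mxtrace /monomial2/= big_distrr/=.
rewrite (bigD1 ord0)//= [X in _ = _ + X](bigD1 ord0)//= addrCA; congr (_ + _).
  by ring.
by rewrite -big_split/=; apply: eq_bigr => l _; ring.
Qed.

Section Dual.
Variables (h : I -> 'M[R]_n.+1) (Gam : I -> I -> R).
Hypothesis h_sym : forall k, (h k)^T = h k.
Hypothesis GamE : forall l l', l != ord0 -> l' != ord0 ->
  \sum_(k | k != ord0) Gam l k * h k l' l' = (l == l')%:R.

Definition dual_form k : 'M[R]_n.+1 :=
  \sum_(l | l != ord0) Gam l k *: delta_mx l l.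

Definition dual_basis e : 'M[R]_n.+1 :=
  (if e == (ord0, ord0) then 1%:M else delta_mx e.1 e.2 + delta_mx e.2 e.1)
  - \sum_(k | k != ord0) basis_coef (h k) e *: dual_form k.

(** Its quadratic form is x_i x_j, so [qform_expand] applied to it expands the entry (i, j) of x^T
    x. *)
Let sym_delta i j : 'M[R]_n.+1 := 2^-1 *: (delta_mx i j + delta_mx j i).

Let qform_delta_mx i j (x : 'rV[R]_n.+1) : qform (delta_mx i j) x = x 0 i * x 0 j.
Proof.
rewrite qformE (bigD1 i)//= (bigD1 j)//= mxE !eqxx mul1r big1 ?addr0; last first.
  by move=> c /negPf cj; rewrite mxE cj andbF mul0r.
rewrite big1 ?addr0// => a /negPf ai; rewrite big1// => c _.
by rewrite mxE ai mul0r.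
Qed.

Let sym_deltaP i j : (sym_delta i j)^T = sym_delta i j.
Proof. by rewrite linearZ/= linearD/= !trmx_delta addrC. Qed.

Let sym_delta_coef i j e : basis_coef (sym_delta i j) e =
  (if e == (ord0, ord0) then 1%:M else delta_mx e.1 e.2 + delta_mx e.2 e.1) i j.
Proof.
rewrite /basis_coef; case: ifP => _.
  rewrite linearZ/= linearD/= !mxE /mxtrace.
  have E a c : \sum_i0 (delta_mx a c : 'M[R]_n.+1) i0 i0 = (a == c)%:R.
    rewrite (bigD1 a)//= mxE eqxx/= big1 ?addr0//.
    by move=> k /negPf ka; rewrite mxE ka.
  by rewrite !E (eq_sym j i); case: (i == j); rewrite /=; field.
rewrite !mxE mulrA divff ?pnatr_eq0// mul1r.
rewrite (eq_sym i e.1) (eq_sym j e.2) (eq_sym i e.2) (eq_sym j e.1).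
by rewrite [(e.2 == i) && _]andbC.
Qed.

(** Expand x^T x in the differences z_l = x_l^2 - x_0^2 and the monomials of [sign_basis], then
    eliminate the z_l: by [GamE] they are combinations of the h_k and of these monomials. The sum
    subtracted in [dual_basis] accounts for the latter. *)
Lemma dual_expand (x : 'rV[R]_n.+1) : x^T *m x =
  \sum_(k | k != ord0) qform (h k) x *: dual_form k +
  \sum_(e | sign_basis e) monomial2 e x *: dual_basis e.
Proof.
pose z l := x 0 l ^+ 2 - x 0 ord0 ^+ 2.
have F2 : \sum_(e | sign_basis e) monomial2 e x *:
    (if e == (ord0, ord0) then 1%:M else delta_mx e.1 e.2 + delta_mx e.2 e.1)
  = x^T *m x - \sum_(l | l != ord0) z l *: delta_mx l l.
  apply/matrixP => i j; rewrite summxE !mxE big_ord1 !mxE.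
  have := qform_expand x (sym_deltaP i j).
  rewrite qformZ qformD !qform_delta_mx => E.
  have -> : x 0 i * x 0 j = 2^-1 * (x 0 i * x 0 j + x 0 j * x 0 i) by field.
  rewrite E summxE addrAC [X in X - _](_ : _ = \sum_(l | l != ord0) (z l *: delta_mx l l) i j).
    rewrite subrr add0r; apply: eq_bigr => e _.
    by rewrite sym_delta_coef !mxE.
  apply: eq_bigr => l _; rewrite !mxE mulrC; congr (_ * _).
  rewrite (eq_sym l i) (eq_sym l j) andbC.
  by case: (i == l); case: (j == l); rewrite /=; field.
have F3 : \sum_(k | k != ord0)
    (\sum_(l | l != ord0) h k l l * z l) *: dual_form k =
    \sum_(l | l != ord0) z l *: delta_mx l l.
  under eq_bigr do rewrite /dual_form scaler_sumr.
  rewrite exchange_big/=; apply: eq_bigr => l l0.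
  under eq_bigr do rewrite scalerA.
  rewrite -scaler_suml; congr (_ *: _).
  under eq_bigr do rewrite big_distrl/=.
  rewrite exchange_big/= (bigD1 l)//= [X in _ + X]big1 ?addr0; last first.
    move=> l' /andP[l'0 /negPf l'l].
    rewrite -[RHS](mulr0 (z l')) -[X in _ * X](_ : (l == l')%:R = 0); last first.
      by rewrite eq_sym l'l.
    by rewrite -GamE// big_distrr/=; apply: eq_bigr => k _; ring.
  rewrite -[RHS]mulr1 -[X in _ * X](_ : (l == l)%:R = 1); last by rewrite eqxx.
  by rewrite -GamE// big_distrr/=; apply: eq_bigr => k _; ring.
have F4 : \sum_(k | k != ord0) qform (h k) x *: dual_form k =
    \sum_(l | l != ord0) z l *: delta_mx l l +
    \sum_(e | sign_basis e) \sum_(k | k != ord0)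
      monomial2 e x *: (basis_coef (h k) e *: dual_form k).
  rewrite -F3 exchange_big/= -big_split/=; apply: eq_bigr => k _.
  rewrite qform_expand// scalerDl; congr (_ + _).
  by rewrite scaler_suml; apply: eq_bigr => e _; rewrite scalerA.
under [X in _ = _ + X]eq_bigr do rewrite scalerBr scaler_sumr.
by rewrite sumrB F2 F4 addrC -[X in X + _]addrA -opprD subrK.
Qed.

End Dual.
End LocalUnique.

(** * Uniqueness in a neighbourhood of the pencil *)

Section CubeUnique.
Variables (R : realFieldType) (n : nat).
Local Notation I := 'I_n.+1.

Let gamma_exists (h : I -> 'M[R]_n.+1) kap :
  (forall k a c, `|h k a c - cube_form R k a c| <= kap) ->
  kap * n.+1%:R <= 2^-1 ->
  exists Gam : I -> I -> R, forall l l', l != ord0 -> l' != ord0 ->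
    \sum_(k | k != ord0) Gam l k * h k l' l' = (l == l')%:R.
Proof.
move=> hk kn.
have kap0 : 0 <= kap by apply: le_trans (hk ord0 ord0 ord0); rewrite normr_ge0.
(* The diagonal coefficients of the h_k, bordered by the identity at index 0, form a matrix whose
   entries are within kap of those of the identity. *)
pose D : 'M[R]_n.+1 :=
  \matrix_(k, l) if (k == ord0) || (l == ord0) then (k == l)%:R else h k l l.
pose K := D - 1%:M.
have Kk i j : `|K i j| <= kap.
  rewrite !mxE; case: eqVneq => [->|i0]/=; first by rewrite eq_sym subrr normr0.
  case: eqVneq => [->|j0]/=; first by rewrite subrr normr0.
  have := hk i j j; rewrite !mxE (negPf j0)/= subr0 andbb eq_sym.
  by rewrite eq_sym.
have := near1_unit Kk kn; rewrite addrC subrK => Du.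
exists (fun l k => invmx D l k) => l l' l0 l'0.
have := congr1 (fun M : 'M[R]_n.+1 => M l l') (mulVmx Du); rewrite !mxE => <-.
rewrite [RHS](bigD1 ord0)//= [D _ _]mxE eqxx/= eq_sym (negPf l'0) mulr0 add0r.
by apply: eq_bigr => k k0; rewrite [D _ _]mxE (negPf k0) (negPf l'0).
Qed.

Let grid_bound (q : grid n) j : `|grid_pt R q 0 j| <= 3.
Proof.
rewrite mxE; have := ltn_ord (q j); rewrite ltnS => q6.
have : (q j)%:R <= 6 :> R by rewrite ler_nat.
have : 0 <= (q j)%:R :> R by [].
by move=> h1 h2; rewrite ler_norml; apply/andP; split; lra.
Qed.

Let mono_bound (q : grid n) p : `|monomial2 p (grid_pt R q)| <= 9.
Proof.
rewrite /monomial2 normrM (_ : 9 = 3 * 3); last by ring.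
by apply: ler_pM.
Qed.

Let cube_bound (q : grid n) k : `|qform (cube_form R k) (grid_pt R q)| <= 9.
Proof.
rewrite qform_cube; have := le_trans (ler_norm _) (mono_bound q (k, k)).
have := le_trans (ler_norm _) (mono_bound q (ord0, ord0)).
rewrite /monomial2/= -!expr2 => h1 h2.
have := sqr_ge0 (grid_pt R q 0 k); have := sqr_ge0 (grid_pt R q 0 ord0).
by move=> h3 h4; rewrite ler_norml; apply/andP; split; lra.
Qed.

Let gen_bound (q : grid n) p : `|gen_fun (@cube_form R n) p (grid_pt R q)| <= 9.
Proof. by rewrite /gen_fun; case: ifP. Qed.

Section Near.
Variables (h : I -> 'M[R]_n.+1) (del : R).
Hypothesis h_near : forall k a c, `|h k a c - cube_form R k a c| <= del.
(** Bounds the change of a form at a grid point: each of the (n + 1)^2 entries moves by at most del,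
    and a monomial is at most 9 there. *)
Let eta := 9 * n.+1%:R ^+ 2 * del.
Hypothesis eta1 : eta <= 1.

Let eta0 : 0 <= eta.
Proof.
rewrite mulr_ge0// ?mulr_ge0 ?sqr_ge0//.
by apply: le_trans (h_near ord0 ord0 ord0); rewrite normr_ge0.
Qed.

Let qform_near (q : grid n) k :
  `|qform (h k) (grid_pt R q) - qform (cube_form R k) (grid_pt R q)| <= eta.
Proof.
rewrite -qformN -qformD qformE (le_trans (ler_norm_sum _ _ _))//.
apply: (@le_trans _ _ (\sum_(i : I) \sum_(j : I) del * 9)); last first.
  rewrite !sumr_const !card_ord -mulrnA -[X in X <= _]mulr_natr natrM /eta.
  by rewrite le_eqVlt; apply/orP; left; apply/eqP; ring.
apply: ler_sum => i _; rewrite (le_trans (ler_norm_sum _ _ _))//.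
apply: ler_sum => j _; rewrite normrM; apply: ler_pM => //.
  by have := h_near k i j; rewrite !mxE.
exact: (mono_bound q (i, j)).
Qed.

Let gen_near (q : grid n) p :
  `|gen_fun h p (grid_pt R q) - gen_fun (@cube_form R n) p (grid_pt R q)| <= eta.
Proof. by rewrite /gen_fun; case: ifP => _ //; rewrite subrr normr0. Qed.

(** Both unperturbed factors are at most 9 in absolute value and eta <= 1, whence 19 = 1 + 9 + 9. *)
Lemma prod_near (q : grid n) j :
  `|prod_fun h j (grid_pt R q) - prod_fun (@cube_form R n) j (grid_pt R q)| <= 19 * eta.
Proof.
rewrite /prod_fun; set a := qform (h _) _; set b := gen_fun h _ _.
set a0 := qform _ _; set b0 := gen_fun _ _ _.
have -> : a * b - a0 * b0 = (a - a0) * (b - b0) + (a - a0) * b0 + a0 * (b - b0).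
  by ring.
have h1 : `|a - a0| <= eta by exact: qform_near.
have h2 : `|b - b0| <= eta by exact: gen_near.
have h3 : `|a0| <= 9 by exact: cube_bound.
have h4 : `|b0| <= 9 by exact: gen_bound.
have e1 : `|(a - a0) * (b - b0)| <= eta * 1.
  by rewrite normrM ler_pM// (le_trans h2).
have e2 : `|(a - a0) * b0| <= eta * 9 by rewrite normrM ler_pM.
have e3 : `|a0 * (b - b0)| <= 9 * eta by rewrite normrM ler_pM.
rewrite (le_trans (ler_normD _ _))//.
have := ler_normD ((a - a0) * (b - b0)) ((a - a0) * b0).
by move=> e4; lra.
Qed.

End Near.

Let sign_weight_kernel j :
  \sum_q prod_fun (@cube_form R n) (val (j : {j | j \in @prod_index n})) (grid_pt R q)
    * sign_weight R q = 0.
Proof.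
apply: big1 => q _; have [->|q0] := eqVneq (sign_weight R q) 0; first by rewrite mulr0.
by rewrite /prod_fun qform_cube !(sign_weight_support _ q0) subrr !mul0r.
Qed.

Lemma cube_unique : exists2 del : R, 0 < del &
  forall h : I -> 'M[R]_n.+1, (forall k, (h k)^T = h k) ->
    (forall k a c, `|h k a c - cube_form R k a c| <= del) ->
  forall (M : I -> I -> R) (X : 'M[R]_n.+1 -> 'M[R]_n.+1 -> R), psd_form X ->
    (forall k l, M k l = M l k) ->
    (forall x : 'rV_n.+1, X (x^T *m x) (x^T *m x) =
       \sum_(k | k != ord0) \sum_(l | l != ord0)
          M k l * (qform (h k) x * qform (h l) x)) ->
    forall x y : 'rV_n.+1, X (x^T *m x) (y^T *m y) =
       \sum_(k | k != ord0) \sum_(l | l != ord0)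
          M k l * (qform (h k) x * qform (h l) y).
Proof.
pose E : finType := (I * I)%type.
(* Chosen so that eps * #|E| < 1, as [gram_unique] requires. *)
pose eps : R := (#|E|%:R + 1)^-1.
have E0 : 0 < #|E|%:R + 1 :> R by rewrite ltr_wpDl.
have eps0 : 0 < eps by rewrite invr_gt0.
pose g := #|{: grid n}|%:R : R.
have g0 : 0 <= g by rewrite /g.
(* A product of two monomials is at most 81 at each of the g grid points, so changing every weight
   by at most [ec] moves a sum by at most eps. *)
pose ec := eps / (81 * g + 1).
have ec0 : 0 < ec by rewrite divr_gt0// ltr_wpDl// mulr_ge0.
have [d1 d10 Hd1] := kernel_perturb (@prod_free R n) sign_weight_kernel ec0.
pose N2 : R := 9 * n.+1%:R ^+ 2.
have N20 : 0 < N2 by rewrite mulr_gt0// exprn_gt0.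
(* The three bounds give eta <= 1, the closeness that [kernel_perturb] asks for, and the inverse in
   [gamma_exists]. *)
pose del := Num.min (Num.min N2^-1 (d1 / (19 * N2))) (2 * n.+1%:R)^-1.
have del0 : 0 < del.
  by rewrite !lt_min !invr_gt0 N20/= divr_gt0 ?mulr_gt0.
exists del => // h hs hn M X HX Ms XM x y.
have dn1 : N2 * del <= 1.
  by rewrite mulrC -ler_pdivlMr// div1r /del !ge_min lexx.
have dn2 : 19 * (N2 * del) <= d1.
  by rewrite mulrA mulrC -ler_pdivlMr ?mulr_gt0// /del !ge_min lexx orbT.
have dn3 : del * n.+1%:R <= 2^-1.
  by rewrite -ler_pdivlMr// -invfM /del !ge_min lexx orbT.
have [Gam GamE] := gamma_exists hn dn3.
have [A_free [c cker cnear]] := Hd1 _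
  (fun j q => le_trans (prod_near hn dn1 q (val j)) dn2).
apply: (@gram_unique R _ X HX 'rV[R]_n.+1 (fun x => x^T *m x) I E (grid n)
  (fun k => k != ord0) (@sign_basis n) (dual_form Gam) (dual_basis h Gam)
  (fun k => qform (h k)) (@monomial2 R n) _ (@grid_pt R n) c eps) => //.
- by move=> z; exact: dual_expand.
- move=> k l k0 l0; wlog kl : k l k0 l0 / (k <= l)%N => [W|].
    case: (leqP k l) => [kl|/ltnW lk]; first exact: W.
    transitivity (\sum_q c q * (qform (h l) (grid_pt R q) * qform (h k) (grid_pt R q))).
      by apply: eq_bigr => q _; ring.
    exact: W.
  have jP : (k, (l, l)) \in @prod_index n.
    by rewrite unfold_in /prod_index/= k0 eqxx kl !orbT.
  rewrite -[RHS](cker (exist (fun j => j \in @prod_index n) _ jP)); apply: eq_bigr => q _.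
  by rewrite /prod_fun/gen_fun/= eqxx l0 mulrC.
- move=> k e k0 he.
  have jP : (k, e) \in @prod_index n.
    rewrite unfold_in /prod_index/= k0/=; by case/orP: he => [-> //|/eqP ->].
  rewrite -[RHS](cker (exist (fun j => j \in @prod_index n) _ jP)); apply: eq_bigr => q _.
  rewrite /prod_fun/gen_fun/= ifN; first by rewrite mulrC.
  case/orP: he => [e12|/eqP -> //=].
  by rewrite -val_eqE/= ltn_eqF.
- move=> e f he hf; rewrite -(sign_orthonormal R he hf) -sumrB.
  rewrite (le_trans (ler_norm_sum _ _ _))//.
  apply: (@le_trans _ _ (\sum_(q : grid n) ec * 81)).
    apply: ler_sum => q _; rewrite -mulrBl normrM ler_pM//.
    rewrite normrM (_ : 81 = 9 * 9); last by ring.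
    by apply: ler_pM.
  rewrite sumr_const -[leLHS]mulr_natl -/g.
  rewrite [leLHS](_ : _ = eps * (81 * g) / (81 * g + 1)); last by rewrite /ec; ring.
  rewrite ler_pdivrMr ?ltr_wpDl// ?mulr_ge0//.
  by rewrite ler_wpM2l ?(ltW eps0)// lerDl.
- by rewrite /eps mulrC ltr_pdivrMr// mul1r ltrDl.
- move=> a ha.
  (* The index set contains h_k h_l only for k <= l, so the coefficients of the two orders are
     folded into one. *)
  pose b (k l : I) := (k <= l)%N%:R * a k l + (k < l)%N%:R * a l k.
  pose bj (j : I * (I * I)) := if (j.2.1 == j.2.2) && (j.2.1 != ord0)
    then b j.1 j.2.1 else 0.
  have bj0 (j : {j | j \in @prod_index n}) : bj (val j) = 0.
    apply: (A_free (fun j => bj (val j))) => q.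
    pose f k l := qform (h k) (grid_pt R q) * qform (h l) (grid_pt R q).
    rewrite -(big_sub (@prod_index n) (fun j => bj j * prod_fun h j (grid_pt R q))).
    transitivity (\sum_(k | k != ord0) \sum_(l | l != ord0) b k l * f k l).
      rewrite big_mkcond/= [RHS]big_mkcond/=.
      rewrite -(pair_bigA _ (fun k p => if (k, p) \in @prod_index n then
        bj (k, p) * prod_fun h (k, p) (grid_pt R q) else 0))/=.
      apply: eq_bigr => k _; case: eqVneq => [->|k0] /=.
        by apply: big1 => p _; rewrite /in_mem /= /prod_index/= ?eqxx.
      rewrite [RHS]big_mkcond/= -(pair_bigA _ (fun u v => if (k, (u, v)) \in @prod_index n then
        bj (k, (u, v)) * prod_fun h (k, (u, v)) (grid_pt R q) else 0))/=.
      apply: eq_bigr => u _.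
      rewrite (bigD1 u)//= big1 ?addr0; last first.
        by move=> v /negPf vu; rewrite /bj/= eq_sym vu mul0r if_same.
      rewrite /in_mem/= /prod_index /bj /prod_fun /gen_fun/= ltnn eqxx k0/=.
      case: eqVneq => [_|u0]/=; first by rewrite mul0r.
      case: ifPn => [|/negPf ku]; first by rewrite /f.
      have kun : (k < u)%N = false by apply: contraFF ku; exact: ltnW.
      by rewrite /b ku kun !mul0r addr0 mul0r.
    rewrite -[RHS](ha q).
    transitivity (\sum_(k | k != ord0) \sum_(l | l != ord0) (k <= l)%N%:R * a k l * f k l +
      \sum_(k | k != ord0) \sum_(l | l != ord0) (k < l)%N%:R * a l k * f k l).
      rewrite -big_split/=; apply: eq_bigr => k _; rewrite -big_split/=.
      by apply: eq_bigr => l _; rewrite /b mulrDl.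
    rewrite [X in _ + X = _]exchange_big/= -big_split/=; apply: eq_bigr => k _.
    rewrite -big_split/=; apply: eq_bigr => l _; rewrite /f leqNgt.
    by case: (l < k)%N; rewrite /=; ring.
  have bkl (k l : I) : k != ord0 -> l != ord0 -> (k <= l)%N -> b k l = 0.
    move=> k0 l0 kl.
    have jP : (k, (l, l)) \in @prod_index n.
      by rewrite unfold_in /prod_index/= k0 eqxx kl !orbT.
    by have := bj0 (exist (fun j => j \in @prod_index n) _ jP); rewrite /bj/= eqxx l0.
  move=> k l k0 l0; case: (ltngtP k l) => [kl|lk|/val_inj kl].
  + by have := bkl _ _ k0 l0 (ltnW kl); rewrite /b kl (ltnW kl) !mul1r.
  + have := bkl _ _ l0 k0 (ltnW lk); rewrite /b lk (ltnW lk) !mul1r => <-.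
    by rewrite addrC.
  + have := bkl _ _ k0 l0; rewrite /b kl leqnn ltnn mul1r mul0r addr0.
    by move=> /(_ isT) ->; rewrite addr0.
Qed.

End CubeUnique.

(** * Rigid tuples of covariance matrices *)

Section TupleUnique.
Variables (R : realFieldType) (n m : nat).
Hypothesis mn : (m < n)%N.
Local Notation letter := (widen_ord (leqW mn)).

(** The scalar matrix cancels in differences, which therefore lie in the pencil, and n + 1 > i makes
    the form positive definite. The factor i will separate the top left entries. *)
Definition diag_form (i : 'I_m.+1) : 'M[R]_n.+1 :=
  n.+1%:R%:M + i%:R *: cube_form R (letter i : 'I_n.+1).

(** Here X stands for an arbitrary feasible point of the semidefinite program; the conclusion says
    that all of them agree on pairs of rank one matrices. *)
Definition gram_rigid (S : 'I_m.+1 -> 'M[R]_n.+1) := forall (lam : 'I_m.+1 -> R)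
    (X : 'M[R]_n.+1 -> 'M[R]_n.+1 -> R)
    (H := fun i => S i - \sum_j lam j *: S j),
  psd_form X -> \sum_i lam i = 1 ->
  (forall x, X (x^T *m x) (x^T *m x) = \sum_i lam i * (qform (H i) x * qform (H i) x)) ->
  forall x y, X (x^T *m x) (y^T *m y) = \sum_i lam i * (qform (H i) x * qform (H i) y).

Lemma gram_rigid_diag : exists2 del : R, 0 < del & forall S,
  (forall i, (S i)^T = S i) ->
  (forall i a c, `|S i a c - diag_form i a c| <= del) -> gram_rigid S.
Proof.
have [d d0 Hd] := cube_unique R n.
exists (d / 2); first by rewrite divr_gt0.
move=> S Ss Sn lam X H HX lam1 XH x y.
(* The differences S_i - S_0 supply only part of a perturbed pencil; exact cube forms fill the
   remaining indices. *)
pose h (k : 'I_n.+1) : 'M[R]_n.+1 :=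
  if insub (k : nat) is Some i then
    if k == ord0 then 0 else k%:R^-1 *: (S i - S ord0)
  else cube_form R k.
have cube0 : cube_form R (ord0 : 'I_n.+1) = 0 by rewrite /cube_form subrr.
have hS (i : 'I_m.+1) : i%:R *: h (letter i) = S i - S ord0.
  rewrite /h /= valK; case: eqVneq => [i0|i0].
    have -> : i = ord0 by apply/val_inj; move/(congr1 val): i0.
    by rewrite scaler0 subrr.
  rewrite scalerA divff ?scale1r// pnatr_eq0.
  by apply: contra i0 => /eqP i0; apply/eqP/val_inj.
have h0 : h ord0 = 0 by rewrite /h; case: insubP.
have hs k : (h k)^T = h k.
  rewrite /h; case: insubP => [i _ _|_].
    by case: eqP => _; rewrite ?trmx0// linearZ/= linearB/= !Ss.
  by rewrite /cube_form linearB/= !trmx_delta.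
have hn k a c : `|h k a c - cube_form R k a c| <= d.
  have [->|k0] := eqVneq k ord0; first by rewrite h0 cube0 subrr normr0 ltW.
  rewrite /h (negPf k0); case: insubP => [i im ki|_]; last by rewrite subrr normr0 ltW.
  have kl : letter i = k by apply: val_inj.
  have k1 : 1 <= k%:R :> R by rewrite ler1n lt0n.
  have E : (k%:R^-1 *: (S i - S ord0)) a c - cube_form R k a c =
     k%:R^-1 * ((S i a c - diag_form i a c) - (S ord0 a c - diag_form ord0 a c)).
    rewrite /diag_form kl ki /= scale0r addr0.
    have kn0 : k%:R != 0 :> R by rewrite gt_eqF// (lt_le_trans ltr01).
    by rewrite !mxE -/(cube_form R k) ?mxE; field.
  rewrite E normrM ger0_norm ?invr_ge0// -[leRHS]mul1r ler_pM// ?invr_ge0//.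
    by rewrite invf_le1// (lt_le_trans ltr01).
  rewrite (le_trans (ler_normB _ _))//.
  by have := lerD (Sn i a c) (Sn ord0 a c); rewrite -splitr.
(* Since the weights add up to 1, H_i = sum_j lam_j (S_i - S_j), and S_0 cancels. *)
pose al (i : 'I_m.+1) (k : 'I_n.+1) : R := \sum_j lam j *
  ((k == letter i)%:R * i%:R - (k == letter j)%:R * j%:R).
have HE i : H i = \sum_(k | k != ord0) al i k *: h k.
  have pick (l : 'I_n.+1) (t : R) : \sum_k ((k == l)%:R * t) *: h k = t *: h l.
    rewrite (bigD1 l)//= eqxx mul1r big1 ?addr0// => k /negPf ->.
    by rewrite mul0r scale0r.
  transitivity (\sum_k al i k *: h k); last first.
    by rewrite (bigD1 ord0)//= h0 scaler0 add0r.
  under eq_bigr do rewrite /al scaler_suml.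
  rewrite exchange_big/=.
  under eq_bigr do under eq_bigr do rewrite -scalerA scalerBl.
  under eq_bigr do rewrite -scaler_sumr sumrB !pick !hS opprB addrA subrK scalerBr.
  by rewrite sumrB -scaler_suml lam1 scale1r.
have qH i z : qform (H i) z = \sum_(k | k != ord0) al i k * qform (h k) z.
  by rewrite HE qform_sum; apply: eq_bigr => k _; rewrite qformZ.
pose M k l := \sum_i lam i * (al i k * al i l).
have MH u v : \sum_i lam i * (qform (H i) u * qform (H i) v) =
    \sum_(k | k != ord0) \sum_(l | l != ord0) M k l * (qform (h k) u * qform (h l) v).
  transitivity (\sum_i \sum_(k | k != ord0) \sum_(l | l != ord0)
    lam i * (al i k * al i l) * (qform (h k) u * qform (h l) v)).
    apply: eq_bigr => i _; rewrite !qH big_distrl big_distrr/=.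
    apply: eq_bigr => k _; rewrite !big_distrr/=; apply: eq_bigr => l _; ring.
  rewrite exchange_big/=; apply: eq_bigr => k _.
  rewrite exchange_big/=; apply: eq_bigr => l _.
  by rewrite /M big_distrl.
rewrite MH; apply: (Hd h hs hn) => //.
- by move=> k l; apply: eq_bigr => i _; ring.
- by move=> z; rewrite XH MH.
Qed.

End TupleUnique.

(** * An explicit rigid tuple of positive definite forms *)

Section BaseTuple.
Variables (R : realFieldType) (n m : nat).
Hypothesis mn : (m < n)%N.
Local Notation letter := (widen_ord (leqW mn)).

(** A shear along e_0; the parameters of two such shears add up in the product. *)
Let Gc (t : R) : 'M[R]_n.+1 :=
  \matrix_(i, j) ((i == j)%:R + t * ((i == ord0) && (j != ord0))%:R).

Let GcK t : Gc t *m Gc (- t) = 1%:M.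
Proof.
apply/matrixP => i j; rewrite !mxE.
rewrite (bigD1 ord0)//= !mxE eqxx/=.
transitivity (((i == ord0)%:R + t * ((i == ord0) && (ord0 != ord0 :> 'I_n.+1))%:R) *
  ((ord0 == j)%:R - t * (j != ord0)%:R) +
  \sum_(k | k != ord0) ((i == k)%:R + t * (i == ord0)%:R) * (k == j)%:R).
  congr (_ + _); first by rewrite eqxx; ring.
  apply: eq_bigr => k k0; rewrite !mxE k0 (negPf k0)/= andbT; ring.
rewrite eqxx andbF mulr0 addr0 (eq_sym ord0).
case: (eqVneq j ord0) => [->|j0].
  rewrite big1 ?addr0; last by move=> k /negPf ->; rewrite mulr0.
  by rewrite mulr0 subr0 mulr1.
rewrite (bigD1 j)//= eqxx big1 ?addr0; last by move=> k /andP[_ /negPf ->]; rewrite mulr0.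
by rewrite /=; ring.
Qed.

Let G := Gc 2.
Let Gi := Gc (- 2).

Let GGi : G *m Gi = 1%:M. Proof. exact: GcK. Qed.
Let GiG : Gi *m G = 1%:M. Proof. by have := GcK (- 2); rewrite opprK. Qed.

(* The change of coordinates makes the first columns linearly independent and
   the top left entries distinct. *)
Definition base_tuple (i : 'I_m.+1) : 'M[R]_n.+1 := G *m diag_form R mn i *m G^T.

Let congr_bound (A : 'M[R]_n.+1) (e : R) (s := \sum_a \sum_c `|Gi a c|) :
  (forall a c, `|A a c| <= e) -> forall a c, `|(Gi *m A *m Gi^T) a c| <= s * e * s.
Proof.
move=> Ae a c.
have e0 : 0 <= e by apply: le_trans (Ae a c); rewrite normr_ge0.
have row_s i : \sum_k `|Gi i k| <= s.
  by rewrite /s [leRHS](bigD1 i)//= lerDl; do 2! apply: sumr_ge0 => ? _.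
have s0 : 0 <= s by do 2! apply: sumr_ge0 => ? _.
have GA i j : `|(Gi *m A) i j| <= s * e.
  rewrite mxE (le_trans (ler_norm_sum _ _ _))//.
  apply: (@le_trans _ _ (\sum_k `|Gi i k| * e)); last by rewrite -big_distrl/= ler_wpM2r.
  by apply: ler_sum => k _; rewrite normrM ler_wpM2l.
rewrite mxE (le_trans (ler_norm_sum _ _ _))//.
apply: (@le_trans _ _ (\sum_k s * e * `|Gi c k|)); last first.
  by rewrite -big_distrr/= ler_wpM2l// mulr_ge0.
by apply: ler_sum => k _; rewrite normrM [Gi^T _ _]mxE ler_wpM2r.
Qed.

(** Rigidity is invariant under congruence: X is transported along A -> Gi^T A Gi, and only the
    radius changes, by the factor found in [congr_bound]. *)
Lemma gram_rigid_base : exists2 del : R, 0 < del & forall S,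
  (forall i, (S i)^T = S i) ->
  (forall i a c, `|S i a c - base_tuple i a c| <= del) -> gram_rigid S.
Proof.
have [d d0 Hd] := gram_rigid_diag R mn.
pose s := \sum_a \sum_c `|Gi a c|.
have s0 : 0 <= s by do 2! apply: sumr_ge0 => ? _.
exists (d / (s * s + 1)); first by rewrite divr_gt0// ltr_wpDl// mulr_ge0.
move=> S Ss Sn lam X H HX lam1 XH x y.
pose S' i := Gi *m S i *m Gi^T.
have S's i : (S' i)^T = S' i by rewrite /S' !trmx_mul trmxK Ss mulmxA.
have S'n i a c : `|S' i a c - diag_form R mn i a c| <= d.
  have -> : S' i a c - diag_form R mn i a c =
      (Gi *m (S i - base_tuple i) *m Gi^T) a c.
    rewrite mulmxBr mulmxBl /base_tuple !mulmxA GiG mul1mx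
      -(mulmxA (diag_form R mn i)) -trmx_mul GiG.
    by rewrite trmx1 mulmx1 [RHS]mxE [X in _ = _ + X]mxE.
  have := @congr_bound (S i - base_tuple i) (d / (s * s + 1)) _ a c.
  rewrite -/s => h; apply: le_trans (h _) _.
    by move=> u v; rewrite !mxE -/(base_tuple i) ?mxE; have := Sn i u v; rewrite ?mxE.
  rewrite mulrAC mulrA ler_pdivrMr; last by rewrite ltr_wpDl// mulr_ge0.
  by rewrite mulrC ler_wpM2l ?(ltW d0)// lerDl.
pose X' A B := X (Gi^T *m A *m Gi) (Gi^T *m B *m Gi).
have HX' : psd_form X'.
  split=> [A B|a A A' B|A]; first exact: (psd_formC HX).
    by rewrite /X' mulmxDr mulmxDl -scalemxAr -scalemxAl (psd_formP HX).
  exact: (psd_form_ge0 HX).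
have X'E u v : X' (u^T *m u) (v^T *m v) =
    X ((u *m Gi)^T *m (u *m Gi)) ((v *m Gi)^T *m (v *m Gi)).
  by rewrite /X' !trmx_mul !mulmxA.
pose H' i := S' i - \sum_j lam j *: S' j.
have H'E i u : qform (H' i) u = qform (H i) (u *m Gi).
  have -> : H' i = Gi *m H i *m Gi^T.
    rewrite /H' /H mulmxBr mulmxBl mulmx_sumr mulmx_suml; congr (_ - _).
    by apply: eq_bigr => j _; rewrite -scalemxAr -scalemxAl.
  by rewrite /qform trmx_mul !mulmxA.
have := Hd S' S's S'n lam X' HX' lam1 _ (x *m G) (y *m G).
rewrite X'E -!mulmxA GGi !mulmx1 => ->.
  by apply: eq_bigr => i _; rewrite !H'E -!mulmxA GGi !mulmx1.
move=> z; rewrite X'E XH; apply: eq_bigr => i _.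
by rewrite -!H'E.
Qed.

Let w : 'rV[R]_n.+1 := row ord0 G.

Let wE j : w 0 j = if j == ord0 then 1 else 2.
Proof. by rewrite !mxE eqxx (eq_sym ord0); case: eqP => _ /=; ring. Qed.

Lemma qform_base i x : qform (base_tuple i) x =
  n.+1%:R * (\sum_j (x *m G) 0 j ^+ 2) +
  i%:R * ((x *m G) 0 (letter i) ^+ 2 - (x *m G) 0 ord0 ^+ 2).
Proof.
have -> : qform (base_tuple i) x = qform (diag_form R mn i) (x *m G).
  by rewrite /qform /base_tuple trmx_mul !mulmxA.
rewrite /diag_form qformD qformZ qform_cube; congr (_ + _).
rewrite qformE big_distrr/=; apply: eq_bigr => j _.
rewrite (bigD1 j)//= mxE eqxx mulr1n big1 ?addr0 ?expr2//.
by move=> k /negPf kj; rewrite mxE eq_sym kj mulr0n mul0r.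
Qed.

Lemma base_pos i x : x != 0 -> 0 < qform (base_tuple i) x.
Proof.
move=> x0; rewrite qform_base; set y := x *m G.
have y0 : y != 0.
  apply: contraNneq x0 => y0; rewrite -[x]mulmx1 -GGi mulmxA -/y y0.
  by rewrite mul0mx.
have [j yj] : exists j, y 0 j != 0.
  apply/existsP; apply: contraNT y0 => /existsPn h.
  apply/eqP/rowP => j; rewrite [RHS]mxE; apply/eqP.
  by have := h j; rewrite negbK.
have ss : 0 < \sum_j y 0 j ^+ 2.
  rewrite (bigD1 j)//= ltr_wpDr ?sumr_ge0//; last by rewrite exprn_even_gt0.
  by move=> k _; exact: sqr_ge0.
have s0 : y 0 ord0 ^+ 2 <= \sum_j y 0 j ^+ 2.
  by rewrite (bigD1 ord0)//= lerDl sumr_ge0// => k _; exact: sqr_ge0.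
have im : i%:R < n.+1%:R :> R by rewrite ltr_nat (leq_trans (ltn_ord i))// ltnW.
have i0 : 0 <= i%:R :> R by [].
have sl := sqr_ge0 (y 0 (letter i)).
nra.
Qed.

Let e0G (A : 'M[R]_n.+1) j : (G *m A *m G^T) j ord0 = (G *m (A *m w^T)) j 0.
Proof.
rewrite -mulmxA [LHS]mxE [RHS]mxE; apply: eq_bigr => k _; rewrite !mxE.
by congr (_ * _); apply: eq_bigr => l _; rewrite !mxE.
Qed.

Let base_corner i : base_tuple i ord0 ord0 = n.+1%:R * (\sum_j w 0 j ^+ 2) + 3 * i%:R.
Proof.
have -> : base_tuple i ord0 ord0 = qform (base_tuple i) (delta_mx 0 ord0).
  by rewrite /qform -rowE trmx_delta -colE !mxE.
rewrite qform_base -rowE -/w !wE eqxx; congr (_ + _).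
case: eqP => [/(congr1 val)/= ->|_]; rewrite ?mul0r ?mulr0//; ring.
Qed.

Lemma base_corner_sub i j :
  base_tuple i ord0 ord0 - base_tuple j ord0 ord0 = 3 * (i%:R - j%:R).
Proof. by rewrite !base_corner; ring. Qed.

Lemma base_corner_ge1 i : 1 <= base_tuple i ord0 ord0.
Proof.
rewrite base_corner ler_wpDr ?mulr_ge0// mulr_ege1 ?ler1n//.
rewrite (bigD1 ord0)//= wE eqxx expr1n lerDl sumr_ge0// => j _; exact: sqr_ge0.
Qed.

Lemma base_tuple_sym i : (base_tuple i)^T = base_tuple i.
Proof.
rewrite /base_tuple !trmx_mul trmxK mulmxA /diag_form; congr (_ *m _ *m _).
by rewrite linearD/= tr_scalar_mx linearZ/= linearB/= !trmx_delta.
Qed.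

Let corner_col i : diag_form R mn i *m w^T =
  \col_j (n.+1%:R * w 0 j + i%:R * ((j == letter i)%:R * w 0 j - (j == ord0)%:R * w 0 j)).
Proof.
apply/colP => j; rewrite /diag_form mulmxDl mul_scalar_mx -scalemxAl mulmxBl.
have E k : (delta_mx k k *m w^T) j 0 = (j == k)%:R * w 0 j.
  rewrite mxE (bigD1 k)//= !mxE eqxx andbT big1 ?addr0; last first.
    by move=> l /negPf lk; rewrite mxE lk andbF mul0r.
  by case: eqP => [->//|_]; rewrite !mul0r.
have E1 := E (letter i); have E2 := E ord0.
set A := delta_mx _ _ *m _ in E1 *; set B := delta_mx _ _ *m _ in E2 *.
move: A B E1 E2 => A B E1 E2.
by rewrite !mxE E1 E2 !mxE.
Qed.

(** After undoing G, the last coordinate, which is no letter because m < n, shows that the c_i add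
    up to zero. Then coordinate [letter i] shows c_i = 0 for i != 0. *)
Lemma base_columns_free (c : 'I_m.+1 -> R) :
  (forall j, \sum_i c i * base_tuple i j ord0 = 0) -> forall i, c i = 0.
Proof.
move=> h; pose v := \sum_i c i *: (diag_form R mn i *m w^T).
have Gv : G *m v = 0.
  apply/colP => j; rewrite [RHS]mxE -[RHS](h j) mulmx_sumr summxE.
  by apply: eq_bigr => i _; rewrite e0G -scalemxAr [LHS]mxE.
have v0 : v = 0 by rewrite -[v]mul1mx -GiG -mulmxA Gv mulmx0.
have vE j : n.+1%:R * w 0 j * \sum_i c i +
   \sum_i c i * i%:R * ((j == letter i)%:R - (j == ord0)%:R) * w 0 j = 0.
  have := congr1 (fun M : 'cV_n.+1 => M j 0) v0; rewrite [X in _ = X]mxE => vj.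
  rewrite -[RHS]vj /v summxE big_distrr -big_split/=; apply: eq_bigr => i _.
  by rewrite corner_col !mxE; ring.
have n0 : n.+1%:R != 0 :> R by rewrite pnatr_eq0.
have max0 : ord_max != ord0 :> 'I_n.+1 by rewrite -val_eqE/= -lt0n (leq_trans _ mn).
have sc : \sum_i c i = 0.
  have := vE ord_max; rewrite wE (negPf max0) [X in _ + X]big1 ?addr0.
    by move=> /eqP; rewrite !mulf_eq0 (negPf n0) pnatr_eq0/= => /eqP.
  move=> i _; rewrite (_ : ord_max == letter i = false) ?subrr ?mulr0 ?mul0r//.
  by rewrite -val_eqE/= gtn_eqF// (leq_trans (ltn_ord i)).
have ci (i : 'I_m.+1) : i != ord0 -> c i = 0.
  move=> i0; have li0 : letter i != ord0 by rewrite -val_eqE/=.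
  have := vE (letter i); rewrite sc mulr0 add0r wE (negPf li0) (bigD1 i)//= eqxx.
  rewrite big1 ?addr0; last first.
    move=> k /negPf ki; rewrite (_ : letter i == letter k = false) ?subrr ?mulr0 ?mul0r//.
    by rewrite -val_eqE/= val_eqE eq_sym.
  move=> /eqP; rewrite subr0 mulr1 !mulf_eq0 !pnatr_eq0 orbF => /orP[/eqP//|].
  by rewrite -(inj_eq val_inj)/= in i0; rewrite (negPf i0).
move=> i; have [->|/ci//] := eqVneq i ord0.
by rewrite -[RHS]sc (bigD1 ord0)//= big1 ?addr0.
Qed.

End BaseTuple.

(** * Separation of the components by eigenvectors *)

Lemma col_mul_diag (R : comPzRingType) p k (M : 'M[R]_(p, k)) d j :
  col j (M *m diag_mx d) = d 0 j *: col j M.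
Proof. by apply/colP => i; rewrite mul_mx_diag !mxE mulrC. Qed.

Lemma col_mulmx (R : pzRingType) p k l (M : 'M[R]_(p, k)) (N : 'M[R]_(k, l)) j :
  col j (M *m N) = M *m col j N.
Proof. by rewrite !colE mulmxA. Qed.

Section EigenRecovery.
Variables (R : fieldType) (n m : nat).
Variables (B : 'M[R]_(n.+1, m)) (L : 'M[R]_(m, n.+1)).
Hypothesis LB : L *m B = 1%:M.
Variables (lam a : 'rV[R]_m).
Hypothesis lam_neq0 : forall i, lam 0 i != 0.
Hypothesis a_neq0 : forall i, a 0 i != 0.
Hypothesis a_inj : injective (a 0).
Let D := diag_mx lam.
Variable Q : 'M[R]_n.+1.
Hypothesis QM : (B *m D *m B^T) *m Q *m (B *m D *m B^T) = B *m D *m B^T.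
Let A := B *m (D *m diag_mx a) *m B^T *m Q.

Let BtL : B^T *m L^T = 1%:M.
Proof. by rewrite -trmx_mul LB trmx1. Qed.

Let D_unit : D \in unitmx.
Proof.
by rewrite unitmxE det_diag unitfE; apply/prodf_neq0 => i _; exact: lam_neq0.
Qed.

(** L cancels B on the left and L^T cancels B^T on the right of [QM], which leaves D (B^T Q B) D =
    D. So every generalized inverse Q makes the columns of B orthogonal, with values 1 / lam_i. *)
Lemma ginv_dual : B^T *m Q *m B *m D = 1%:M.
Proof.
have : D *m (B^T *m Q *m B *m D) = D *m 1%:M.
  have := congr1 (fun M => L *m M *m L^T) QM.
  rewrite !mulmxA LB mul1mx mulmx1 -[X in X = _]mulmxA BtL mulmx1.
  by rewrite -[X in _ = X]mulmxA BtL mulmx1.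
move=> /(congr1 (mulmx (invmx D))).
by rewrite !mulmxA mulVmx// !mul1mx.
Qed.

Lemma ginv_dualE i j : (B^T *m Q *m B) i j = (i == j)%:R / lam 0 j.
Proof.
have := congr1 (fun M : 'M[R]_m => M i j) ginv_dual; rewrite mul_mx_diag.
by rewrite [X in X = _]mxE [X in _ = X]mxE => <-; rewrite mulfK.
Qed.

Let AB : A *m B = B *m diag_mx a.
Proof.
rewrite /A -!mulmxA; congr (B *m _); rewrite !mulmxA; apply/matrixP => i j.
rewrite -!mulmxA mul_diag_mx [LHS]mxE mul_diag_mx [in LHS]mxE mulmxA.
by rewrite ginv_dualE !mxE; case: eqVneq => [->|_]; rewrite ?mul0r ?mulr0//=; field.
Qed.

(** A maps into the span of the columns of B and multiplies them by the a_i, so X times the product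
    of the X - a_i annihilates it. The roots of this polynomial are simple because the a_i are
    nonzero and distinct. *)
Lemma recovery_diagonalizable :
  exists Vd : 'M[R]_n.+1 * 'rV[R]_n.+1,
    Vd.1 \in unitmx /\ A *m Vd.1 = Vd.1 *m diag_mx Vd.2.
Proof.
have eigB j (q : {poly R}) : horner_mx A q *m col j B = q.[a 0 j] *: col j B.
  have Aj : A *m col j B = a 0 j *: col j B.
    by rewrite -col_mulmx AB col_mul_diag.
  elim/poly_ind: q => [|q c IH]; first by rewrite horner0 rmorph0 mul0mx scale0r.
  rewrite rmorphD rmorphM/= horner_mx_X horner_mx_C mulmxDl -mulmxA Aj.
  by rewrite -scalemxAr IH mul_scalar_mx hornerMXaddC scalerDl scalerA mulrC.
pose rs := 0 :: [seq a 0 i | i <- enum 'I_m].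
have [P Pu /similar_diagLR-/(_ Pu)[d Ad]] : exists2 P, P \in unitmx & similar_diag P A.
  apply/diagonalizableP; exists rs.
    rewrite /= map_inj_uniq// enum_uniq andbT; apply/mapP => -[i _ ai].
    by have := a_neq0 i; rewrite -ai eqxx.
  apply: mxminpoly_min; rewrite big_cons big_map big_enum/= subr0 mulrC rmorphM/=.
  rewrite horner_mx_X {2}/A -!mulmxA [LHS]mulmxA.
  rewrite (_ : _ *m B = 0) ?mul0mx//; apply/matrixP => i j; rewrite [RHS]mxE.
  have qj : (\prod_i ('X - (a 0 i)%:P)).[a 0 j] = 0.
    by rewrite horner_prod (bigD1 j)//= hornerXsubC subrr mul0r.
  have := eigB j (\prod_i ('X - (a 0 i)%:P)); rewrite qj scale0r -col_mulmx.
  move=> /colP/(_ i).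
  by rewrite [X in X = _ -> _]mxE [X in _ = X -> _]mxE.
exists (invmx P, d); split; first by rewrite unitmx_inv.
by rewrite /= Ad conjumx ?unitmx_inv// invmxK mulmxK.
Qed.

(** An eigenvector with nonzero eigenvalue lies in the span of the columns of B, where the
    eigenspaces are lines since the a_i are distinct. Two columns of V on one line would contradict
    invertibility, so each line occurs exactly once. *)
Lemma eigenvector_match (V : 'M[R]_n.+1) (d : 'rV[R]_n.+1) :
  V \in unitmx -> A *m V = V *m diag_mx d ->
  exists (f : 'I_m -> 'I_n.+1) (c : 'I_m -> R),
    [/\ injective f, forall i, c i != 0, forall i, col (f i) V = c i *: col i B,
        forall i, d 0 (f i) = a 0 i & forall l, l \notin codom f -> d 0 l = 0].
Proof.
move=> Vu AV.
have Bcol i : col i B != 0.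
  apply/eqP => Bi; have := congr1 (fun M : 'cV_m => M i 0) (congr1 (mulmx L) Bi).
  rewrite mulmx0 colE mulmxA LB mul1mx !mxE eqxx/= => /eqP; by rewrite oner_eq0.
have Binj (y : 'cV[R]_m) : B *m y = 0 -> y = 0.
  by move=> By; rewrite -[y]mul1mx -LB -mulmxA By mulmx0.
have AVl l : A *m col l V = d 0 l *: col l V by rewrite -col_mulmx AV col_mul_diag.
have Bdiag y i : (diag_mx a *m y) i 0 = a 0 i * y i 0 by rewrite mul_diag_mx mxE.
have ex1 i : exists l, d 0 l = a 0 i.
  pose x := invmx V *m col i B.
  have Vx : V *m x = col i B by rewrite mulmxA mulmxV// mul1mx.
  have dx : diag_mx d *m x = a 0 i *: x.
    rewrite -[LHS]mul1mx -(mulVmx Vu) -mulmxA (mulmxA V) -AV -mulmxA Vx.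
    by rewrite -col_mulmx AB col_mul_diag -scalemxAr.
  have [l xl] : exists l, x l 0 != 0.
    apply/existsP; apply: contraNT (Bcol i) => /existsPn h; rewrite -Vx.
    rewrite (_ : x = 0) ?mulmx0//; apply/colP => l; rewrite [RHS]mxE; apply/eqP.
    by have := h l; rewrite negbK.
  exists l; apply: (mulIf xl).
  by have /colP/(_ l) := dx; rewrite mul_diag_mx [X in X = _]mxE [X in _ = X]mxE.
have [f fE] := fin_all_exists ex1.
have colV l : d 0 l != 0 -> exists i c, d 0 l = a 0 i /\ col l V = c *: col i B.
  move=> dl; pose y := (d 0 l)^-1 *: (D *m diag_mx a *m B^T *m Q *m col l V).
  have yE : B *m y = col l V.
    rewrite /y -scalemxAr; apply: (scalerI dl); rewrite scalerA divff// scale1r.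
    by rewrite -AVl /A !mulmxA.
  have ay : diag_mx a *m y = d 0 l *: y.
    apply/eqP; rewrite -subr_eq0; apply/eqP/Binj.
    by rewrite mulmxBr mulmxA -AB -mulmxA yE AVl -scalemxAr yE subrr.
  have ayi i : (a 0 i - d 0 l) * y i 0 = 0.
    have /colP/(_ i) := ay; rewrite mul_diag_mx [X in X = _]mxE [X in _ = X]mxE.
    by move=> e; rewrite mulrBl e subrr.
  have [i yi] : exists i, y i 0 != 0.
    apply/existsP; apply: contraT => /existsPn h.
    have y0 : y = 0.
      apply/colP => i; rewrite [RHS]mxE; apply/eqP; by have := h i; rewrite negbK.
    have := congr1 (mulmx (invmx V)) (etrans (esym yE) (congr1 (mulmx B) y0)).
    rewrite !mulmx0 colE mulmxA mulVmx// mul1mx => /colP/(_ l).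
    by rewrite !mxE !eqxx/= => /eqP; rewrite oner_eq0.
  have dai : d 0 l = a 0 i.
    have /eqP := ayi i; rewrite mulf_eq0 (negPf yi) orbF subr_eq0.
    by move=> /eqP.
  exists i, (y i 0); split => //; rewrite -yE; apply/colP => k.
  rewrite mxE (bigD1 i)//= big1 ?addr0; first by rewrite !mxE mulrC.
  move=> i' ii'; have /eqP := ayi i'; rewrite mulf_eq0 subr_eq0 dai.
  by rewrite (inj_eq a_inj) (negPf ii')/= => /eqP ->; rewrite mulr0.
have cE i : exists c, c != 0 /\ col (f i) V = c *: col i B.
  have [|i' [c [da cV]]] := colV (f i); first by rewrite fE.
  have ii' : i = i' by apply: a_inj; rewrite -fE da.
  exists c; split; last by rewrite cV ii'.
  apply/eqP => c0; have := congr1 (mulmx (invmx V)) cV.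
  rewrite c0 scale0r mulmx0 colE mulmxA mulVmx// mul1mx => /colP/(_ (f i)).
  by rewrite !mxE !eqxx/= => /eqP; rewrite oner_eq0.
have [c /all_and2[c0 cV]] := fin_all_exists cE.
exists f, c; split=> //.
  by move=> i j fij; apply: a_inj; rewrite -(fE i) -(fE j) fij.
move=> l lf; apply/eqP; apply: contraR lf => dl.
have [i [c' [da cl]]] := colV l dl.
suff -> : l = f i by exact: codom_f.
apply/eqP; apply: contraT => lfi.
have VE : V *m (c i *: delta_mx l 0 - c' *: delta_mx (f i) 0) = 0 :> 'cV_n.+1.
  by rewrite mulmxBr -!scalemxAr -!colE cl cV !scalerA [c' * _]mulrC subrr.
have := congr1 (mulmx (invmx V)) VE.
rewrite mulmxA mulVmx// mul1mx mulmx0 => /colP/(_ l).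
rewrite !mxE !eqxx (negPf lfi)/= mulr1 mulr0 subr0 => /eqP.
by rewrite (negPf (c0 i)).
Qed.

End EigenRecovery.

(** * Moments of Gaussian mixtures *)

Section GaussianMoments.
Variables (R : realType) (s : R).
Hypothesis s_neq0 : s != 0.
Notation mu := (@lebesgue_measure R).
Let p := @normal_pdf R 0 s.

Let pE x : p x = normal_peak s * expR (- (s ^+ 2 *+ 2)^-1 * x ^+ 2).
Proof.
rewrite /p normal_pdfE// /normal_fun subr0; congr (_ * expR _).
by rewrite !mulNr mulrC.
Qed.

Let s2 : 0 < s ^+ 2.
Proof. by rewrite exprn_even_gt0. Qed.

Lemma is_derive_normal_pdf (x : R) :
  is_derive (x : R^o) 1 (p : R^o -> R^o) (- (x / s ^+ 2) * p x).
Proof.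
have -> : p = normal_peak s \*: (expR \o (- (s ^+ 2 *+ 2)^-1 \*: (fun y : R => y ^+ 2))).
  by apply/funext => y; rewrite pE.
apply: is_derive_eq.
rewrite !scaler1 /GRing.scale/= /GRing.scale/=.
field.
by rewrite s_neq0.
Qed.

(** Bounding exp (c x^2) below by its Taylor term of order k + 1 leaves at most C / x for x >= 1. *)
Lemma cvg_expn_normal_pdf k : x ^+ k * p x @[x --> +oo] --> (0 : R).
Proof.
pose c := (s ^+ 2 *+ 2)^-1.
have c0 : 0 < c by rewrite invr_gt0 mulrn_wgt0.
pose C := normal_peak s * k.+1`!%:R / c ^+ k.+1.
have f0 : 0 < k.+1`!%:R :> R by rewrite ltr0n fact_gt0.
have C0 : 0 < C.
  by apply: divr_gt0; [apply: mulr_gt0 => //; exact: normal_peak_gt0|exact: exprn_gt0].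
apply: (@squeeze_cvgr _ _ _ _ (cst 0) (fun x => C * x^-1)).
- near=> x.
  have x1 : 1 <= x by near: x; exact: nbhs_pinfty_ge.
  have x0 : 0 < x by exact: lt_le_trans x1.
  have px : 0 <= p x by exact: normal_pdf_ge0.
  rewrite mulr_ge0 ?exprn_ge0 ?(ltW x0)//=.
  rewrite pE -/c mulNr expRN.
  have h : (c * x ^+ 2) ^+ k.+1 / k.+1`!%:R <= expR (c * x ^+ 2).
    apply: le_trans (expR_ge1Dxn k _); first by rewrite lerDr.
    by rewrite mulr_ge0 ?sqr_ge0 ?ltW.
  have h0 : 0 < (c * x ^+ 2) ^+ k.+1 / k.+1`!%:R.
    by rewrite divr_gt0// exprn_gt0// mulr_gt0// exprn_gt0.
  rewrite (@le_trans _ _ (x ^+ k * (normal_peak s * ((c * x ^+ 2) ^+ k.+1 / k.+1`!%:R)^-1)))//.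
    rewrite ler_wpM2l ?exprn_ge0 ?(ltW x0)// ler_wpM2l ?normal_peak_ge0//.
    by rewrite lef_pV2// posrE ?expR_gt0.
  rewrite invfM invrK exprMn invfM -exprM mulnS exprD mulnC exprM.
  have kx : 1 <= x ^+ k by exact: exprn_ege1.
  have kx0 : 0 < x ^+ k by exact: lt_le_trans kx.
  rewrite [leLHS](_ : _ = C * ((x ^+ k)^-1 * x^-1 ^+ 2)); last first.
    rewrite /C; field.
    by rewrite ?gt_eqF ?exprn_gt0.
  rewrite ler_wpM2l ?(ltW C0)// expr2 mulrA -[leRHS]mul1r ler_wpM2r ?invr_ge0 ?(ltW x0)//.
  by rewrite -invfM invf_le1 ?mulr_gt0// -[1]mulr1 ler_pM.
- exact: cvg_cst.
- rewrite -[X in _ --> X](mulr0 C); apply: cvgM; first exact: cvg_cst.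
  apply: (proj2 (gtr0_cvgV0 (f := fun x : R => x) _)); last exact: cvg_id.
  exact: nbhs_pinfty_gt.
Unshelve. all: by end_near. Qed.

Let cp : continuous p.
Proof. exact: continuous_normal_pdf. Qed.

Let p_ge0 x : 0 <= p x.
Proof. exact: normal_pdf_ge0. Qed.

Let mp : measurable_fun setT p.
Proof. exact: measurable_normal_pdf. Qed.

Let sym_even k (x : R) : x ^+ (2 * k) * p x = (- x) ^+ (2 * k) * p (- x).
Proof. by rewrite !pE !exprM !sqrrN. Qed.

Let cxp k : continuous (fun x : R => x ^+ k * p x).
Proof. by move=> x; apply: cvgM; [exact: exprn_continuous|exact: cp]. Qed.

Let setc : [set x : R | 0 <= x] = `[0, +oo[%classic.
Proof. by apply/seteqP; split => x /=; rewrite in_itv/= andbT. Qed.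

Let FTC_half k (F : R -> R) l :
  (forall x : R, is_derive (x : R^o) 1 (F : R^o -> R^o) (x ^+ (2 * k) * p x)) ->
  F x @[x --> +oo] --> l ->
  (\int[mu]_(x in [set x | (0 <= x)%R]) (x ^+ (2 * k) * p x)%:E = (l - F 0)%:E)%E.
Proof.
move=> dF Fl; rewrite setc EFinB.
apply: ge0_continuous_FTC2y => //.
- by move=> x x0; rewrite mulr_ge0 ?exprn_ge0.
- by apply: continuous_subspaceT; exact: cxp.
- by apply: cvg_at_right_filter; apply: differentiable_continuous; apply/derivable1_diffP.
- by move=> x _; rewrite derive1E; exact: derive_val.
Qed.

Let half0 : (\int[mu]_(x in [set x | (0 <= x)%R]) (p x)%:E = (2^-1)%:E)%E.
Proof.
have ev : p =1 p \o -%R by move=> x /=; have := sym_even 0 x; rewrite !mul1r.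
have := ge0_symfun_integralT p_ge0 cp ev.
rewrite integral_normal_pdf.
set I := (X in (_ * X)%E) => h.
have : (2^-1)%:E = ((2^-1)%:E * (2%:E * I))%E by rewrite -h mule1.
by rewrite muleA -EFinM mulVf ?pnatr_eq0// mul1e => ->.
Qed.

Let antideriv k : exists F l,
  [/\ forall x : R, is_derive (x : R^o) 1 (F : R^o -> R^o) (x ^+ (2 * k) * p x),
      F x @[x --> +oo] --> l &
      l - F 0 = (\prod_(i < k) (2 * i + 1)%:R) * s ^+ (2 * k) / 2].
Proof.
elim: k => [|k [F [l [dF Fl lF]]]].
  pose F x := (\int[mu]_(t in [set` `]-oo, x]]) (p t))%R.
  have ip := integrable_normal_pdf (0 : R) s.
  have dF (x : R) : is_derive (x : R^o) 1 (F : R^o -> R^o) (x ^+ (2 * 0) * p x).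
    have [||||d e] := @continuous_FTC1 R p -oo%O x (x + 1).
    + by rewrite ltrDl.
    + exact: integrableS ip.
    + by rewrite ltNyr.
    + exact: cp.
    by apply: DeriveDef => //; rewrite -derive1E e mul1r.
  have iI : fine (\int[mu]_x (p x)%:E)%E = 1 by rewrite integral_normal_pdf.
  have Fnd : {homo F : x y / x <= y}.
    move=> x y xy; rewrite /F /Rintegral fine_le//.
    + by apply: integrable_fin_num => //; exact: integrableS ip.
    + by apply: integrable_fin_num => //; exact: integrableS ip.
    apply: ge0_subset_integral => //.
    + by apply/measurable_EFinP; exact: measurable_funTS.
    + by move=> t _; rewrite lee_fin.
    + by apply: subset_itvl; rewrite bnd_simp.
  have Fub x : F x <= 1.
    rewrite -iI fine_le//.
    + by apply: integrable_fin_num => //; exact: integrableS ip.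
    + by rewrite integral_normal_pdf.
    apply: (@ge0_subset_integral _ _ _ mu `]-oo, x] setT) => //.
    + by apply/measurable_EFinP.
    + by move=> t _; rewrite lee_fin.
  have [l Fl] : exists l : R, F x @[x --> +oo] --> l.
    exists (sup (range F)); apply: nondecreasing_cvgr => //.
    by exists 1 => _ [x _ <-].
  exists F, l; split => //.
  have := FTC_half dF Fl.
  under eq_integral do rewrite mul1r.
  by rewrite half0 big_ord0 !mul1r => -[].
exists (fun x => s ^+ 2 * ((2 * k + 1)%:R * F x - x ^+ (2 * k + 1) * p x)).
exists (s ^+ 2 * ((2 * k + 1)%:R * l - 0)); split.
- move=> x.
  have d1 := dF x.
  have d2 := is_derive_normal_pdf x.
  pose q : R^o -> R^o := fun y => y ^+ (2 * k + 1).
  have d3 : is_derive (x : R^o) 1 q ((2 * k + 1)%:R * x ^+ (2 * k)).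
    have -> : q = (@id R) ^+ (2 * k).+1 by apply/funext => y; rewrite fctE /q addn1.
    apply: is_derive_eq; rewrite /GRing.scale/= mulr1 addn1.
    by rewrite mulr_natl.
  have -> : (fun x : R => s ^+ 2 * ((2 * k + 1)%:R * F x - x ^+ (2 * k + 1) * p x)) =
    s ^+ 2 \*: ((2 * k + 1)%:R \*: F - q * p).
    by apply/funext => y.
  apply: is_derive_eq.
  rewrite /GRing.scale/= /GRing.scale/= /q !addn1/= mulnS !exprS.
  by field.
- apply: cvgM; first exact: cvg_cst.
  apply: (@cvgB _ R^o); last exact: cvg_expn_normal_pdf.
  by apply: cvgM => //; exact: cvg_cst.
- have -> : 0 ^+ (2 * k + 1) = 0 :> R by rewrite addn1 exprS mul0r.
  rewrite mul0r !subr0 -!mulrBr lF big_ord_recr/= mulnS exprD.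
  by field.
Qed.

Lemma integral_expn_normal_pdf k :
  (\int[mu]_x (x ^+ (2 * k) * p x)%:E =
   ((\prod_(i < k) (2 * i + 1)%:R) * s ^+ (2 * k))%:E)%E.
Proof.
have [F [l [dF Fl lF]]] := antideriv k.
rewrite ge0_symfun_integralT.
- rewrite (FTC_half dF Fl) lF -EFinM; congr _%:E; by field.
- by move=> x; rewrite mulr_ge0// exprM exprn_ge0// sqr_ge0.
- exact: cxp.
- by move=> x /=; exact: sym_even.
Qed.

End GaussianMoments.

(** The density agrees almost everywhere with the Radon-Nikodym derivative, as both have the same
    integrals over measurable sets. *)
Lemma ge0_integral_normal_prob (R : realType) (s : R) (f : R -> \bar R) :
  s != 0 -> (forall x, 0 <= f x)%E -> measurable_fun setT f ->
  (\int[normal_prob 0 s]_x f x =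
   \int[lebesgue_measure]_x (f x * (normal_pdf 0 s x)%:E))%E.
Proof.
move=> s0 f0 mf.
have dom := @normal_prob_dominates R 0 s.
rewrite -(Radon_Nikodym_SigmaFinite.change_of_variables dom)//.
have iRN := Radon_Nikodym_SigmaFinite.f_integrable dom.
have mRN := measurable_int _ iRN.
have mpdf : measurable_fun setT (fun x : R => (normal_pdf 0 s x)%:E).
  by apply/measurable_EFinP; exact: measurable_normal_pdf.
apply: ge0_ae_eq_integral => //.
- exact: emeasurable_funM.
- exact: emeasurable_funM.
- by move=> x _; rewrite mule_ge0//; exact: Radon_Nikodym_SigmaFinite.f_ge0.
- by move=> x _; rewrite mule_ge0// lee_fin normal_pdf_ge0.
apply: ae_eqe_mul2l.
apply: integral_ae_eq => //.
by move=> E _ mE; rewrite -(Radon_Nikodym_SigmaFinite.f_integral dom).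
Qed.

Lemma normal_moment (R : realType) (s : R) k : s != 0 ->
  (\int[normal_prob 0 s]_x (x ^+ (2 * k))%:E =
   ((\prod_(i < k) (2 * i + 1)%:R) * s ^+ (2 * k))%:E)%E.
Proof.
move=> s0; rewrite ge0_integral_normal_prob//.
- by under eq_integral do rewrite -EFinM; exact: integral_expn_normal_pdf.
- by move=> x; rewrite lee_fin exprM exprn_ge0// sqr_ge0.
- by apply/measurable_EFinP; exact: exprn_measurable.
Qed.

(** In a degenerate direction the law is a Dirac mass, and the formula stays right at v = 0,
    including 0 ^+ 0 = 1 for k = 0. *)
Lemma gaussian_even_moment (R : realType) (v : R) k
    (nu : {measure set (measurableTypeR R) -> \bar R}) : 0 <= v ->
  (forall A, measurable A ->
    nu A = if v == 0 then \d_(0 : R) A else normal_prob 0 (Num.sqrt v) A) ->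
  (\int[nu]_x (x ^+ (2 * k))%:E =
   ((\prod_(i < k) (2 * i + 1)%:R) * v ^+ k)%:E)%E.
Proof.
move=> v0; have [->|vn0] := eqVneq v 0 => nuE.
  rewrite (eq_measure_integral \d_(0 : measurableTypeR R)); last by move=> A mA _; exact: nuE.
  rewrite integral_dirac//; last first.
    by apply/measurable_EFinP; exact: exprn_measurable.
  rewrite diracT mul1e; case: k => [|k]; first by rewrite big_ord0 !mul1r.
  by rewrite mulnS !exprS !mul0r mulr0.
transitivity (\int[normal_prob 0 (Num.sqrt v)]_x (x ^+ (2 * k))%:E)%E.
  by apply: eq_measure_integral => A mA _; exact: nuE.
rewrite normal_moment; last by rewrite gt_eqF// sqrtr_gt0 lt_neqAle eq_sym vn0.
by rewrite exprM sqr_sqrtr.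
Qed.

Definition linf (R : realType) n (u : 'rV[R]_n) (y : n.-tuple R) :
    measurableTypeR R :=
  \sum_(i < n) u 0 i * tnth y i.

Lemma measurable_linf (R : realType) n (u : 'rV[R]_n) :
  measurable_fun setT (linf u).
Proof.
apply: measurable_sum => i; apply: measurable_funM; first exact: measurable_cst.
exact: measurable_tnth.
Qed.

HB.instance Definition _ (R : realType) n (u : 'rV[R]_n) :=
  isMeasurableFun.Build _ _ _ _ (linf u) (measurable_linf u).

(** * Mixed moments of a mixture by polarization *)

Section Mixture.
Variables (R : realType) (n m : nat) (d d' : measure_display)
  (T : measurableType d) (P : probability T R) (Y : {RV P >-> n.-tuple R})
  (T' : measurableType d') (P' : probability T' R)
  (G : 'I_m -> {RV P' >-> n.-tuple R}) (lam : 'I_m -> R)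
  (S : 'I_m -> 'M[R]_n).
Hypothesis YG : is_mixture Y G lam.
Hypothesis GS : forall i, centered_gaussian (G i) (S i).

Lemma mixture_even_moment (u : 'rV[R]_n) k :
  (\int[P]_t (linf u (Y t) ^+ (2 * k))%:E =
   (\sum_(i < m) lam i * ((\prod_(j < k) (2 * j + 1)%:R) *
      ((u *m S i *m u^T) 0 0) ^+ k))%:E)%E.
Proof.
have [lam0 lam1 lamY] := YG.
have mlin := measurable_linf u.
have mX (D : set (measurableTypeR R)) :
    measurable_fun D (fun x : measurableTypeR R => (x ^+ (2 * k))%:E).
  by apply/measurable_EFinP; apply: measurable_funTS; exact: exprn_measurable.
have X0 x : (0 <= (x ^+ (2 * k))%:E :> \bar R)%E.
  by rewrite lee_fin exprM exprn_ge0// sqr_ge0.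
pose YU : {mfun T >-> measurableTypeR R} := linf u \o Y.
pose GU i : {mfun T' >-> measurableTypeR R} := linf u \o G i.
pose nu i : {measure set (measurableTypeR R) -> \bar R} := distribution P' (GU i).
transitivity (\int[distribution P YU]_x (x ^+ (2 * k))%:E)%E.
  by rewrite ge0_integral_distribution.
(* [msum] runs over natural numbers, so the weighted laws of the components are extended by the zero
   measure. *)
pose ms (j : nat) : {measure set (measurableTypeR R) -> \bar R} :=
  if insub j is Some i then mscale (NngNum (lam0 i)) (nu i) else mzero.
transitivity (\int[msum ms m]_x (x ^+ (2 * k))%:E)%E.
  apply: eq_measure_integral => A mA _.
  have mlA : measurable (linf u @^-1` A).
    by rewrite -[X in measurable X]setTI; apply: mlin.
  rewrite -[RHS]/(\sum_(i < m) ms i A)%E.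
  rewrite -[LHS]/(distribution P Y (linf u @^-1` A)) lamY//.
  apply: eq_bigr => i _; rewrite /ms insubT// => im.
  by rewrite (_ : Sub _ _ = i)//; apply: val_inj.
rewrite ge0_integral_measure_sum// -sumEFin; apply: eq_bigr => i _.
rewrite /ms insubT// => im; rewrite (_ : Sub _ _ = i); last exact: val_inj.
rewrite ge0_integral_mscale// EFinM; congr (_ * _)%E.
have [[Ssym Spsd] Snu] := GS i.
apply: gaussian_even_moment => [|A mA]; first exact: Spsd.
exact: (Snu u A mA).
Qed.

Let integrable_linf (u : 'rV[R]_n) k :
  P.-integrable setT (fun t => (linf u (Y t) ^+ (2 * k))%:E).
Proof.
have mY : measurable_fun setT (fun t => linf u (Y t)).
  apply: (measurableT_comp (measurable_linf u)); exact: measurable_funPT.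
apply/integrableP; split.
  by apply/measurable_EFinP; exact: measurable_funX.
rewrite (eq_integral (fun t => (linf u (Y t) ^+ (2 * k))%:E)).
  by rewrite mixture_even_moment ltry.
by move=> t _; rewrite gee0_abs// lee_fin exprM exprn_ge0// sqr_ge0.
Qed.

(** Even powers of linear forms only involve one-dimensional Gaussian laws and, being nonnegative,
    are integrable once their integral is finite. Polarization reduces all needed moments to
    them. *)
Lemma mixture_moment_comb k (s : seq (R * 'rV[R]_n)) (f : n.-tuple R -> R) :
  (forall y, f y = \sum_(p <- s) p.1 * linf p.2 y ^+ (2 * k)) ->
  ('E_P[fun t => f (Y t)])%E =
  (\sum_(i < m) lam i * ((\prod_(j < k) (2 * j + 1)%:R) *
     \sum_(p <- s) p.1 * ((p.2 *m S i *m p.2^T) 0 0) ^+ k))%:E.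
Proof.
move=> fE; rewrite unlock.
under eq_integral do rewrite fE -sumEFin.
rewrite integral_sum//; last first.
  move=> p; under eq_fun do rewrite EFinM.
  by apply: integrableZl => //; exact: integrable_linf.
under [in RHS]eq_bigr do rewrite big_distrr big_distrr/=.
rewrite [in RHS]exchange_big/= -sumEFin; apply: eq_bigr => p _.
under eq_integral do rewrite EFinM.
rewrite integralZl//.
rewrite mixture_even_moment -EFinM big_distrr/=; congr _%:E.
by apply: eq_bigr => i _; ring.
Qed.

Let e4 (a b c l : 'I_n) (w x y z : R) : 'rV[R]_n :=
  \row_j (w * (j == a)%:R + x * (j == b)%:R + y * (j == c)%:R + z * (j == l)%:R).

Let sum_delta (F : 'I_n -> R) a : \sum_j (j == a)%:R * F j = F a.
Proof.
rewrite (bigD1 a)//= eqxx mul1r big1 ?addr0// => j /negPf ->; exact: mul0r.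
Qed.

Let linf_e4 a b c l w x y z t :
  linf (e4 a b c l w x y z) t =
  w * tnth t a + x * tnth t b + y * tnth t c + z * tnth t l.
Proof.
rewrite /linf -(sum_delta (tnth t) a) -(sum_delta (tnth t) b)
  -(sum_delta (tnth t) c) -(sum_delta (tnth t) l) !big_distrr -!big_split/=.
by apply: eq_bigr => j _; rewrite mxE; ring.
Qed.

Let form_e4 i a b c l w x y z (u := e4 a b c l w x y z) :
  (u *m S i *m u^T) 0 0 =
    w ^+ 2 * S i a a + x ^+ 2 * S i b b + y ^+ 2 * S i c c + z ^+ 2 * S i l l
  + 2 * (w * x * S i a b + w * y * S i a c + w * z * S i a l
  + x * y * S i b c + x * z * S i b l + y * z * S i c l).
Proof.
have [[Ssym _] _] := GS i.
have sym j k : S i j k = S i k j by rewrite -[in LHS]Ssym mxE.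
have rowE j : (u *m S i) 0 j = w * S i a j + x * S i b j + y * S i c j + z * S i l j.
  rewrite mxE -(sum_delta (S i ^~ j) a) -(sum_delta (S i ^~ j) b)
    -(sum_delta (S i ^~ j) c) -(sum_delta (S i ^~ j) l) !big_distrr -!big_split/=.
  by apply: eq_bigr => j' _; rewrite mxE; ring.
rewrite mxE; under eq_bigr do rewrite rowE 2!mxE.
set F := fun j => w * S i a j + x * S i b j + y * S i c j + z * S i l j.
transitivity (w * F a + x * F b + y * F c + z * F l).
  rewrite -(sum_delta F a) -(sum_delta F b) -(sum_delta F c) -(sum_delta F l).
  rewrite !big_distrr -!big_split/=.
  by apply: eq_bigr => j _; rewrite /F; ring.
rewrite /F (sym b a) (sym c a) (sym l a) (sym c b) (sym l b) (sym l c).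
by ring.
Qed.

Lemma mixture_moment2 a b :
  ('E_P[fun t => (tnth (Y t) a * tnth (Y t) b)%R])%E = (\sum_(i < m) lam i * S i a b)%:E.
Proof.
rewrite (@mixture_moment_comb 1 [:: (4^-1, e4 a b a a 1 1 0 0);
  (- 4^-1, e4 a b a a 1 (-1) 0 0)] (fun y => tnth y a * tnth y b)).
  congr _%:E; apply: eq_bigr => i _; congr (_ * _).
  by rewrite !big_cons !big_nil !big_ord_recr big_ord0/= !form_e4; field.
by move=> y; rewrite !big_cons !big_nil/= !linf_e4; field.
Qed.

Lemma mixture_moment4 a b c l :
  ('E_P[fun t => (tnth (Y t) a * tnth (Y t) b * tnth (Y t) c * tnth (Y t) l)%R])%E =
  (\sum_(i < m) lam i *
    (S i a b * S i c l + S i a c * S i b l + S i a l * S i b c))%:E.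
Proof.
(* Summing x y z (Y_a + x Y_b + y Y_c + z Y_l)^4 over the 8 sign choices gives 8 * 4! = 192 times
   the monomial. *)
pose g (x y z : R) := (x * y * z / 192, e4 a b c l 1 x y z).
rewrite (@mixture_moment_comb 2 [:: g 1 1 1; g 1 1 (-1); g 1 (-1) 1;
  g 1 (-1) (-1); g (-1) 1 1; g (-1) 1 (-1); g (-1) (-1) 1; g (-1) (-1) (-1)]
  (fun y => tnth y a * tnth y b * tnth y c * tnth y l)).
  congr _%:E; apply: eq_bigr => i _; congr (_ * _).
  by rewrite !big_cons !big_nil !big_ord_recr big_ord0/= !form_e4; field.
by move=> y; rewrite !big_cons !big_nil/= !linf_e4; field.
Qed.

Lemma mixture_moment6 e a b :
  ('E_P[fun t => (tnth (Y t) e ^+ 4 * tnth (Y t) a * tnth (Y t) b)%R])%E =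
  (\sum_(i < m) lam i *
    (3 * S i e e ^+ 2 * S i a b + 12 * S i e e * S i e a * S i e b))%:E.
Proof.
(* The signs y, z keep the terms odd in Y_a and in Y_b. The weights 1, -4, 3 at x = 2, 1, 0 kill the
   coefficients of x^0 and x^2 and turn x^4 into 12. The multinomial coefficient is 30, and 12 * 4 *
   30 = 1440. *)
pose g (c x y z : R) := (c * y * z / 1440, e4 e a b b x y z 0).
rewrite (@mixture_moment_comb 3 [:: g 1 2 1 1; g 1 2 1 (-1); g 1 2 (-1) 1;
  g 1 2 (-1) (-1); g (-4) 1 1 1; g (-4) 1 1 (-1); g (-4) 1 (-1) 1;
  g (-4) 1 (-1) (-1); g 3 0 1 1; g 3 0 1 (-1); g 3 0 (-1) 1;
  g 3 0 (-1) (-1)]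
  (fun y => tnth y e ^+ 4 * tnth y a * tnth y b)).
  congr _%:E; apply: eq_bigr => i _; congr (_ * _).
  by rewrite !big_cons !big_nil !big_ord_recr big_ord0/= !form_e4; field.
by move=> y; rewrite !big_cons !big_nil/= !linf_e4; field.
Qed.

End Mixture.

(** * The algorithm *)

Fixpoint nscoped (e : nexp) : bool :=
  match e with
  | NVar x => (x < 4)%N
  | NCst _ => true
  | NAdd e1 e2 | NSub e1 e2 | NMul e1 e2 | NDiv e1 e2 | NMod e1 e2 =>
      nscoped e1 && nscoped e2
  end.

(** For loop bounds, whose value must not change with the loop variables 2 and 3. *)
Fixpoint nsize_only (e : nexp) : bool :=
  match e with
  | NVar x => (x < 2)%N
  | NCst _ => true
  | NAdd e1 e2 | NSub e1 e2 | NMul e1 e2 | NDiv e1 e2 | NMod e1 e2 =>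
      nsize_only e1 && nsize_only e2
  end.

(** Forbids reading array [a], so that the expression keeps its value while [fill] overwrites that
    array. *)
Fixpoint rscoped (a : nat) (e : rexp) : bool :=
  match e with
  | RGet b i => (b != a) && nscoped i
  | RNat i => nscoped i
  | RAdd e1 e2 | RMul e1 e2 => rscoped a e1 && rscoped a e2
  | ROpp e1 | RInv e1 => rscoped a e1
  end.

(* a[c] := \sum_(y < e2) ex(c, y) for c < e1, where c is variable 2 and y is
   variable 3. *)
Definition fill (a : nat) (e1 e2 : nexp) (ex : rexp) : prog :=
  For 2 e1 (Seq (SetR a (NVar 2) (RNat (NCst 0)))
    (For 3 e2 (SetR a (NVar 2) (RAdd (RGet a (NVar 2)) ex)))).

Section Fill.
Variables (R : realType) (n m : nat).
Implicit Types (A : nat -> nat -> R) (st : state R).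

Definition cell_state A (c y : nat) : state R :=
  State (fun x => nth 0%N [:: n; m; c; y] x) A 0.

Definition upd A a (f : nat -> R) : nat -> nat -> R :=
  fun b => if b == a then f else A b.

Definition sized st := (ints st 0 = n /\ ints st 1 = m)%N.

Lemma evalN_size st e : nsize_only e -> sized st ->
  evalN st e = evalN (cell_state (arrs st) 0 0) e.
Proof.
move=> + [h0 h1]; elim: e => //=; first by move=> [|[|]].
all: by move=> e1 IH1 e2 IH2 /andP[/IH1 -> /IH2 ->].
Qed.

Lemma evalN_sizeA A A' e c y : nsize_only e ->
  evalN (cell_state A c y) e = evalN (cell_state A' 0 0) e.
Proof.
elim: e => //=; first by move=> [|[|]].
all: by move=> e1 IH1 e2 IH2 /andP[/IH1 -> /IH2 ->].
Qed.

Let evalN_cell st e A c y : nscoped e -> sized st -> ints st 2 = c ->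
  ints st 3 = y -> evalN st e = evalN (cell_state A c y) e.
Proof.
move=> + [h0 h1] h2 h3; elim: e => //=; first by move=> [|[|[|[|]]]].
all: by move=> e1 IH1 e2 IH2 /andP[/IH1 -> /IH2 ->].
Qed.

Let evalR_cell st a e A c y : rscoped a e -> sized st -> ints st 2 = c ->
  ints st 3 = y -> (forall b, b != a -> arrs st b = A b) ->
  evalR st e = evalR (cell_state A c y) e.
Proof.
move=> + szst h2 h3 hA; elim: e => //=.
- by move=> b i /andP[ba hi]; rewrite (evalN_cell A hi szst h2 h3) hA.
- by move=> i hi; rewrite (evalN_cell A hi szst h2 h3).
- by move=> e1 IH1 e2 IH2 /andP[/IH1 -> /IH2 ->].
- by move=> e1 IH1 /IH1 ->.
- by move=> e1 IH1 e2 IH2 /andP[/IH1 -> /IH2 ->].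
- by move=> e1 IH1 /IH1 ->.
Qed.

Definition fill_value A e2 ex (c : nat) : R :=
  \sum_(0 <= y < evalN (cell_state A 0 0) e2) evalR (cell_state A c y) ex.

Definition fill_arr A a e1 e2 ex : nat -> R := fun c =>
  if (c < evalN (cell_state A 0 0) e1)%N then fill_value A e2 ex c else A a c.

Definition fill_cost e1 e2 : nat :=
  let st := cell_state (fun _ _ => 0) 0 0 in
  (1 + evalN st e1 * (3 + 2 * evalN st e2))%N.

Lemma exec_fill o a e1 e2 ex st : sized st -> nsize_only e1 -> nsize_only e2 ->
  rscoped a ex ->
  [/\ sized (exec o (fill a e1 e2 ex) st),
      arrs (exec o (fill a e1 e2 ex) st) =
        upd (arrs st) a (fill_arr (arrs st) a e1 e2 ex) &
      clock (exec o (fill a e1 e2 ex) st) = (clock st + fill_cost e1 e2)%N].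
Proof.
move=> szst s1 s2 sx.
set A := arrs st.
pose N2 := evalN (cell_state A 0 0) e2.
pose inner := foldl (fun st' i => exec o (SetR a (NVar 2) (RAdd (RGet a (NVar 2)) ex))
   (tick 1 (set_int 3 i st'))).
have innerP st1 c k : sized st1 -> ints st1 2 = c ->
    (forall b, b != a -> arrs st1 b = A b) ->
    let st2 := inner st1 (iota 0 k) in
    [/\ sized st2, ints st2 2 = c, forall b, b != a -> arrs st2 b = A b,
      arrs st2 a = (fun c' => if c' == c then
        arrs st1 a c + \sum_(0 <= y < k) evalR (cell_state A c y) ex else arrs st1 a c') &
      clock st2 = (clock st1 + 2 * k)%N].
  move=> sz1 i1 A1; elim: k => [|k].
    split=> //=; last by rewrite muln0 addn0.
    by apply/funext => c'; rewrite big_geq// addr0; case: eqVneq => [->|].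
  rewrite /inner -[in iota 0 k.+1]addn1 iotaD foldl_cat add0n -/(inner _ _).
  set st2 := inner _ _ => /= -[sz2 i2 A2 a2 c2].
  split.
  - exact: sz2.
  - exact: i2.
  - by move=> b ba; rewrite /= (negPf ba) A2.
  - apply/funext => c'; rewrite /= eqxx i2.
    rewrite (@evalR_cell _ a ex A c k)//=.
    rewrite a2 eqxx; case: eqVneq => [_|//].
    by rewrite big_nat_recr//= addrA.
  - by rewrite /= c2; lia.
pose outer := foldl (fun st' i => exec o (Seq (SetR a (NVar 2) (RNat (NCst 0)))
    (For 3 e2 (SetR a (NVar 2) (RAdd (RGet a (NVar 2)) ex))))
   (tick 1 (set_int 2 i st'))).
have outerP k : let st2 := outer (tick 1 st) (iota 0 k) in
    [/\ sized st2, forall b, b != a -> arrs st2 b = A b,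
      arrs st2 a = (fun c' => if (c' < k)%N then fill_value A e2 ex c' else A a c') &
      clock st2 = (clock st + 1 + (3 + 2 * N2) * k)%N].
  elim: k => [|k]; first by split=> //=; rewrite muln0 addn0.
  rewrite /outer -[in iota 0 k.+1]addn1 iotaD foldl_cat add0n -/(outer _ _).
  set st2 := outer _ _; cbv zeta => -[sz2 A2 a2 c2] /=.
  set st3 := tick 1 _.
  have sz3 : sized st3 by [].
  rewrite (_ : evalN _ e2 = N2); last first.
    by rewrite evalN_size//; exact: evalN_sizeA.
  have [||b ba|sz4 i4 A4 a4 c4] := innerP st3 k N2; rewrite //=.
    by rewrite (negPf ba) A2.
  rewrite -/inner; split=> //.
  - rewrite a4; apply/funext => c'; rewrite /= eqxx eqxx add0r a2.
    by case: (ltngtP c' k) => [ck|ck|->];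
      rewrite ?ltnSn ?(leqW ck) // ltnS leqNgt ck.
  - by rewrite c4 /= c2; lia.
have [sz2 A2 a2 c2] := outerP (evalN st e1).
rewrite /fill [exec _ _ _]/= -/outer; split=> //.
- apply/funext => b; rewrite /upd; case: eqVneq => [->|ba]; last exact: A2.
  by rewrite a2 /fill_arr (evalN_size s1 szst).
- rewrite c2 /fill_cost (evalN_size s1 szst) (evalN_sizeA _ (fun _ _ => 0) _ _ s1).
  by rewrite /N2 (evalN_sizeA _ (fun _ _ => 0) _ _ s2); lia.
Qed.

End Fill.

Local Notation nn := (NVar 0).
Local Notation mm := (NVar 1).
Local Notation vc := (NVar 2).
Local Notation vy := (NVar 3).
Local Notation n2 := (NMul nn nn).
Local Notation n3 := (NMul n2 nn).
Local Notation n4 := (NMul n2 n2).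
Local Notation n8 := (NMul n4 n4).

(** The test for equality as a number 0 or 1, by truncated subtraction. *)
Definition neq (e1 e2 : nexp) := NSub (NCst 1) (NAdd (NSub e1 e2) (NSub e2 e1)).

Definition nlt (e1 e2 : nexp) := NSub (NCst 1) (NSub (NCst 1) (NSub e2 e1)).

Lemma evalN_neq (R : realType) (st : state R) e1 e2 :
  evalN st (neq e1 e2) = (evalN st e1 == evalN st e2).
Proof. rewrite /=; case: eqVneq => [->|]; lia. Qed.

Lemma evalN_nlt (R : realType) (st : state R) e1 e2 :
  evalN st (nlt e1 e2) = (evalN st e1 < evalN st e2)%N.
Proof. rewrite /=; case: ltnP => /=; lia. Qed.

Definition cell (p q : nexp) := NAdd (NMul p nn) q.

(* The four letters of a word of length 4 coded by e < n ^ 4. *)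
Definition let1 e := NDiv (NDiv (NDiv e nn) nn) nn.
Definition let2 e := NMod (NDiv (NDiv e nn) nn) nn.
Definition let3 e := NMod (NDiv e nn) nn.
Definition let4 e := NMod e nn.

(** Constraint l = (a, b, c, d) prescribes X_(ab,cd) + X_(ac,bd) + X_(ad,bc), which is all that
    fourth moments reveal. Pairings coincide when letters repeat, hence a sum of indicators. *)
Definition sdp_entry : rexp :=
  let j := NMod vc n2 in let i := NMod (NDiv vc n2) n2 in
  let l := NDiv (NDiv vc n2) n2 in
  let pairing p q r s := NMul (neq i (cell p q)) (neq j (cell r s)) in
  let a := let1 l in let b := let2 l in let c := let3 l in let d := let4 l in
  RNat (NAdd (NAdd (pairing a b c d) (pairing a c b d)) (pairing a d b c)).

(* Multiplying the coefficient of X^a by a! gives the moment E[Y^a]. *)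
Definition moment2 p q :=
  RMul (RGet 2 (NAdd p (NMul nn q))) (RNat (NAdd (NCst 1) (neq q p))).

(** The factorial is built letter by letter: each contributes one plus the number of equal letters
    before it. *)
Definition moment4 a b c d :=
  RMul (RGet 4 (NAdd a (NMul nn (NAdd b (NMul nn (NAdd c (NMul nn d)))))))
    (RNat (NMul (NMul (NAdd (NCst 1) (neq b a))
      (NAdd (NAdd (NCst 1) (neq c a)) (neq c b)))
      (NAdd (NAdd (NAdd (NCst 1) (neq d a)) (neq d b)) (neq d c)))).

(* E[Y_0^4 Y_p Y_q] *)
Definition moment6 p q :=
  RMul (RGet 6 (NAdd p (NMul nn q)))
    (RNat (NMul (NCst 24) (NMul
      (NAdd (NCst 1) (NMul (NCst 4) (neq p (NCst 0))))
      (NAdd (NAdd (NCst 1) (neq q p)) (NMul (NCst 4) (neq q (NCst 0))))))).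

(** Gaussian fourth moments are sums over three pairings. Subtracting the pairings of second moments
    replaces S_i by H_i, because the weights add up to 1. *)
Definition sdp_rhs : rexp :=
  let a := let1 vc in let b := let2 vc in let c := let3 vc in let d := let4 vc in
  RAdd (moment4 a b c d)
    (ROpp (RAdd (RAdd (RMul (moment2 a b) (moment2 c d))
      (RMul (moment2 a c) (moment2 b d))) (RMul (moment2 a d) (moment2 b c)))).

(** Rigidity only determines X on symmetric matrices, hence the average over the orders of (j, k)
    and of (0, l). The product of second moments undoes the centering. *)
Definition second_entry : rexp :=
  let l := NMod vc nn in let k := NMod (NDiv vc nn) nn in
  let j := NDiv (NDiv vc nn) nn in
  let X p q := RGet 12 (NAdd (NMul p n2) q) in
  RAdd (RMul (RInv (RNat (NCst 4)))
    (RAdd (RAdd (X (cell j k) l) (X (cell j k) (NMul l nn)))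
      (RAdd (X (cell k j) l) (X (cell k j) (NMul l nn)))))
    (RMul (moment2 j k) (moment2 (NCst 0) l)).

(** The matrix of the linear map Q -> M_2 Q M_2 in row-major coordinates. *)
Definition kron_entry : rexp :=
  let r := NDiv vc n2 in let s := NMod vc n2 in
  RMul (RGet 13 (cell (NDiv r nn) (NDiv s nn)))
    (RGet 13 (cell (NMod s nn) (NMod r nn))).

Definition mul_entry (a b : nat) : rexp :=
  RMul (RGet a (cell (NDiv vc nn) vy)) (RGet b (cell vy (NMod vc nn))).

(** E[Y_0^4 Y_p Y_q] is the entry (p, q) of sum_i lam_i (3 a_i^2 S_i + 12 a_i b_i b_i^T). *)
Definition third_entry : rexp :=
  RMul (RAdd (moment6 (NDiv vc nn) (NMod vc nn))
    (ROpp (RMul (RNat (NCst 3)) (RGet 17 vc)))) (RInv (RNat (NCst 12))).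

Definition rsub e1 e2 := RAdd e1 (ROpp e2).
(* x / x is 0 at x = 0 and 1 elsewhere. *)
Definition nonzero e := RMul e (RInv e).
Definition iszero e := rsub (RNat (NCst 1)) (nonzero e).
(* Tests whether eigenvector vy is the s-th one with a nonzero eigenvalue. *)
Definition select s :=
  RMul (RGet 25 vy) (iszero (rsub (RGet 26 vy) (RNat s))).

(* With S_b = sum_i lam_i S_i, H_i = S_i - S_b, a_i the top left entry of S_i and
   b_i = S_i e_0, the arrays hold:
   9, 10, 11  a feasibility problem (zero objective) for the Gram matrix 12,
   13  sum_i lam_i S_i (x) b_i, whose first n^2 entries are
       M_2 = sum_i lam_i b_i b_i^T,
   14, 15  the system M_2 Q M_2 = M_2 and its solution Q,
   17  sum_i lam_i a_i^2 S_i, obtained with the help of 16,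
   18  M_3 = sum_i lam_i a_i b_i b_i^T,
   19  M_3 Q, with eigenvectors b_i and eigenvalues a_i on the image of M_2,
   20, 21  eigenvectors V and eigenvalues of 19,
   22  Q V,
   23  the contraction of 13 with 22, that is c_l S_i when V_l = c_l b_i,
   24  the values c_l^2 / lam_i,
   25, 26  the indicator and the rank of the nonzero eigenvalues,
   27  the values 1 / c_l. *)
Definition steps_gram : prog :=
  Seq (fill 9 n8 (NCst 1) sdp_entry)
  (Seq (fill 10 n4 (NCst 1) sdp_rhs)
  (Seq (Sdp n4 n2 9 10 11 12)
       (fill 13 n3 (NCst 1) second_entry))).

(** Since E[Y_0^5 Y_j] / 15 is the j-th entry of sum_i lam_i a_i^2 b_i, array 16 is Q times this
    vector. The b_i are orthogonal for Q with values 1 / lam_i, so contracting array 13 with it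
    yields array 17. *)
Definition steps_eigen : prog :=
  Seq (fill 14 n4 (NCst 1) kron_entry)
  (Seq (Lin n2 n2 14 13 15)
  (Seq (fill 16 nn nn (RMul (RGet 15 (cell vc vy))
     (RMul (moment6 vy (NCst 0)) (RInv (RNat (NCst 15))))))
  (Seq (fill 17 n2 nn (RMul (RGet 13 (cell vc vy)) (RGet 16 vy)))
  (Seq (fill 18 n2 (NCst 1) third_entry)
  (Seq (fill 19 n2 nn (mul_entry 18 15))
       (Eig nn 19 20 21)))))).

(** The first coordinate of b_i is a_i, which is also the eigenvalue; so eigenvalue over first
    coordinate of V_l is 1 / c_l. The rank of a nonzero eigenvalue is the slot that its component is
    written to. *)
Definition steps_output : prog :=
  Seq (fill 22 n2 nn (mul_entry 15 20))
  (Seq (fill 23 n3 nn (mul_entry 13 22))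
  (Seq (fill 24 nn nn (RMul (RGet 20 (cell vy vc)) (RGet 22 (cell vy vc))))
  (Seq (fill 25 nn (NCst 1) (nonzero (RGet 21 vc)))
  (Seq (fill 26 nn nn (RMul (RNat (nlt vy vc)) (RGet 25 vy)))
  (Seq (fill 27 nn (NCst 1) (RMul (RGet 21 vc) (RInv (RGet 20 vc))))
  (Seq (fill 7 (NMul mm n2) nn (RMul (select (NDiv vc n2))
     (RMul (RGet 23 (cell (NMod vc n2) vy)) (RGet 27 vy))))
       (fill 8 mm nn (RMul (select vc)
     (RInv (RMul (RGet 24 vy) (RMul (RGet 27 vy) (RGet 27 vy)))))))))))).

Definition mixture_alg : prog := Seq steps_gram (Seq steps_eigen steps_output).

(** * Effect and running time of the program *)

Section Exec.
Variables (R : realType) (n m : nat) (o : solvers R).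
Implicit Types A : nat -> nat -> R.

Definition arr_mx A (a p k : nat) : 'M[R]_(p, k) :=
  \matrix_(i < p, j < k) A a (i * k + j)%N.

Definition arr_sdp A (a p k : nat) (l : 'I_p) : 'M[R]_k :=
  \matrix_(i < k, j < k) A a ((l * k + i) * k + j)%N.

Definition pfill a e1 e2 ex A := upd A a (fill_arr n m A a e1 e2 ex).

Definition psdp p k a b c x A := upd A x
  (mx_arr (sdp_solver o (@arr_sdp A a p k) (arr_mx A b p 1) (arr_mx A c k k))).

Definition plin p k a b x A :=
  upd A x (mx_arr (lin_solver o (arr_mx A a p k) (arr_mx A b p 1))).

Definition peig k a v d A :=
  let Vd := eig_solver o (arr_mx A a k k) in
  upd (upd A v (mx_arr Vd.1)) d (mx_arr Vd.2).

Definition runs (s : prog) (F : (nat -> nat -> R) -> nat -> nat -> R) (t : nat) :=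
  forall st, sized n m st -> [/\ sized n m (exec o s st),
    arrs (exec o s st) = F (arrs st) & (clock (exec o s st) <= clock st + t)%N].

Lemma runs_seq s1 s2 F1 F2 t1 t2 : runs s1 F1 t1 -> runs s2 F2 t2 ->
  runs (Seq s1 s2) (F2 \o F1) (t1 + t2).
Proof.
move=> r1 r2 st /r1[z1 e1 c1]; have [z2 e2 c2] := r2 _ z1.
split=> //=; first by rewrite e2 e1.
by rewrite (leq_trans c2)// addnA leq_add2r.
Qed.

Lemma runs_fill a e1 e2 ex : nsize_only e1 -> nsize_only e2 -> rscoped a ex ->
  runs (fill a e1 e2 ex) (pfill a e1 e2 ex) (fill_cost R n m e1 e2).
Proof.
by move=> h1 h2 h3 st sz; have [z e c] := exec_fill o sz h1 h2 h3; rewrite c leqnn.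
Qed.

Lemma runs_sdp ep ek a b c x p k :
  (forall st : state R, sized n m st -> evalN st ep = p /\ evalN st ek = k) ->
  runs (Sdp ep ek a b c x) (psdp p k a b c x) (1 + p * k * k + p + k * k).
Proof. by move=> h st sz; have [<- <-] := h st sz; split=> //=. Qed.

Lemma runs_lin ep ek a b x p k :
  (forall st : state R, sized n m st -> evalN st ep = p /\ evalN st ek = k) ->
  runs (Lin ep ek a b x) (plin p k a b x) (1 + p * k + p + k).
Proof. by move=> h st sz; have [<- <-] := h st sz; split=> //=. Qed.

Lemma runs_eig ek a v d k :
  (forall st : state R, sized n m st -> evalN st ek = k) ->
  runs (Eig ek a v d) (peig k a v d) (1 + k * k + k).
Proof. by move=> h st sz; have <- := h st sz; split=> //=. Qed.

Definition after_gram A :=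
  pfill 13 n3 (NCst 1) second_entry
  (psdp (n * n * (n * n)) (n * n) 9 10 11 12
  (pfill 10 n4 (NCst 1) sdp_rhs
  (pfill 9 n8 (NCst 1) sdp_entry A))).

Definition after_eigen A :=
  peig n 19 20 21
  (pfill 19 n2 nn (mul_entry 18 15)
  (pfill 18 n2 (NCst 1) third_entry
  (pfill 17 n2 nn (RMul (RGet 13 (cell vc vy)) (RGet 16 vy))
  (pfill 16 nn nn (RMul (RGet 15 (cell vc vy))
     (RMul (moment6 vy (NCst 0)) (RInv (RNat (NCst 15)))))
  (plin (n * n) (n * n) 14 13 15
  (pfill 14 n4 (NCst 1) kron_entry A)))))).

Definition after_output A :=
  pfill 8 mm nn (RMul (select vc)
     (RInv (RMul (RGet 24 vy) (RMul (RGet 27 vy) (RGet 27 vy)))))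
  (pfill 7 (NMul mm n2) nn (RMul (select (NDiv vc n2))
     (RMul (RGet 23 (cell (NMod vc n2) vy)) (RGet 27 vy)))
  (pfill 27 nn (NCst 1) (RMul (RGet 21 vc) (RInv (RGet 20 vc)))
  (pfill 26 nn nn (RMul (RNat (nlt vy vc)) (RGet 25 vy))
  (pfill 25 nn (NCst 1) (nonzero (RGet 21 vc))
  (pfill 24 nn nn (RMul (RGet 20 (cell vy vc)) (RGet 22 (cell vy vc)))
  (pfill 23 n3 nn (mul_entry 13 22)
  (pfill 22 n2 nn (mul_entry 15 20) A))))))).

Lemma runs_le s F t t' : (t <= t')%N -> runs s F t -> runs s F t'.
Proof.
move=> tt' r st /r[z e c]; split=> //.
by rewrite (leq_trans c)// leq_add2l.
Qed.

Definition cost := (400 * (n + m).+1 ^ 9)%N.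

Lemma runs_alg : runs mixture_alg (after_output \o (after_eigen \o after_gram)) cost.
Proof.
have sz2 st : sized n m st -> evalN (R := R) st n2 = (n * n)%N by move=> [/= -> _].
have sz4 st : sized n m st -> evalN (R := R) st n4 = (n * n * (n * n))%N by move=> [/= -> _].
have szn st : sized n m st -> evalN (R := R) st nn = n by move=> [/= -> _].
have g := runs_seq (@runs_fill 9 n8 (NCst 1) sdp_entry isT isT isT)
  (runs_seq (@runs_fill 10 n4 (NCst 1) sdp_rhs isT isT isT)
  (runs_seq (@runs_sdp n4 n2 9 10 11 12 _ _ (fun st h => conj (sz4 st h) (sz2 st h)))
  (@runs_fill 13 n3 (NCst 1) second_entry isT isT isT))).
have e := runs_seq (@runs_fill 14 n4 (NCst 1) kron_entry isT isT isT)
  (runs_seq (@runs_lin n2 n2 14 13 15 _ _ (fun st h => conj (sz2 st h) (sz2 st h)))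
  (runs_seq (@runs_fill 16 nn nn (RMul (RGet 15 (cell vc vy))
     (RMul (moment6 vy (NCst 0)) (RInv (RNat (NCst 15))))) isT isT isT)
  (runs_seq (@runs_fill 17 n2 nn (RMul (RGet 13 (cell vc vy)) (RGet 16 vy)) isT isT isT)
  (runs_seq (@runs_fill 18 n2 (NCst 1) third_entry isT isT isT)
  (runs_seq (@runs_fill 19 n2 nn (mul_entry 18 15) isT isT isT)
  (@runs_eig nn 19 20 21 n szn)))))).
have u := runs_seq (@runs_fill 22 n2 nn (mul_entry 15 20) isT isT isT)
  (runs_seq (@runs_fill 23 n3 nn (mul_entry 13 22) isT isT isT)
  (runs_seq (@runs_fill 24 nn nn (RMul (RGet 20 (cell vy vc)) (RGet 22 (cell vy vc))) isT isT isT)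
  (runs_seq (@runs_fill 25 nn (NCst 1) (nonzero (RGet 21 vc)) isT isT isT)
  (runs_seq (@runs_fill 26 nn nn (RMul (RNat (nlt vy vc)) (RGet 25 vy)) isT isT isT)
  (runs_seq (@runs_fill 27 nn (NCst 1) (RMul (RGet 21 vc) (RInv (RGet 20 vc))) isT isT isT)
  (runs_seq (@runs_fill 7 (NMul mm n2) nn (RMul (select (NDiv vc n2))
     (RMul (RGet 23 (cell (NMod vc n2) vy)) (RGet 27 vy))) isT isT isT)
  (@runs_fill 8 mm nn (RMul (select vc)
     (RInv (RMul (RGet 24 vy) (RMul (RGet 27 vy) (RGet 27 vy))))) isT isT isT))))))).
apply: runs_le (runs_seq g (runs_seq e u)).
rewrite /fill_cost /cost /=.
set N := (n + m).+1.
have N1 : (0 < N)%N by [].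
have nN : (n <= N)%N by rewrite /N; lia.
have mN : (m <= N)%N by rewrite /N; lia.
(* Bounding every monomial in n and m by the same number makes the final estimate linear. *)
have B k l : (k + l <= 9)%N -> (n ^ k * m ^ l <= N ^ 9)%N.
  move=> kl; apply: (@leq_trans (N ^ (k + l))); last exact: leq_pexp2l.
  have pw x k0 : (x <= N)%N -> (x ^ k0 <= N ^ k0)%N.
    by case: k0 => // k0 xN; rewrite leq_exp2r.
  by rewrite expnD leq_mul// pw.
have b00 := B 0 0 isT; have b10 := B 1 0 isT; have b20 := B 2 0 isT.
have b30 := B 3 0 isT; have b40 := B 4 0 isT; have b80 := B 8 0 isT.
have b01 := B 0 1 isT; have b11 := B 1 1 isT; have b21 := B 2 1 isT.
have b31 := B 3 1 isT.
move: (N ^ 9)%N b00 b10 b20 b30 b40 b80 b01 b11 b21 b31 => P.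
rewrite !expnS !expn0 !muln1 !mul1n !mulnA => *.
have fc x y : (x <= P)%N -> (x * y <= P)%N -> (1 + x * (3 + 2 * y) <= 6 * P)%N.
  by rewrite mulnDr mulnCA; lia.
lia.
Qed.

End Exec.

Lemma mixture_alg_polynomial_time (R : realType) : polynomial_time R mixture_alg.
Proof.
exists 400%N, 9%N => o _ n m M.
have sz : sized n m (input_state m M) by [].
by have [_ _] := @runs_alg R n m o _ sz; rewrite add0n /cost.
Qed.

(** * Correctness of the algorithm *)

Arguments neq : simpl never.
Arguments nlt : simpl never.

Section PairIndex.
Variables (p q : nat).

Lemma pair_index_subproof (i : 'I_p) (j : 'I_q) : (i * q + j < p * q)%N.
Proof.
apply: (@leq_trans (i * q + q)); first by rewrite ltn_add2l.
by rewrite addnC -mulSn leq_mul2r ltn_ord orbT.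
Qed.

Definition pair_index i j : 'I_(p * q) := Ordinal (pair_index_subproof i j).

Lemma pair_index_div (i : nat) (j : 'I_q) : ((i * q + j) %/ q = i)%N.
Proof.
have q0 : (0 < q)%N by exact: leq_ltn_trans (ltn_ord j).
by rewrite divnMDl// divn_small// addn0.
Qed.

Lemma pair_index_mod (i : nat) (j : 'I_q) : ((i * q + j) %% q = j)%N.
Proof. by rewrite modnMDl modn_small. Qed.

Lemma pair_index_inj i j i' j' :
  (pair_index i j == pair_index i' j') = (i == i') && (j == j').
Proof.
apply/eqP/andP => [/(congr1 val)/= h|[/eqP -> /eqP ->]//].
split; apply/eqP/val_inj; first by rewrite /= -(pair_index_div i j) h pair_index_div.
by rewrite /= -(pair_index_mod i j) h pair_index_mod.
Qed.

Lemma pair_indexP (l : 'I_(p * q)) : exists i j, l = pair_index i j.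
Proof.
have q0 : (0 < q)%N by case: q l => // -[x]; rewrite muln0.
have h1 : (l %/ q < p)%N by rewrite ltn_divLR.
have h2 : (l %% q < q)%N by rewrite ltn_mod.
exists (Ordinal h1), (Ordinal h2); apply: val_inj => /=; exact: divn_eq.
Qed.

Lemma sum_pair_index (V : nmodType) (F : 'I_(p * q) -> V) :
  \sum_l F l = \sum_i \sum_j F (pair_index i j).
Proof.
rewrite pair_bigA/=; apply: reindex; apply: onW_bij.
apply: inj_card_bij; last by rewrite card_prod !card_ord.
by move=> [i j] [i' j'] /eqP; rewrite pair_index_inj/= => /andP[/eqP -> /eqP ->].
Qed.

End PairIndex.

Lemma mx_arrE (R : realType) p k (M : 'M[R]_(p, k)) (i : 'I_p) (j : 'I_k) :
  mx_arr M (i * k + j) = M i j.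
Proof. by rewrite /mx_arr pair_index_div pair_index_mod !valK. Qed.

Section CellValues.
Variables (R : realType) (n m : nat).
Implicit Types (A : nat -> nat -> R) (st : state R).

Lemma pfillE a e1 e2 ex A c : (c < evalN (cell_state n m A 0 0) e1)%N ->
  pfill n m a e1 e2 ex A a c =
  \sum_(y < evalN (cell_state n m A 0 0) e2) evalR (cell_state n m A c y) ex.
Proof.
by move=> h; rewrite /pfill /upd eqxx /fill_arr h /fill_value big_mkord.
Qed.

Lemma pfill1E a e1 ex A c : (c < evalN (cell_state n m A 0 0) e1)%N ->
  pfill n m a e1 (NCst 1) ex A a c = evalR (cell_state n m A c 0) ex.
Proof. by move=> h; rewrite pfillE//= big_ord1. Qed.

Lemma evalR_moment2 st p q : evalR st (moment2 p q) =
  arrs st 2 (evalN st p + ints st 0 * evalN st q) *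
  (1 + (evalN st q == evalN st p))%:R.
Proof. by rewrite -evalN_neq. Qed.

Lemma evalR_moment4 st a b c d (e := evalN st) : evalR st (moment4 a b c d) =
  arrs st 4 (e a + ints st 0 * (e b + ints st 0 * (e c + ints st 0 * e d))) *
  ((1 + (e b == e a)) * (1 + (e c == e a) + (e c == e b)) *
   (1 + (e d == e a) + (e d == e b) + (e d == e c)))%:R.
Proof. by rewrite /e -!evalN_neq. Qed.

Lemma evalR_moment6 st p q (e := evalN st) : evalR st (moment6 p q) =
  arrs st 6 (e p + ints st 0 * e q) *
  (24 * ((1 + 4 * (e p == 0)) * (1 + (e q == e p) + 4 * (e q == 0))))%:R.
Proof.
by rewrite /e -(evalN_neq st p (NCst 0)) -(evalN_neq st q (NCst 0)) -evalN_neq.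
Qed.

End CellValues.

Section WordDigits.
Variables (R : realType) (n : nat) (st : state R).
Hypothesis stn : ints st 0 = n.
Variables (a b c d : 'I_n) (e : nexp).
Hypothesis eE : evalN st e = pair_index (pair_index a b) (pair_index c d).

Let n0 : (0 < n)%N. Proof. exact: leq_ltn_trans (ltn_ord a). Qed.

Let d1 : (evalN st e %/ n = (a * n + b) * n + c)%N.
Proof.
rewrite eE/= addnA mulnA -mulnDl divnMDl// divn_small//; lia.
Qed.

Lemma eval_let1 : evalN st (let1 e) = a.
Proof. by rewrite /= stn d1 !pair_index_div. Qed.

Lemma eval_let2 : evalN st (let2 e) = b.
Proof. by rewrite /= stn d1 pair_index_div pair_index_mod. Qed.

Lemma eval_let3 : evalN st (let3 e) = c.
Proof. by rewrite /= stn d1 pair_index_mod. Qed.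

Lemma eval_let4 : evalN st (let4 e) = d.
Proof. by rewrite /= stn eE/= addnA mulnA -mulnDl pair_index_mod. Qed.

End WordDigits.

(** * Reading the parameters off the eigenvectors *)

Section Output.
Variables (R : realType) (n0 m0 : nat).
Local Notation n := n0.+1.
Local Notation m := m0.+1.
Variables (S : 'I_m -> 'M[R]_n) (lam : 'I_m -> R) (A : nat -> nat -> R).
Hypothesis lam_neq0 : forall i, lam i != 0.
Hypothesis corner_neq0 : forall i, S i ord0 ord0 != 0.
Variables (Q V : 'M[R]_n) (d : 'rV[R]_n).
Hypothesis A13E : forall j k l : 'I_n, A 13 (pair_index (pair_index j k) l) =
  \sum_i lam i * (S i j k * S i ord0 l).
Hypothesis A15E : forall j k : 'I_n, A 15 (j * n + k)%N = Q j k.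
Hypothesis A20E : forall j k : 'I_n, A 20 (j * n + k)%N = V j k.
Hypothesis A21E : forall k : 'I_n, A 21 k = d 0 k.
Hypothesis dualE : forall i' i,
  \sum_y S i' ord0 y * (\sum_z Q y z * S i ord0 z) = (i' == i)%:R / lam i.
Variables (f : 'I_m -> 'I_n) (c : 'I_m -> R).
Hypothesis f_inj : injective f.
Hypothesis c_neq0 : forall i, c i != 0.
Hypothesis Vf : forall i j, V j (f i) = c i * S i ord0 j.
Hypothesis df : forall i, d 0 (f i) = S i ord0 ord0.
Hypothesis d_out : forall l, l \notin codom f -> d 0 l = 0.

Let K1 := pfill n m 22 n2 nn (mul_entry 15 20) A.
Let K2 := pfill n m 23 n3 nn
  (mul_entry 13 22) K1.
Let K3 := pfill n m 24 nn nn
  (RMul (RGet 20 (cell vy vc)) (RGet 22 (cell vy vc))) K2.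
Let K4 := pfill n m 25 nn (NCst 1) (nonzero (RGet 21 vc)) K3.
Let K5 := pfill n m 26 nn nn
  (RMul (RNat (nlt vy vc)) (RGet 25 vy)) K4.
Let K6 := pfill n m 27 nn (NCst 1) (RMul (RGet 21 vc) (RInv (RGet 20 vc))) K5.

Let R3Q i j k : \sum_y (\sum_i' lam i' * (S i' j k * S i' ord0 y)) *
  (\sum_z Q y z * S i ord0 z) = S i j k.
Proof.
transitivity (\sum_i' lam i' * S i' j k * ((i' == i)%:R / lam i)).
  under [RHS]eq_bigr do rewrite -dualE big_distrr/=.
  rewrite [RHS]exchange_big/=; apply: eq_bigr => y _; rewrite big_distrl/=.
  by apply: eq_bigr => i' _; ring.
rewrite (bigD1 i)//= eqxx big1 ?addr0; first by rewrite /=; field; rewrite lam_neq0.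
by move=> i' /negPf ->; rewrite mul0r mulr0.
Qed.

Let E22 (j : 'I_n) i : K1 22 (pair_index j (f i)) =
  c i * (\sum_z Q j z * S i ord0 z).
Proof.
rewrite /K1 pfillE; last exact: ltn_ord.
rewrite big_distrr/=; apply: eq_bigr => z _.
rewrite /= pair_index_div pair_index_mod.
by rewrite -[LHS]/(A 15 (j * n + z)%N * A 20 (z * n + f i)%N) A15E A20E Vf; ring.
Qed.

Let E23 (j k : 'I_n) i : K2 23 (pair_index (pair_index j k) (f i)) = c i * S i j k.
Proof.
rewrite /K2 pfillE; last exact: ltn_ord.
rewrite -(R3Q i j k) big_distrr/=; apply: eq_bigr => z _.
rewrite -A13E [RHS]mulrCA -E22.
set u := pair_index j k; rewrite /= pair_index_div pair_index_mod.
by [].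
Qed.

Let E24 i : K3 24 (f i) = c i ^+ 2 / lam i.
Proof.
rewrite /K3 pfillE; last exact: ltn_ord.
transitivity (c i ^+ 2 * \sum_y S i ord0 y * (\sum_z Q y z * S i ord0 z)).
  rewrite big_distrr/=; apply: eq_bigr => y _.
  rewrite -[LHS]/(A 20 (y * n + f i)%N * K1 22 (pair_index y (f i))) A20E E22 Vf.
  by ring.
by rewrite dualE eqxx mul1r.
Qed.

Let E25 (l : 'I_n) : K4 25 l = (l \in codom f)%:R.
Proof.
rewrite /K4 pfill1E; last exact: ltn_ord.
rewrite -[LHS]/(A 21 l * (A 21 l)^-1) A21E.
case: (boolP (l \in codom f)) => [/codomP[i ->]|/d_out ->]; last by rewrite mul0r.
by rewrite df divff.
Qed.

(** The solver may list the eigenvectors in any order; ranks number those with nonzero eigenvalue by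
    0, ..., m - 1. *)
Let rank i := #|[pred y : 'I_n | (y < f i)%N && (y \in codom f)]|.

Let E26 i : K5 26 (f i) = (rank i)%:R.
Proof.
rewrite /K5 pfillE; last exact: ltn_ord.
rewrite /rank -sum1_card natr_sum [RHS]big_mkcond/=; apply: eq_bigr => y _.
rewrite -[LHS]/((evalN (cell_state n m K4 (f i) y) (nlt vy vc))%:R * K4 25 y).
rewrite evalN_nlt/= E25 [in RHS]inE.
by case: (y < f i)%N; case: (y \in codom f); rewrite /= ?mul1r ?mul0r.
Qed.

Let E27 i : K6 27 (f i) = (c i)^-1.
Proof.
rewrite /K6 pfill1E; last exact: ltn_ord.
rewrite -[LHS]/(A 21 (f i) * (A 20 ((ord0 : 'I_n) * n + f i)%N)^-1) A21E A20E df Vf.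
have := corner_neq0 i; have := c_neq0 i; move=> h1 h2; field; by rewrite h1 h2.
Qed.

Let rank_lt i : (rank i < m)%N.
Proof.
rewrite -[X in (_ < X)%N](card_ord m) -(card_codom f_inj).
apply: proper_card; apply/properP; split.
  by apply/fintype.subsetP => y; rewrite !inE => /andP[].
by exists (f i); rewrite ?inE ?codom_f// ltnn.
Qed.

Let rank_inj : injective (fun i => Ordinal (rank_lt i)).
Proof.
have mono i j : (f i < f j)%N -> (rank i < rank j)%N.
  move=> fij; apply: proper_card; apply/properP; split.
    apply/fintype.subsetP => y; rewrite !inE => /andP[yi ->]; rewrite andbT.
    exact: ltn_trans fij.
  by exists (f i); rewrite !inE ?codom_f ?fij// ltnn.
move=> i j /(congr1 val)/= rij; apply: f_inj; apply: val_inj.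
by case: (ltngtP (f i) (f j)) => [/mono|/mono|//]; rewrite rij ltnn.
Qed.

Let selectE A' s e c' i (st := cell_state n m A' c' (f i)) :
  A' 25 = K4 25 -> A' 26 = K5 26 -> evalN st e = s ->
  evalR st (select e) = (rank i == s)%:R.
Proof.
move=> A'25 A'26 es.
rewrite -[LHS]/(A' 25 (f i) * (1%:R - (A' 26 (f i) - (evalN st e)%:R) *
  (A' 26 (f i) - (evalN st e)%:R)^-1)).
rewrite A'25 A'26 E25 codom_f E26 mul1r es; case: eqVneq => [->|rs].
  by rewrite subrr mul0r subr0.
by rewrite divff ?subrr// subr_eq0 eqr_nat.
Qed.

Let select_out A' e c' (y : 'I_n) (st := cell_state n m A' c' y) :
  A' 25 = K4 25 -> y \notin codom f -> evalR st (select e) = 0.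
Proof.
move=> A'25 yf; rewrite -[LHS]/(A' 25 y * evalR st (iszero (rsub (RGet 26 vy) (RNat e)))).
by rewrite A'25 E25 (negPf yf) mul0r.
Qed.

Let sum_codom (F : 'I_n -> R) : (forall y, y \notin codom f -> F y = 0) ->
  \sum_y F y = \sum_i F (f i).
Proof.
move=> F0; rewrite (bigID (mem (codom f)))/= [X in _ + X]big1 ?addr0//.
rewrite -big_uniq; first exact: big_image.
by rewrite map_inj_uniq ?enum_uniq.
Qed.

(** For eigenvalue zero nothing is known about the entries w; the selector discards them. *)
Let pick_rank i (sel w : 'I_n -> R) :
  (forall y, y \notin codom f -> sel y = 0) ->
  (forall i', sel (f i') = (rank i' == rank i)%:R) ->
  \sum_y sel y * w y = w (f i).
Proof.
move=> sel0 selE; rewrite sum_codom => [|y /sel0 ->]; last by rewrite mul0r.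
rewrite (bigD1 i)//= selE eqxx mul1r big1 ?addr0// => i' i'i.
rewrite selE; case: eqP => [r|_]; last by rewrite mul0r.
by case/eqP: i'i; apply: rank_inj; apply: val_inj.
Qed.

Let sel7 := select (NDiv vc n2).
Let val7 := RMul (RGet 23 (cell (NMod vc n2) vy))
  (RGet 27 vy).
Let val8 := RInv (RMul (RGet 24 vy) (RMul (RGet 27 vy) (RGet 27 vy))).
Let K7 := pfill n m 7 (NMul mm n2) nn
  (RMul sel7 val7) K6.
Let K8 := pfill n m 8 mm nn (RMul (select vc) val8) K7.

Lemma output_arrays (B := after_output n m A) : exists r : 'I_m -> 'I_m,
  injective r /\ forall i,
    (forall j k : 'I_n, B 7 ((r i * n + j) * n + k)%N = S i j k) /\
    B 8 (r i) = lam i.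
Proof.
exists (fun i => Ordinal (rank_lt i)); split; first exact: rank_inj.
move=> i; set s : 'I_m := Ordinal _; split=> [j k|].
  pose u : 'I_(n * n) := pair_index j k.
  pose w := pair_index s u.
  have -> : ((s * n + j) * n + k = w)%N by rewrite /w /= mulnDl -mulnA addnA.
  rewrite -[B 7]/(K7 7) /K7 pfillE; last exact: ltn_ord.
  transitivity (\sum_(y < n) evalR (cell_state n m K6 w y) sel7 *
    evalR (cell_state n m K6 w y) val7); first by [].
  have es y : evalN (cell_state n m K6 w y) (NDiv vc n2) = s.
    exact: pair_index_div.
  rewrite (@pick_rank i); first last.
  - by move=> i'; exact: selectE.
  - by move=> y; exact: select_out.
  have eu y : evalN (cell_state n m K6 w y) (NMod vc n2) = u.
    exact: pair_index_mod.
  rewrite -[LHS]/(K2 23 (evalN (cell_state n m K6 w (f i)) (NMod vc n2) * n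
    + f i)%N * K6 27 (f i)) eu.
  by rewrite -[(u * n + f i)%N]/(pair_index u (f i) : nat) E23 E27 mulrC mulKf.
rewrite -[B 8]/(K8 8) /K8 pfillE; last exact: ltn_ord.
transitivity (\sum_(y < n) evalR (cell_state n m K7 s y) (select vc) *
  evalR (cell_state n m K7 s y) val8); first by [].
rewrite (@pick_rank i); first last.
- by move=> i'; exact: selectE.
- by move=> y; exact: select_out.
rewrite -[LHS]/((K3 24 (f i) * (K6 27 (f i) * K6 27 (f i)))^-1) E24 E27.
by field; rewrite lam_neq0 c_neq0.
Qed.

End Output.

(** * From the moments to the eigenvalue problem *)

Section GramStep.
Variables (R : realType) (n0 m0 : nat).
Local Notation n := n0.+1.
Local Notation m := m0.+1.
Variables (S : 'I_m -> 'M[R]_n) (lam : 'I_m -> R).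
Hypothesis S_sym : forall i, (S i)^T = S i.
Hypothesis lam_gt0 : forall i, 0 < lam i.
Hypothesis lam1 : \sum_i lam i = 1.
Hypothesis rigid : gram_rigid S.
Variables (o : solvers R) (A0 : nat -> nat -> R).
Hypothesis o_ok : correct_solvers o.

Definition second_moment (p q : 'I_n) : R := \sum_i lam i * S i p q.

Hypothesis A2E : forall p q : 'I_n,
  A0 2 (p + n * q)%N * (1 + (q == p :> nat))%:R = second_moment p q.
Hypothesis A4E : forall a b c d : 'I_n,
  A0 4 (a + n * (b + n * (c + n * d)))%N *
  ((1 + (b == a :> nat)) * (1 + (c == a :> nat) + (c == b :> nat)) *
   (1 + (d == a :> nat) + (d == b :> nat) + (d == c :> nat)))%:R =
  \sum_i lam i * (S i a b * S i c d + S i a c * S i b d + S i a d * S i b c).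
Hypothesis A11E : forall c, A0 11 c = 0.

Let Sb : 'M[R]_n := \sum_j lam j *: S j.
Let H i := S i - Sb.

Let SbE p q : Sb p q = second_moment p q.
Proof. by rewrite /Sb summxE; apply: eq_bigr => i _; rewrite mxE. Qed.

Let H_sym i p q : H i p q = H i q p.
Proof.
have Ss j : S j p q = S j q p by rewrite -[in LHS]S_sym mxE.
by rewrite /H !mxE Ss !SbE /second_moment; congr (_ - _); apply: eq_bigr => j _;
  rewrite -[in LHS](S_sym j) mxE.
Qed.

Let cov a b c d : \sum_i lam i * (H i a b * H i c d) =
  \sum_i lam i * (S i a b * S i c d) - Sb a b * Sb c d.
Proof.
have -> : Sb a b * Sb c d = Sb a b * Sb c d + Sb a b * Sb c d - (\sum_i lam i) * (Sb a b * Sb c d).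
  by rewrite lam1; ring.
rewrite {1}(SbE c d) {2}(SbE a b) /second_moment big_distrr/= big_distrl/=.
rewrite [(\sum_i lam i) * _]big_distrl/=.
rewrite -big_split -!sumrB/=; apply: eq_bigr => i _; rewrite /H !mxE.
by ring.
Qed.

Let G1 := pfill n m 9 n8 (NCst 1) sdp_entry A0.
Let G2 := pfill n m 10 n4 (NCst 1) sdp_rhs G1.

Local Notation word a b c d := (pair_index (pair_index a b) (pair_index c d)).

Let Al := @arr_sdp R G2 9 (n * n * (n * n)) (n * n).
Let bv := arr_mx G2 10 (n * n * (n * n)) 1.
Let Cm := arr_mx G2 11 (n * n) (n * n).

Let C0 : Cm = 0.
Proof. by apply/matrixP => i j; rewrite !mxE -[G2 11 _]/(A0 11 _) A11E. Qed.

Let AlE a b c d i j : Al (word a b c d) i j =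
  (((i == pair_index a b) && (j == pair_index c d)) +
   ((i == pair_index a c) && (j == pair_index b d)) +
   ((i == pair_index a d) && (j == pair_index b c)))%N%:R.
Proof.
rewrite mxE -[G2 9 _]/(G1 9 _).
set w := word a b c d.
have hc : ((w * (n * n) + i) * (n * n) + j < n * n * (n * n) * (n * n * (n * n)))%N.
  have := ltn_ord (pair_index (pair_index w i) j).
  by rewrite /= !mulnA.
rewrite /G1 pfill1E//.
set st := cell_state _ _ _ _ _.
set l := NDiv (NDiv vc n2) n2.
have lE : evalN st l = w.
  by rewrite /= !pair_index_div.
have e1 := @eval_let1 R n st erefl a b c d l lE.
have e2 := @eval_let2 R n st erefl a b c d l lE.
have e3 := @eval_let3 R n st erefl a b c d l lE.
have e4 := @eval_let4 R n st erefl a b c d l lE.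
have ei : evalN st (NMod (NDiv vc n2) n2) = i.
  by rewrite /= pair_index_div pair_index_mod.
have ej : evalN st (NMod vc n2) = j.
  by rewrite /= pair_index_mod.
have neqE p q : evalN st (neq p q) = (evalN st p == evalN st q) by exact: evalN_neq.
have cellE p q : evalN st (cell p q) = (evalN st p * n + evalN st q)%N by [].
rewrite /sdp_entry -/l; congr _%:R.
pose at_i p q := neq (NMod (NDiv vc n2) n2) (cell p q).
pose at_j p q := neq (NMod vc n2) (cell p q).
transitivity (evalN st (NAdd
    (NAdd (NMul (at_i (let1 l) (let2 l)) (at_j (let3 l) (let4 l)))
          (NMul (at_i (let1 l) (let3 l)) (at_j (let2 l) (let4 l))))
    (NMul (at_i (let1 l) (let4 l)) (at_j (let2 l) (let3 l))))).
  by [].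
have AddE p q : evalN st (NAdd p q) = (evalN st p + evalN st q)%N by [].
have MulE p q : evalN st (NMul p q) = (evalN st p * evalN st q)%N by [].
by rewrite !AddE !MulE /at_i /at_j !neqE !cellE ei ej e1 e2 e3 e4 !mulnb -!val_eqE.
Qed.

Let bE a b c d : bv (word a b c d) 0 = \sum_i lam i *
  (H i a b * H i c d + H i a c * H i b d + H i a d * H i b c).
Proof.
rewrite mxE muln1 addn0 /G2 pfill1E; last exact: ltn_ord.
set st := cell_state _ _ _ _ _.
have lE : evalN st vc = word a b c d by [].
have e1 := @eval_let1 R n st erefl a b c d _ lE.
have e2 := @eval_let2 R n st erefl a b c d _ lE.
have e3 := @eval_let3 R n st erefl a b c d _ lE.
have e4 := @eval_let4 R n st erefl a b c d _ lE.
have m2E p q (p' q' : 'I_n) : evalN st p = p' -> evalN st q = q' ->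
  evalR st (moment2 p q) = Sb p' q'.
  move=> pE qE; rewrite evalR_moment2 pE qE SbE -A2E; congr (_ * _).
rewrite -[LHS]/(evalR st (moment4 (let1 vc) (let2 vc) (let3 vc) (let4 vc))
  - (evalR st (moment2 (let1 vc) (let2 vc)) * evalR st (moment2 (let3 vc) (let4 vc))
   + evalR st (moment2 (let1 vc) (let3 vc)) * evalR st (moment2 (let2 vc) (let4 vc))
   + evalR st (moment2 (let1 vc) (let4 vc)) * evalR st (moment2 (let2 vc) (let3 vc)))).
rewrite evalR_moment4 e1 e2 e3 e4.
rewrite (m2E _ _ _ _ e1 e2) (m2E _ _ _ _ e3 e4) (m2E _ _ _ _ e1 e3).
rewrite (m2E _ _ _ _ e2 e4) (m2E _ _ _ _ e1 e4) (m2E _ _ _ _ e2 e3).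
rewrite -[X in X * _]/(A0 4 (a + n * (b + n * (c + n * d)))%N) A4E.
under eq_bigr do rewrite !mulrDr.
under [RHS]eq_bigr do rewrite !mulrDr.
by rewrite !big_split/= !cov; ring.
Qed.

Let traceE a b c d (X : 'M[R]_(n * n)) : \tr (Al (word a b c d) *m X) =
  X (pair_index c d) (pair_index a b) + X (pair_index b d) (pair_index a c) +
  X (pair_index b c) (pair_index a d).
Proof.
have pick (u v : 'I_(n * n)) :
    \sum_i \sum_j ((i == u) && (j == v))%:R * X j i = X v u.
  rewrite (bigD1 u)//= (bigD1 v)//= !eqxx mul1r big1 ?addr0; last first.
    by move=> j /negPf ->; rewrite mul0r.
  by rewrite big1 ?addr0// => i /negPf ->; rewrite big1// => j _; rewrite mul0r.
rewrite /mxtrace -(pick (pair_index a b)) -(pick (pair_index a c)) -(pick (pair_index a d)).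
rewrite -!big_split/=; apply: eq_bigr => i _; rewrite mxE -!big_split/=.
by apply: eq_bigr => j _; rewrite AlE !natrD !mulrDl.
Qed.

Let hv i : 'rV[R]_(n * n) := \row_k H i (inord (k %/ n)) (inord (k %% n)).

Let hvE i a b : hv i 0 (pair_index a b) = H i a b.
Proof. by rewrite mxE/= pair_index_div pair_index_mod !inord_val. Qed.

(** The Gram matrix of the true components, a witness that the program is feasible. *)
Let Xs : 'M[R]_(n * n) := \sum_i lam i *: ((hv i)^T *m hv i).

Let XsE u v : Xs u v = \sum_i lam i * (hv i 0 u * hv i 0 v).
Proof.
rewrite /Xs summxE; apply: eq_bigr => i _.
by rewrite mxE mxE big_ord1 mxE.
Qed.

Let Xs_psd : psd Xs.
Proof.
split=> [|u].
  by apply/matrixP => i j; rewrite mxE !XsE; apply: eq_bigr => k _; congr (_ * _); exact: mulrC.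
rewrite /Xs mulmx_sumr mulmx_suml summxE sumr_ge0// => i _.
rewrite -scalemxAr -scalemxAl mxE mulr_ge0 ?(ltW (lam_gt0 i))//.
rewrite -!mulmxA mulmxA mxE big_ord1 -[hv i *m u^T]trmxK trmx_mul trmxK [_^T 0 0]mxE.
exact: sqr_ge0.
Qed.

Let Xs_feasible : sdp_feasible Al bv Xs.
Proof.
split=> [|l]; first exact: Xs_psd.
have [u [v ->]] := pair_indexP l.
have [a [b ->]] := pair_indexP u; have [c [d ->]] := pair_indexP v.
rewrite traceE bE !XsE -!big_split/=; apply: eq_bigr => i _.
by rewrite !hvE; ring.
Qed.

Definition gram_solution := sdp_solver o Al bv Cm.
Local Notation X := gram_solution.

Let X_feasible : sdp_feasible Al bv X.
Proof.
have [_ _ osdp] := o_ok.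
have [] := osdp _ _ Al bv Cm; last by [].
(* With a zero objective every feasible point is optimal. *)
exists Xs; split; first exact: Xs_feasible.
by move=> X' _; rewrite C0 !mul0mx.
Qed.

Let mv (A : 'M[R]_n) : 'rV[R]_(n * n) :=
  \row_k A (inord (k %/ n)) (inord (k %% n)).

Let mvE A a b : mv A 0 (pair_index a b) = A a b.
Proof. by rewrite mxE/= pair_index_div pair_index_mod !inord_val. Qed.

Let XB (A B : 'M[R]_n) : R := (mv A *m X *m (mv B)^T) 0 0.

Let XB_psd : psd_form XB.
Proof.
have [[Xt Xp] _] := X_feasible.
split => [A B|t A A' B|A]; last exact: Xp.
- by rewrite /XB -[mv A *m X *m _]trmxK [LHS]mxE !trmx_mul trmxK Xt mulmxA.
- rewrite /XB; have -> : mv (t *: A + A') = t *: mv A + mv A'.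
    by apply/rowP => k; rewrite !mxE.
  by rewrite !mulmxDl -!scalemxAl 2!mxE.
Qed.

Let XBE A B : XB A B = \sum_a \sum_b \sum_c \sum_d
  A a b * B c d * X (pair_index a b) (pair_index c d).
Proof.
rewrite /XB mxE; under eq_bigr do rewrite mxE big_distrl/=.
rewrite exchange_big/= sum_pair_index; apply: eq_bigr => a _; apply: eq_bigr => b _.
rewrite sum_pair_index; apply: eq_bigr => c _; apply: eq_bigr => d _.
by rewrite [(mv B)^T _ _]mxE !mvE; ring.
Qed.

Let sqE (x : 'rV[R]_n) a b : (x^T *m x) a b = x 0 a * x 0 b.
Proof. by rewrite mxE big_ord1 mxE. Qed.

(** The constraints of all words (a, b, c, d), weighted by x_a x_b x_c x_d, add up to three times
    this identity, since the three pairings contribute equally. *)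
Let XB_feasible (x : 'rV[R]_n) : XB (x^T *m x) (x^T *m x) =
  \sum_i lam i * (qform (H i) x * qform (H i) x).
Proof.
have [_ Xc] := X_feasible.
pose x4 (a b c d : 'I_n) := x 0 a * x 0 b * x 0 c * x 0 d.
have pairs (F : 'I_n -> 'I_n -> 'I_n -> 'I_n -> R) :
  \sum_a \sum_b \sum_c \sum_d x4 a b c d * (F c d a b + F b d a c + F b c a d) =
  3 * \sum_a \sum_b \sum_c \sum_d x4 a b c d * F a b c d.
  rewrite (_ : 3 = 1 + 1 + 1); last by ring.
  rewrite !mulrDl !mul1r.
  transitivity (\sum_a \sum_b \sum_c \sum_d x4 a b c d * F c d a b +
    \sum_a \sum_b \sum_c \sum_d x4 a b c d * F b d a c +
    \sum_a \sum_b \sum_c \sum_d x4 a b c d * F b c a d).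
    rewrite -!big_split/=; apply: eq_bigr => a _; rewrite -!big_split/=.
    apply: eq_bigr => b _; rewrite -!big_split/=; apply: eq_bigr => c _.
    by rewrite -!big_split/=; apply: eq_bigr => d _; rewrite !mulrDr.
  have s12 (K : 'I_n -> 'I_n -> 'I_n -> 'I_n -> R) :
      \sum_a \sum_b \sum_c \sum_d K b a c d = \sum_a \sum_b \sum_c \sum_d K a b c d.
    exact: exchange_big.
  have s23 (K : 'I_n -> 'I_n -> 'I_n -> 'I_n -> R) :
      \sum_a \sum_b \sum_c \sum_d K a c b d = \sum_a \sum_b \sum_c \sum_d K a b c d.
    by apply: eq_bigr => a _; exact: exchange_big.
  have s34 (K : 'I_n -> 'I_n -> 'I_n -> 'I_n -> R) :
      \sum_a \sum_b \sum_c \sum_d K a b d c = \sum_a \sum_b \sum_c \sum_d K a b c d.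
    by apply: eq_bigr => a _; apply: eq_bigr => b _; exact: exchange_big.
  pose K a b c d := x4 a b c d * F a b c d.
  rewrite -[\sum_a \sum_b \sum_c \sum_d x4 a b c d * F a b c d]/(
    \sum_a \sum_b \sum_c \sum_d K a b c d).
  have t1 : \sum_a \sum_b \sum_c \sum_d K b c a d = \sum_a \sum_b \sum_c \sum_d K a b c d.
    by rewrite (s12 (fun a b c d => K a c b d)) s23.
  have t2 : \sum_a \sum_b \sum_c \sum_d K b d a c = \sum_a \sum_b \sum_c \sum_d K a b c d.
    rewrite (s12 (fun a b c d => K a d b c)) (s34 (fun a b c d => K a c b d)).
    exact: s23.
  have t3 : \sum_a \sum_b \sum_c \sum_d K c d a b = \sum_a \sum_b \sum_c \sum_d K a b c d.
    by rewrite (s23 (fun a b c d => K b d a c)) t2.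
  rewrite -{1}t3 -{1}t2 -t1; congr (_ + _ + _);
    do 4 (apply: eq_bigr => ? _); rewrite /K /x4; ring.
have : 3 * XB (x^T *m x) (x^T *m x) = 3 * \sum_i lam i * (qform (H i) x * qform (H i) x).
  have -> : XB (x^T *m x) (x^T *m x) =
      \sum_a \sum_b \sum_c \sum_d x4 a b c d * X (pair_index a b) (pair_index c d).
    rewrite XBE; do 4 (apply: eq_bigr => ? _).
    by rewrite !sqE /x4 !mulrA.
  have -> : \sum_i lam i * (qform (H i) x * qform (H i) x) =
      \sum_a \sum_b \sum_c \sum_d x4 a b c d * (\sum_i lam i * (H i a b * H i c d)).
    under [RHS]eq_bigr do under eq_bigr do under eq_bigr do
      under eq_bigr do rewrite big_distrr/=.
    under [RHS]eq_bigr do under eq_bigr do under eq_bigr do rewrite exchange_big/=.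
    under [RHS]eq_bigr do under eq_bigr do rewrite exchange_big/=.
    under [RHS]eq_bigr do rewrite exchange_big/=.
    rewrite [RHS]exchange_big/=; apply: eq_bigr => i _.
    rewrite !qformE big_distrl big_distrr/=; apply: eq_bigr => a _.
    rewrite big_distrl big_distrr/=; apply: eq_bigr => b _.
    rewrite !big_distrr/=; apply: eq_bigr => c _.
    rewrite !big_distrr/=; apply: eq_bigr => d _.
    by rewrite /x4; ring.
  rewrite -(pairs (fun a b c d => X (pair_index a b) (pair_index c d))).
  rewrite -(pairs (fun a b c d => \sum_i lam i * (H i a b * H i c d))).
  apply: eq_bigr => a _; apply: eq_bigr => b _; apply: eq_bigr => c _.
  apply: eq_bigr => d _; congr (_ * _).
  rewrite -traceE Xc bE -!big_split/=; apply: eq_bigr => i _; ring.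
by apply: mulfI; rewrite pnatr_eq0.
Qed.

(** The matrix e_p^T e_q + e_q^T e_p is a combination of three rank one matrices, so rigidity gives
    the value of X on pairs of such matrices; these values are four times the averages on the
    left. *)
Lemma gram_solutionE (j k l : 'I_n) :
  4^-1 * ((X (pair_index j k) (pair_index ord0 l) + X (pair_index j k) (pair_index l ord0)) +
   (X (pair_index k j) (pair_index ord0 l) + X (pair_index k j) (pair_index l ord0))) +
  second_moment j k * second_moment ord0 l = \sum_i lam i * (S i j k * S i ord0 l).
Proof.
have XBxy := rigid XB_psd lam1 XB_feasible.
have mxDE (M N : 'M[R]_1) : (M + N) 0 0 = M 0 0 + N 0 0 by rewrite mxE.
pose e j : 'rV[R]_n := delta_mx 0 j.
pose P (j k : 'I_n) : 'M[R]_n := delta_mx j k + delta_mx k j.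
have qe (A : 'M[R]_n) p q : qform A (e p + e q) - qform A (e p) - qform A (e q) = A p q + A q p.
  have D u v : (e u *m A *m (e v)^T) 0 0 = A u v.
    by have := qform_delta A u v 1 1; rewrite !scale1r !mul1r.
  by rewrite /qform linearD/= !(mulmxDl, mulmxDr) !(mxDE, D); ring.
have PE p q : P p q = -1 *: ((e q)^T *m e q) +
    (-1 *: ((e p)^T *m e p) + (e p + e q)^T *m (e p + e q)).
  have D u v : (e u)^T *m e v = delta_mx u v by rewrite /e trmx_delta mul_delta_mx.
  have -> : (e p + e q)^T = (e p)^T + (e q)^T by rewrite linearD.
  rewrite !(mulmxDl, mulmxDr) !D !scaleN1r /P.
  by apply/matrixP => u v; rewrite !mxE; ring.
have XP p q r s : XB (P p q) (P r s) = \sum_i lam i * ((H i p q + H i q p) * (H i r s + H i s r)).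
  have XR t A A' C : XB C (t *: A + A') = t * XB C A + XB C A'.
    by rewrite (psd_formC XB_psd) (psd_formP XB_psd) !(psd_formC XB_psd C).
  rewrite !PE !(psd_formP XB_psd) !XR !XBxy.
  under [RHS]eq_bigr do rewrite -!qe.
  rewrite !(mulrDr, big_distrr)/= -!big_split/=; apply: eq_bigr => i _; ring.
have XP' p q r s : XB (P p q) (P r s) = X (pair_index p q) (pair_index r s)
  + X (pair_index p q) (pair_index s r) + (X (pair_index q p) (pair_index r s)
  + X (pair_index q p) (pair_index s r)).
  have mvP u v : mv (P u v) = delta_mx 0 (pair_index u v) + delta_mx 0 (pair_index v u).
    apply/rowP => w; have [a [b ->]] := pair_indexP w.
    by rewrite mvE !mxE !pair_index_inj.
  have D u v : ((delta_mx 0 u : 'rV_(n * n)) *m X *m (delta_mx 0 v : 'rV_(n * n))^T) 0 0 = X u v.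
    by have := qform_delta X u v 1 1; rewrite !scale1r !mul1r.
  by rewrite /XB !mvP linearD/= !(mulmxDl, mulmxDr) !(mxDE, D); ring.
rewrite -XP' XP -!SbE.
under eq_bigr do rewrite (H_sym _ k j) (H_sym _ l ord0).
transitivity (\sum_i lam i * (H i j k * H i ord0 l) + Sb j k * Sb ord0 l).
  congr (_ + _); rewrite big_distrr/=; apply: eq_bigr => i _; by field.
by rewrite cov subrK.
Qed.

Hypothesis A6E : forall p q : 'I_n,
  A0 6 (p + n * q)%N * (24 * ((1 + 4 * (p == 0 :> nat)) *
    (1 + (q == p :> nat) + 4 * (q == 0 :> nat))))%:R =
  \sum_i lam i * (3 * S i ord0 ord0 ^+ 2 * S i p q
    + 12 * S i ord0 ord0 * S i ord0 p * S i ord0 q).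
Variable L : 'M[R]_(m, n).
Let B : 'M[R]_(n, m) := \matrix_(j, i) S i j ord0.
Hypothesis LB : L *m B = 1%:M.
Hypothesis corner_neq0 : forall i, S i ord0 ord0 != 0.
Hypothesis corner_inj : injective (fun i => S i ord0 ord0).

Let lamv : 'rV[R]_m := \row_i lam i.
Let av : 'rV[R]_m := \row_i S i ord0 ord0.
Let D := diag_mx lamv.
Let M2 : 'M[R]_n := B *m D *m B^T.

Let S_symE i p q : S i p q = S i q p.
Proof. by rewrite -[in LHS]S_sym mxE. Qed.

Let G4 := after_gram n m o A0.

Let G4_keep b c : (b \notin [:: 9; 10; 12; 13])%N -> G4 b c = A0 b c.
Proof.
rewrite !inE !negb_or => /and4P[/negPf h1 /negPf h2 /negPf h3 /negPf h4].
by rewrite /G4 /after_gram /pfill /psdp /upd h1 h2 h3 h4.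
Qed.

Let RE (j k l : 'I_n) : G4 13 (pair_index (pair_index j k) l) =
  \sum_i lam i * (S i j k * S i ord0 l).
Proof.
rewrite /G4 /after_gram pfill1E; last exact: ltn_ord.
set st := cell_state _ _ _ _ _.
pose vl := NMod vc nn.
pose vk := NMod (NDiv vc nn) nn.
pose vj := NDiv (NDiv vc nn) nn.
have el : evalN st vl = l by rewrite /= pair_index_mod.
have ek : evalN st vk = k by rewrite /= pair_index_div pair_index_mod.
have ej : evalN st vj = j by rewrite /= !pair_index_div.
have XE p q (u v : 'I_(n * n)) : evalN st p = u -> evalN st q = v ->
    evalR st (RGet 12 (NAdd (NMul p n2) q)) = gram_solution u v.
  move=> pu qv; rewrite -[LHS]/(arrs st 12 (evalN st p * (n * n) + evalN st q)%N) pu qv.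
  exact: mx_arrE.
have m2E p q (p' q' : 'I_n) : evalN st p = p' -> evalN st q = q' ->
    evalR st (moment2 p q) = second_moment p' q'.
  move=> pE qE; rewrite evalR_moment2 pE qE -A2E; congr (_ * _).
have cE p q (p' q' : 'I_n) : evalN st p = p' -> evalN st q = q' ->
    evalN st (cell p q) = pair_index p' q'.
  by move=> pE qE; rewrite /= pE qE.
have e0l : evalN st vl = pair_index (ord0 : 'I_n) l by rewrite el.
have el0 : evalN st (NMul vl nn) = pair_index l (ord0 : 'I_n).
  by rewrite -[evalN _ _]/(evalN st vl * n)%N el /= addn0.
rewrite -gram_solutionE -[LHS]/((4%:R)^-1 * ((evalR st (RGet 12 (NAdd (NMul (cell vj vk) n2) vl))
   + evalR st (RGet 12 (NAdd (NMul (cell vj vk) n2) (NMul vl nn))))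
   + (evalR st (RGet 12 (NAdd (NMul (cell vk vj) n2) vl))
   + evalR st (RGet 12 (NAdd (NMul (cell vk vj) n2) (NMul vl nn)))))
   + evalR st (moment2 vj vk) * evalR st (moment2 (NCst 0) vl)).
rewrite (XE _ _ _ _ (cE _ _ _ _ ej ek) e0l) (XE _ _ _ _ (cE _ _ _ _ ej ek) el0).
rewrite (XE _ _ _ _ (cE _ _ _ _ ek ej) e0l) (XE _ _ _ _ (cE _ _ _ _ ek ej) el0).
by rewrite (m2E _ _ _ _ ej ek) (m2E (NCst 0) _ ord0 l erefl el).
Qed.

Let M2E j k : M2 j k = \sum_i lam i * (S i ord0 j * S i ord0 k).
Proof.
rewrite /M2 mxE; apply: eq_bigr => i _.
by rewrite mul_mx_diag !mxE (S_symE i j) (S_symE i k); ring.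
Qed.

Let M2_arr (j k : 'I_n) : G4 13 (j * n + k)%N = M2 j k.
Proof. by rewrite M2E -(RE ord0 j k). Qed.

Let H1 := pfill n m 14 n4 (NCst 1) kron_entry G4.

Let KE (i j k l : 'I_n) :
  arr_mx H1 14 (n * n) (n * n) (pair_index i j) (pair_index k l) = M2 i k * M2 l j.
Proof.
have E (u v : 'I_(n * n)) : arr_mx H1 14 (n * n) (n * n) u v =
    G4 13 (u %/ n * n + v %/ n)%N * G4 13 (v %% n * n + u %% n)%N.
  rewrite mxE /H1 pfill1E; last exact: (ltn_ord (pair_index u v)).
  by rewrite /= pair_index_div pair_index_mod.
by rewrite E /= !pair_index_div !pair_index_mod !M2_arr.
Qed.

Let bE2 (i j : 'I_n) : arr_mx H1 13 (n * n) 1 (pair_index i j) 0 = M2 i j.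
Proof. by rewrite mxE muln1 addn0 -M2_arr. Qed.

Let H2 := plin o (n * n) (n * n) 14 13 15 H1.
Let Q : 'M[R]_n := \matrix_(k, l) H2 15 (k * n + l)%N.

Let QM : M2 *m Q *m M2 = M2.
Proof.
have [olin _ _] := o_ok.
set K := arr_mx H1 14 (n * n) (n * n); set b := arr_mx H1 13 (n * n) 1.
have KP (x : 'cV[R]_(n * n)) i j : (K *m x) (pair_index i j) 0 =
    (M2 *m (\matrix_(k, l) x (pair_index k l) 0) *m M2) i j.
  rewrite mxE sum_pair_index; under eq_bigr do under eq_bigr do rewrite KE.
  rewrite [RHS]mxE exchange_big/=; apply: eq_bigr => l _.
  rewrite [X in _ = X * _]mxE big_distrl/=.
  by apply: eq_bigr => k _; rewrite [X in _ = _ * X * _]mxE; ring.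
(* The pseudoinverse shows that the system is solvable; the solver may return another solution. *)
have hx : exists x, K *m x = b.
  exists (\col_u pinvmx M2 (inord (u %/ n)) (inord (u %% n))).
  apply/colP => u; have [i [j ->]] := pair_indexP u; rewrite KP bE2.
  rewrite (_ : \matrix_(k, l) _ = pinvmx M2) ?mulmxKpV//; last first.
    by apply/matrixP => k l; rewrite !mxE/= pair_index_div pair_index_mod !inord_val.
have := olin _ _ K b hx => Kx; apply/matrixP => i j.
have := KP (lin_solver o K b) i j; rewrite Kx bE2 => ->.
congr ((_ *m _ *m _) i j); apply/matrixP => k l; rewrite !mxE.
rewrite -[H2 15]/(mx_arr (lin_solver o K b)).
by have := mx_arrE (lin_solver o K b) (pair_index k l) 0; rewrite muln1 addn0.
Qed.

Let dualE i' i : \sum_y S i' ord0 y * (\sum_z Q y z * S i ord0 z) = (i' == i)%:R / lam i.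
Proof.
have lv j : lamv 0 j != 0 by rewrite mxE gt_eqF.
have := ginv_dualE LB lv QM i' i; rewrite [lamv _ _]mxE => <-.
rewrite -mulmxA [RHS]mxE; apply: eq_bigr => y _; rewrite 2!mxE S_symE.
by congr (_ * _); rewrite [RHS]mxE; apply: eq_bigr => z _; rewrite [B _ _]mxE S_symE.
Qed.

Let R3 (j k l : 'I_n) := \sum_i lam i * (S i j k * S i ord0 l).

Let R3Q i j k : \sum_y R3 j k y * (\sum_z Q y z * S i ord0 z) = S i j k.
Proof.
transitivity (\sum_i' lam i' * S i' j k * ((i' == i)%:R / lam i)).
  under [RHS]eq_bigr do rewrite -dualE big_distrr/=.
  rewrite [RHS]exchange_big/=; apply: eq_bigr => y _; rewrite /R3 big_distrl/=.
  by apply: eq_bigr => i' _; ring.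
rewrite (bigD1 i)//= eqxx big1 ?addr0.
  by rewrite /=; field; rewrite gt_eqF.
by move=> i' /negPf ->; rewrite mul0r mulr0.
Qed.

Let H3 := pfill n m 16 nn nn (RMul (RGet 15 (cell vc vy))
  (RMul (moment6 vy (NCst 0)) (RInv (RNat (NCst 15))))) H2.
Let H4 := pfill n m 17 n2 nn
  (RMul (RGet 13 (cell vc vy)) (RGet 16 vy)) H3.
Let H5 := pfill n m 18 n2 (NCst 1) third_entry H4.
Let H6 := pfill n m 19 n2 nn (mul_entry 18 15) H5.

Let QE (j k : 'I_n) : H2 15 (j * n + k)%N = Q j k.
Proof. by rewrite mxE. Qed.

Let moment6E A c y p q (p' q' : 'I_n) (st := cell_state n m A c y) :
  (forall x, A 6 x = A0 6 x) -> evalN st p = p' -> evalN st q = q' ->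
  evalR st (moment6 p q) = \sum_i lam i * (3 * S i ord0 ord0 ^+ 2 * S i p' q'
    + 12 * S i ord0 ord0 * S i ord0 p' * S i ord0 q').
Proof. by move=> A6 pE qE; rewrite evalR_moment6 pE qE -[arrs st 6 _]/(A 6 _) A6 A6E. Qed.

Let E16 (j : 'I_n) : H3 16 j = \sum_i lam i * S i ord0 ord0 ^+ 2 *
  (\sum_z Q j z * S i ord0 z).
Proof.
rewrite /H3 pfillE; last exact: ltn_ord.
under [RHS]eq_bigr do rewrite big_distrr/=.
rewrite [RHS]exchange_big; apply: eq_bigr => z _.
set st := cell_state _ _ _ _ _.
rewrite -[LHS]/(H2 15 (j * n + z)%N * (evalR st (moment6 vy (NCst 0)) / 15%:R)) QE.
have A6 x : H2 6 x = A0 6 x by rewrite -[H2 6 x]/(G4 6 x) G4_keep.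
rewrite (@moment6E H2 j z vy (NCst 0) z ord0 A6 erefl erefl).
rewrite big_distrl big_distrr/=; apply: eq_bigr => i _.
by rewrite (S_symE i z); field.
Qed.

Let E17 (j k : 'I_n) : H4 17 (pair_index j k) =
  \sum_i lam i * S i ord0 ord0 ^+ 2 * S i j k.
Proof.
rewrite /H4 pfillE; last exact: ltn_ord.
transitivity (\sum_y R3 j k y * \sum_i lam i * S i ord0 ord0 ^+ 2 *
    (\sum_z Q y z * S i ord0 z)).
  apply: eq_bigr => y _; rewrite -E16 /R3 -RE.
  by [].
under [RHS]eq_bigr => i _ do rewrite -(R3Q i j k) big_distrr/=.
rewrite [RHS]exchange_big/=; apply: eq_bigr => y _; rewrite big_distrr/=.
by apply: eq_bigr => i _; ring.
Qed.

Let M3 : 'M[R]_n := B *m (D *m diag_mx av) *m B^T.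

Let M3E j k : M3 j k = \sum_i lam i * S i ord0 ord0 * S i ord0 j * S i ord0 k.
Proof.
rewrite /M3 mulmxA mxE; apply: eq_bigr => i _.
by rewrite !mul_mx_diag !mxE (S_symE i j) (S_symE i k); ring.
Qed.

Let E18 (j k : 'I_n) : H5 18 (pair_index j k) = M3 j k.
Proof.
rewrite /H5 pfill1E; last exact: ltn_ord.
set st := cell_state _ _ _ _ _.
rewrite -[LHS]/((evalR st (moment6 (NDiv vc nn) (NMod vc nn))
  - 3%:R * H4 17 (pair_index j k)) / 12%:R) E17.
have A6 x : H4 6 x = A0 6 x by rewrite -[H4 6 x]/(G4 6 x) G4_keep.
have ej : evalN st (NDiv vc nn) = j by exact: pair_index_div.
have ek : evalN st (NMod vc nn) = k by exact: pair_index_mod.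
rewrite (moment6E A6 ej ek).
rewrite M3E big_distrr/= -sumrB big_distrl/=; apply: eq_bigr => i _.
by field.
Qed.

Let E19 : arr_mx H6 19 n n = M3 *m Q.
Proof.
apply/matrixP => j k; rewrite mxE /H6 pfillE; last exact: (ltn_ord (pair_index j k)).
rewrite [RHS]mxE; apply: eq_bigr => y _.
rewrite /= pair_index_div pair_index_mod -E18 -QE.
by [].
Qed.

Let H7 := peig o n 19 20 21 H6.
Let V := (eig_solver o (arr_mx H6 19 n n)).1.
Let d := (eig_solver o (arr_mx H6 19 n n)).2.

Let eig_ok : V \in unitmx /\ M3 *m Q *m V = V *m diag_mx d.
Proof.
have [_ oeig _] := o_ok.
have [] := oeig _ (arr_mx H6 19 n n); last first.
  by rewrite -/V -/d E19.
rewrite E19; apply: (recovery_diagonalizable LB _ _ _ QM) => //.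
- by move=> i; rewrite mxE gt_eqF.
- by move=> i; rewrite mxE.
- by move=> i j; rewrite !mxE => /corner_inj.
Qed.

Lemma eigen_match : exists (f : 'I_m -> 'I_n) (c : 'I_m -> R),
  [/\ injective f, forall i, c i != 0, forall i j, V j (f i) = c i * S i ord0 j,
      forall i, d 0 (f i) = S i ord0 ord0 &
      forall l, l \notin codom f -> d 0 l = 0].
Proof.
have [Vu AV] := eig_ok.
have [|||f [c [finj c0 cV df dz]]] := eigenvector_match LB _ _ _ QM Vu AV.
- by move=> i; rewrite mxE gt_eqF.
- by move=> i; rewrite mxE.
- by move=> i j; rewrite !mxE => /corner_inj.
exists f, c; split=> //.
  move=> i j; have /colP/(_ j) := cV i; rewrite !mxE => ->.
  by rewrite S_symE.
by move=> i; rewrite df mxE.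
Qed.

Lemma mixture_arrays (F := after_output n m (after_eigen n m o (after_gram n m o A0))) :
  exists r : 'I_m -> 'I_m, injective r /\ forall i,
    (forall j k : 'I_n, F 7 ((r i * n + j) * n + k)%N = S i j k) /\ F 8 (r i) = lam i.
Proof.
have [f [c [finj c0 Vf df dz]]] := eigen_match.
have lam0 i : lam i != 0 by rewrite gt_eqF.
have A13E (j k l : 'I_n) : H7 13 (pair_index (pair_index j k) l) =
  \sum_i lam i * (S i j k * S i ord0 l) by rewrite -RE.
have A15E (j k : 'I_n) : H7 15 (j * n + k)%N = Q j k by rewrite -QE.
have A20E (j k : 'I_n) : H7 20 (j * n + k)%N = V j k by rewrite -mx_arrE.
have A21E (k : 'I_n) : H7 21 k = d 0 k by exact: (mx_arrE d ord0 k).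
exact: (output_arrays lam0 corner_neq0 A13E A15E A20E A21E dualE finj c0 Vf df dz).
Qed.

End GramStep.

(** * Moments read off from moment forms *)

Section Words.
Variable n : nat.
Implicit Types (s : seq 'I_n).

Definition word_code s := foldr (fun (j : 'I_n) c => j + n * c)%N 0%N s.

Definition word_fact s := (\prod_(i < n) (count_mem i s)`!)%N.

Lemma word_code_lt s : (word_code s < n ^ size s)%N.
Proof.
elim: s => [|j s IH]//=; rewrite expnS.
apply: (@leq_trans (n + n * word_code s)); first by rewrite ltn_add2r.
by rewrite -mulnS leq_mul2l IH orbT.
Qed.

Lemma code_mnmE s i : code_mnm n (size s) (word_code s) i = count_mem i s.
Proof.
rewrite mnmE; elim: s => [|j s IH]; first by rewrite big_ord0.
have n0 : (0 < n)%N by exact: leq_ltn_trans (ltn_ord j).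
rewrite big_ord_recl/= -IH divn1 [(j + _)%N]addnC [(n * _)%N]mulnC.
rewrite modnMDl modn_small//; congr (_ + _)%N.
apply: eq_bigr => l _; rewrite /bump/= add1n expnS divnMA divnMDl//.
by rewrite [(j %/ n)%N]divn_small// addn0.
Qed.

Lemma prod_count (R : comRingType) (y : 'I_n -> R) s :
  \prod_i y i ^+ count_mem i s = \prod_(j <- s) y j.
Proof.
elim: s => [|j s IH]; first by rewrite big_nil big1.
rewrite big_cons -IH/=; under eq_bigr do rewrite exprD.
rewrite big_split/=; congr (_ * _).
by rewrite (bigD1 j)//= eqxx big1 ?mulr1// => i; rewrite eq_sym => /negPf ->.
Qed.

(** The rule by which the program computes a!. *)
Lemma word_fact_cons j s : word_fact (j :: s) = ((1 + count_mem j s) * word_fact s)%N.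
Proof.
rewrite /word_fact (bigD1 j)//= eqxx factS -mulnA; congr (_ * _)%N.
rewrite [RHS](bigD1 j)//=; congr (_ * _)%N; apply: eq_bigr => i.
by rewrite eq_sym => /negPf ->.
Qed.

Lemma word_fact_nil : word_fact [::] = 1%N.
Proof. by rewrite /word_fact big1. Qed.

Lemma word_fact_perm s t : perm_eq s t -> word_fact s = word_fact t.
Proof. by move=> /permP st; rewrite /word_fact; apply: eq_bigr => i _; rewrite st. Qed.

Lemma mdeg_code s : mdeg (code_mnm n (size s) (word_code s)) = size s.
Proof.
rewrite mdegE; under eq_bigr do rewrite code_mnmE.
elim: s => [|j s IH]; first by rewrite big1.
rewrite /= big_split/= IH (bigD1 j)//= eqxx big1 ?addn0// => i.
by rewrite eq_sym => /negPf ->.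
Qed.

End Words.

Section MomentArrays.
Variables (R : realType) (n m : nat) (d : measure_display)
  (T : measurableType d) (P : probability T R) (Y : {RV P >-> n.-tuple R}).

Lemma mcoeff_moment_form (a : multinom n) : mcoeff a (moment_form Y (mdeg a)) =
  fine ('E_P[fun t => (\prod_(i < n) tnth (Y t) i ^+ a i)%R])%E
    / (\prod_(i < n) (a i)`!)%:R.
Proof.
rewrite /moment_form raddf_sum/=.
have ak : (mdeg a < (mdeg a).+1)%N by [].
rewrite (bigD1 (BMultinom ak))//= [X in _ + X]big1 ?addr0; last first.
  move=> b /andP[_ ba]; rewrite mcoeffZ mcoeffX.
  case: eqP => [e|_]; last by rewrite mulr0.
  by case/eqP: ba; apply: val_inj.
by rewrite mcoeffZ mcoeffX eqxx mulr1.
Qed.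

Lemma word_moment s : (size s <= 6)%N ->
  arrs (input_state m (moment_form Y)) (size s) (word_code s) * (word_fact s)%:R =
  fine ('E_P[fun t => (\prod_(j <- s) tnth (Y t) j)%R])%E.
Proof.
move=> s6; rewrite /= s6 word_code_lt/= -[X in moment_form Y X](mdeg_code s).
rewrite mcoeff_moment_form.
have -> : (\prod_(i < n) (code_mnm n (size s) (word_code s) i)`! = word_fact s)%N.
  by rewrite /word_fact; apply: eq_bigr => i _; rewrite code_mnmE.
rewrite divfK; last first.
  rewrite pnatr_eq0 -lt0n prodn_gt0// => i; exact: fact_gt0.
congr (fine _); congr ('E_P[_])%E; apply/funext => t.
transitivity (\prod_i tnth (Y t) i ^+ count_mem i s).
  by apply: eq_bigr => i _; rewrite code_mnmE.
exact: (prod_count (fun i => tnth (Y t) i)).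
Qed.

End MomentArrays.

Section MomentValues.
Variables (R : realType) (n0 m : nat).
Local Notation n := n0.+1.
Variables (d d' : measure_display)
  (T : measurableType d) (P : probability T R) (Y : {RV P >-> n.-tuple R})
  (T' : measurableType d') (P' : probability T' R)
  (G : 'I_m -> {RV P' >-> n.-tuple R}) (lam : 'I_m -> R)
  (S : 'I_m -> 'M[R]_n).
Hypothesis YG : is_mixture Y G lam.
Hypothesis GS : forall i, centered_gaussian (G i) (S i).
Let A0 := arrs (input_state m (moment_form Y)).

Lemma input_moment2 (p q : 'I_n) :
  A0 2 (p + n * q)%N * (1 + (q == p :> nat))%:R = \sum_i lam i * S i p q.
Proof.
have := @word_moment _ _ m _ _ _ Y [:: p; q] isT.
rewrite (@word_fact_perm _ _ [:: q; p]) ?(perm_catC [:: p] [:: q])//.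
rewrite !word_fact_cons word_fact_nil !muln1/= addn0 muln0 addn0 -/A0.
rewrite -val_eqE/= (eq_sym (q : nat)) => ->.
have -> : (fun t => \prod_(j <- [:: p; q]) tnth (Y t) j) =
    (fun t => tnth (Y t) p * tnth (Y t) q).
  by apply/funext => t; rewrite !big_cons big_nil mulr1.
by rewrite (mixture_moment2 YG GS).
Qed.

Lemma input_moment4 (a b c e : 'I_n) :
  A0 4 (a + n * (b + n * (c + n * e)))%N *
  ((1 + (b == a :> nat)) * (1 + (c == a :> nat) + (c == b :> nat)) *
   (1 + (e == a :> nat) + (e == b :> nat) + (e == c :> nat)))%:R =
  \sum_i lam i * (S i a b * S i c e + S i a c * S i b e + S i a e * S i b c).
Proof.
have := @word_moment _ _ m _ _ _ Y [:: a; b; c; e] isT.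
(* Reversing the word compares each letter with the earlier ones, as [moment4] does. *)
rewrite (@word_fact_perm _ _ [:: e; c; b; a]); last first.
  by rewrite -(perm_rev [:: a; b; c; e]).
rewrite !word_fact_cons word_fact_nil !muln1/= !addn0 muln0 addn0 -/A0.
have -> : ((1 + (b == a :> nat)) * (1 + (c == a :> nat) + (c == b :> nat)) *
   (1 + (e == a :> nat) + (e == b :> nat) + (e == c :> nat)) =
  (1 + ((c == e) + ((b == e) + (a == e)))) * ((1 + ((b == c) + (a == c))) * (1 + (a == b))))%N.
  rewrite -!val_eqE/= (eq_sym (c : nat) e) (eq_sym (b : nat) e) (eq_sym (a : nat) e).
  rewrite (eq_sym (b : nat) c) (eq_sym (a : nat) c) (eq_sym (a : nat) b); ring.
move=> ->.
have -> : (fun t => \prod_(j <- [:: a; b; c; e]) tnth (Y t) j) =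
    (fun t => tnth (Y t) a * tnth (Y t) b * tnth (Y t) c * tnth (Y t) e).
  by apply/funext => t; rewrite !big_cons big_nil mulr1 !mulrA.
by rewrite (mixture_moment4 YG GS).
Qed.

Lemma input_moment6 (p q : 'I_n) :
  A0 6 (p + n * q)%N * (24 * ((1 + 4 * (p == 0 :> nat)) *
    (1 + (q == p :> nat) + 4 * (q == 0 :> nat))))%:R =
  \sum_i lam i * (3 * S i ord0 ord0 ^+ 2 * S i p q
    + 12 * S i ord0 ord0 * S i ord0 p * S i ord0 q).
Proof.
pose z : 'I_n := ord0.
have cE : word_code [:: p; q; z; z; z; z] = (p + n * q)%N.
  by rewrite /= !(muln0, addn0).
have fE : word_fact [:: p; q; z; z; z; z] =
    (24 * ((1 + 4 * (p == 0 :> nat)) * (1 + (q == p :> nat) + 4 * (q == 0 :> nat))))%N.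
  rewrite (@word_fact_perm _ _ [:: q; p; z; z; z; z]); last first.
    by rewrite (perm_catCA [:: p] [:: q]).
  rewrite !word_fact_cons word_fact_nil /= -!val_eqE/= (eq_sym (p : nat) q).
  by rewrite (eq_sym 0%N q) (eq_sym 0%N p); ring.
have := @word_moment _ _ m _ _ _ Y [:: p; q; z; z; z; z] isT.
rewrite cE fE => ->.
have -> : (fun t => \prod_(j <- [:: p; q; z; z; z; z]) tnth (Y t) j) =
    (fun t => tnth (Y t) z ^+ 4 * tnth (Y t) p * tnth (Y t) q).
  by apply/funext => t; rewrite !big_cons big_nil; ring.
by rewrite (mixture_moment6 YG GS).
Qed.

End MomentValues.

(** * The open set of tuples *)

Section GramMatrix.
Variables (R : realType) (n : nat).

(** A left inverse of [cov_form] on symmetric matrices: an off-diagonal coefficient collects two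
    equal entries. *)
Definition gram_mx (q : quadform R n) : 'M[R]_n := \matrix_(j, k)
  (mcoeff (mnm_add (mnm1 j) (mnm1 k)) q / (if j == k then 1 else 2)).

Let mnm1_add_eq (a b j k : 'I_n) :
  (mnm_add (mnm1 a) (mnm1 b) == mnm_add (mnm1 j) (mnm1 k)) =
  ((a == j) && (b == k)) || ((a == k) && (b == j)).
Proof.
apply/eqP/orP => [/mnmP h|[] /andP[/eqP -> /eqP ->]//]; last first.
  by apply/mnmP => i; rewrite !mnmDE addnC.
have {}h i : ((a == i) + (b == i) = (j == i) + (k == i))%N.
  by have := h i; rewrite !mnmDE !mnm1E.
have := h a; have := h b; have := h j; rewrite !eqxx.
rewrite (eq_sym j a) (eq_sym k a) (eq_sym j b) (eq_sym k b) (eq_sym b a).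
have [->|aj] := eqVneq a j; have [->|bk] := eqVneq b k;
  have [ak|ak] := eqVneq a k; have [bj|bj] := eqVneq b j; subst => //=; try by [left|right];
  rewrite ?eqxx; by do ?case: eqP.
Qed.

Lemma gram_mx_cov_form (S : 'M[R]_n) : S^T = S -> gram_mx (cov_form S) = S.
Proof.
move=> Ss; apply/matrixP => j k; rewrite mxE.
have Sjk : S k j = S j k by rewrite -[in LHS]Ss mxE.
have -> : mcoeff (mnm_add (mnm1 j) (mnm1 k)) (cov_form S) =
    \sum_a \sum_b S a b * (((a == j) && (b == k)) || ((a == k) && (b == j)))%:R.
  rewrite /= /cov_poly raddf_sum/=; apply: eq_bigr => a _.
  rewrite raddf_sum/=; apply: eq_bigr => b _.
  by rewrite -mpolyXD mcoeffZ mcoeffX mnm1_add_eq.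
have pick (u v : 'I_n) : \sum_a \sum_b S a b * ((a == u) && (b == v))%:R = S u v.
  rewrite (bigD1 u)//= (bigD1 v)//= !eqxx mulr1 big1 ?addr0; last first.
    by move=> b /negPf ->; rewrite andbF mulr0.
  by rewrite big1 ?addr0// => a /negPf ->; rewrite big1// => b _; rewrite mulr0.
have [->|jk] := eqVneq j k.
  by rewrite -[RHS]pick divr1; do 2 (apply: eq_bigr => ? _); rewrite orbb.
transitivity ((S j k + S k j) / 2); last by rewrite Sjk; field.
congr (_ / _); rewrite -(pick j k) -(pick k j) -big_split/=; apply: eq_bigr => a _.
rewrite -big_split/=; apply: eq_bigr => b _; rewrite -mulrDr; congr (_ * _).
case: (eqVneq a j) => [->|]/=; rewrite ?(negPf jk)/= ?orbF ?addr0//.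
by rewrite add0r.
Qed.

Lemma meval_cov_form (S : 'M[R]_n) (v : 'I_n -> R) :
  meval v (cov_form S) = \sum_j \sum_k S j k * v j * v k.
Proof.
rewrite /= /cov_poly raddf_sum/=; apply: eq_bigr => j _.
rewrite raddf_sum/=; apply: eq_bigr => k _.
by rewrite mevalZ mevalM !mevalXU mulrA.
Qed.

End GramMatrix.

Section GoodTuples.
Variables (R : realType) (n0 m0 : nat).
Local Notation n := n0.+1.
Local Notation m := m0.+1.
Implicit Type S : 'I_m -> 'M[R]_n.

Definition recoverable S := [/\ gram_rigid S,
  exists L : 'M[R]_(m, n), L *m (\matrix_(j, i) S i j ord0) = 1%:M,
  forall i, S i ord0 ord0 != 0 & injective (fun i => S i ord0 ord0)].

(** The interior of the recoverable tuples, so that openness is built in and only the base tuple has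
    to be examined. *)
Definition robust : set ('I_m -> quadform R n) := [set q | exists2 e : R, 0 < e &
  forall S, (forall i, (S i)^T = S i) ->
    (forall i j k, `|S i j k - gram_mx (q i) j k| < e) -> recoverable S].

Lemma robust_open : euclidean_open robust.
Proof.
move=> q [e e0 qe]; exists (e / 2); first by rewrite divr_gt0.
move=> q' q'q; exists (e / 2); first by rewrite divr_gt0.
move=> S Ss Sq'; apply: qe => // i j k.
rewrite (le_lt_trans (ler_distD (gram_mx (q' i) j k) _ _))// [ltRHS]splitr.
rewrite ltrD// (le_lt_trans _ (q'q i (mnm_add (mnm1 j) (mnm1 k))))//.
rewrite !mxE -mulrBl normrM ler_piMr//.
by case: ifP => _; rewrite ?invr1 ?normr1// ger0_norm ?invr_ge0// invf_le1// ler1n.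
Qed.

Hypothesis mn : (m0 < n0)%N.
Local Notation base := (base_tuple R mn).

Let base_left_inverse : exists L : 'M[R]_(m, n),
  L *m (\matrix_(j, i) base i j ord0) = 1%:M.
Proof.
set B := \matrix_(j, i) _.
have : row_free B^T.
  rewrite -kermx_eq0; apply/eqP/row_matrixP => r; rewrite row0.
  set u := row r _; have uB : u *m B^T = 0 by apply/sub_kermxP; exact: row_sub.
  apply/rowP => i; rewrite [RHS]mxE.
  apply: (base_columns_free (mn := mn) (c := fun i => u 0 i)) => j.
  have := congr1 (fun M : 'rV_n => M 0 j) uB; rewrite [X in X = _]mxE [X in _ = X]mxE => h.
  by apply: etrans h; apply: eq_bigr => k _; rewrite !mxE.
by move=> /row_freeP[L /(congr1 trmx)]; rewrite trmx_mul trmxK trmx1; exists L^T.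
Qed.

(** A left inverse L of the base columns makes L B close to the identity, and (L B)^-1 L is then a
    left inverse of B. *)
Let left_inverse_near : exists2 e : R, 0 < e & forall S,
  (forall i j k, `|S i j k - base i j k| < e) ->
  exists L : 'M[R]_(m, n), L *m (\matrix_(j, i) S i j ord0) = 1%:M.
Proof.
have [L LB] := base_left_inverse.
pose s := \sum_i \sum_j `|L i j|.
have s0 : 0 <= s by do 2! apply: sumr_ge0 => ? _.
have m2 : 0 < (s + 1) * (2 * m%:R) by rewrite mulr_gt0 ?ltr_wpDl// mulr_gt0// ltr0n.
exists ((s + 1) * (2 * m%:R))^-1; first by rewrite invr_gt0.
move=> S Sb; set B := \matrix_(j, i) _.
pose E : 'M[R]_(n, m) := \matrix_(j, i) (S i j ord0 - base i j ord0).
have BE : B = \matrix_(j, i) base i j ord0 + E by apply/matrixP => j i; rewrite !mxE; ring.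
have LBE : L *m B = 1%:M + L *m E by rewrite BE mulmxDr LB.
suff : L *m B \in unitmx by move=> u; exists (invmx (L *m B) *m L); rewrite -mulmxA mulVmx.
rewrite LBE; apply: (@near1_unit _ _ _ (2 * m%:R)^-1); last first.
  by rewrite invfM mulrAC -mulrA divff ?mulr1// pnatr_eq0.
move=> i j; rewrite mxE (le_trans (ler_norm_sum _ _ _))//.
apply: (@le_trans _ _ (\sum_k `|L i k| * ((s + 1) * (2 * m%:R))^-1)).
  by apply: ler_sum => k _; rewrite normrM mxE ler_wpM2l// ltW.
rewrite -big_distrl/= invfM mulrA ler_piMl ?invr_ge0//; last first.
  rewrite ler_pdivrMr ?ltr_wpDl// mul1r (@le_trans _ _ s)//; last by rewrite lerDl.
  by rewrite /s [leRHS](bigD1 i)//= lerDl; do 2! apply: sumr_ge0 => ? _.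
Qed.

Lemma robust_base : robust (fun i => cov_form (base i)).
Proof.
have [e1 e10 h1] := gram_rigid_base R mn.
have [e2 e20 h2] := left_inverse_near.
(* The top left entries of the base tuple are at least 1 and differ pairwise by at least 3, so a
   radius of 1 keeps them nonzero and distinct. *)
exists (Num.min (Num.min e1 e2) 1); first by rewrite !lt_min e10 e20 ltr01.
move=> S Ss Sb; have h i j k : `|S i j k - base i j k| < Num.min (Num.min e1 e2) 1.
  by have := Sb i j k; rewrite gram_mx_cov_form ?base_tuple_sym.
have b1 i j k : `|S i j k - base i j k| < 1.
  by have := h i j k; rewrite lt_min => /andP[].
split.
- by apply: h1 => // i j k; have := h i j k; rewrite !lt_min => /andP[/andP[/ltW]].
- by apply: h2 => i j k; have := h i j k; rewrite !lt_min => /andP[/andP[]].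
- move=> i; have := b1 i ord0 ord0; have := base_corner_ge1 R mn i.
  rewrite ltr_distl => c1 /andP[c2 _]; rewrite gt_eqF//; lra.
- move=> i j Sij; apply: val_inj; apply/eqP; rewrite -(eqr_nat R).
  have := b1 i ord0 ord0; have := b1 j ord0 ord0; rewrite Sij !ltr_distl.
  have := base_corner_sub R mn i j => c /andP[c1 c2] /andP[c3 c4].
  have : `|i%:R - j%:R| < 1 :> R by rewrite ltr_norml; lra.
  case: (ltngtP i j) => [ij|ij|/= ->//].
    by rewrite distrC -natrB 1?ltnW// normr_nat ltrn1; lia.
  by rewrite -natrB 1?ltnW// normr_nat ltrn1; lia.
Qed.

Lemma pos_def_base i : pos_def (cov_form (base i)).
Proof.
move=> v [j vj]; pose x : 'rV[R]_n := \row_k v k.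
have x0 : x != 0 by apply: contraNneq vj => /rowP/(_ j); rewrite !mxE => ->.
have := base_pos mn i x0; rewrite qformE meval_cov_form => h.
apply: lt_le_trans h _; rewrite le_eqVlt; apply/orP; left; apply/eqP.
by apply: eq_bigr => a _; apply: eq_bigr => b _; rewrite !mxE; ring.
Qed.

End GoodTuples.

Section Recovery.
Variables (R : realType) (n0 m0 : nat).
Local Notation n := n0.+1.
Local Notation m := m0.+1.
Variables (d d' : measure_display)
  (T : measurableType d) (P : probability T R) (Y : {RV P >-> n.-tuple R})
  (T' : measurableType d') (P' : probability T' R)
  (G : 'I_m -> {RV P' >-> n.-tuple R}) (lam : 'I_m -> R)
  (S : 'I_m -> 'M[R]_n) (o : solvers R).
Hypothesis YG : is_mixture Y G lam.
Hypothesis GS : forall i, centered_gaussian (G i) (S i).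
Hypothesis lam_gt0 : forall i, 0 < lam i.
Hypothesis o_ok : correct_solvers o.
Hypothesis S_ok : recoverable S.

Lemma mixture_alg_correct :
  output n m (exec o mixture_alg (input_state m (moment_form Y))) =
  [set (cov_form (S i), lam i) | i in [set: 'I_m]].
Proof.
have [rigid [L LB] c0 cinj] := S_ok.
have lam1 : \sum_i lam i = 1 by have [_ ->] := YG.
have S_sym i : (S i)^T = S i by have [[]] := GS i.
have [r [rinj rE]] := mixture_arrays S_sym lam_gt0 lam1 rigid o_ok
  (input_moment2 YG GS) (input_moment4 YG GS) (fun=> erefl)
  (input_moment6 YG GS) LB c0 cinj.
have sz : sized n m (input_state m (moment_form Y)) by [].
have [_ arrsE _] := runs_alg o sz.
have outE i : (cov_form (\matrix_(j < n, k < n) arrs (exec o mixture_alg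
    (input_state m (moment_form Y))) 7 ((r i * n + j) * n + k)%N),
    arrs (exec o mixture_alg (input_state m (moment_form Y))) 8 (r i)) =
    (cov_form (S i), lam i).
  have [SE lE] := rE i; rewrite arrsE; congr (cov_form _, _); last exact: lE.
  by apply/matrixP => j k; rewrite mxE; exact: SE.
(* The arrays list the components in the order r, which is a bijection, so the sets agree. *)
apply/seteqP; split=> _ [i _ <-]; last by exists (r i).
have [g _ rg] := injF_bij rinj.
by exists (g i) => //; rewrite -outE rg.
Qed.

End Recovery.

Theorem corollary1p6 (R : realType) :
  exists2 alg : prog, polynomial_time R alg &
  forall n m : nat, (1 <= m <= n - 1)%N ->
  exists U : set ('I_m -> quadform R n),
  [/\ euclidean_open U,
      exists2 q, U q & forall i, pos_def (q i) &
      exists Z : set ('I_m -> quadform R n),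
      [/\ zariski_closed Z,
          Z <> setT &
          forall (q : 'I_m -> quadform R n) (S : 'I_m -> 'M[R]_n)
            (lam : 'I_m -> R)
            (d d' : measure_display)
            (T : measurableType d) (P : probability T R)
            (Y : {RV P >-> n.-tuple R})
            (T' : measurableType d') (P' : probability T' R)
            (G : 'I_m -> {RV P' >-> n.-tuple R}),
            U q -> ~ Z q ->
            (forall i, pos_def (q i)) ->
            (forall i, centered_gaussian (G i) (S i)) ->
            (forall i, q i = cov_form (S i)) ->
            (forall i, 0 < lam i) ->
            is_mixture Y G lam ->
            forall o : solvers R, correct_solvers o ->
            output n m (exec o alg (input_state m (moment_form Y))) =
            [set (q i, lam i) | i in [set: 'I_m]]]].
Proof.
exists mixture_alg; first exact: mixture_alg_polynomial_time.
move=> n [|m0] /andP[m1 mn]; first by case/notF: m1.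
case: n mn => [|n0] mn; first by case/notF: mn.
have {}mn : (m0 < n0)%N by move: mn; rewrite subn1.
exists (@robust R n0 m0); split.
- exact: robust_open.
- exists (fun i => cov_form (base_tuple R mn i)); first exact: robust_base.
  exact: pos_def_base.
exists set0; split.
- exists [set 1]; apply/seteqP; split=> // q /(_ 1 erefl) /eqP.
  by rewrite meval1 oner_eq0.
- by move=> /seteqP[_ /(_ (fun=> cov_form 0) I)].
move=> q S lam d d' T P Y T' P' G [e e0 qe] _ _ GS qS lam_gt0 YG o o_ok.
have S_sym i : (S i)^T = S i by have [[]] := GS i.
have S_ok : recoverable S.
  by apply: qe => // i j k; rewrite qS gram_mx_cov_form// subrr normr0.
rewrite (mixture_alg_correct YG GS lam_gt0 o_ok S_ok).
by apply/seteqP; split=> _ [i _ <-]; exists i; rewrite // qS.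
Qed.
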